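(* Let $n\ge 2$ and $1\le d\le n-1$ with $d\le n-d$. The map $\phi: T^*G/P_d=G\times^{P_d}u(P_d)\to \mathcal{G}/\mathcal{Q}$, $\phi(g,Y)=g(\mathrm{Id}+t^{-1}Y+t^{-2}Y^2+\cdots)\ (\mathrm{mod}\ \mathcal{Q})$, identifies $\overline{T^*G/P_d}$ (the closure being taken in $\mathcal{G}/\mathcal{Q}$) with the affine Schubert variety $X(\kappa_d)$; that is, the closure in $\mathcal{G}/\mathcal{Q}$ of the image $\phi(T^*G/P_d)$ equals $X(\kappa_d)$.
   Context: Let $K=\mathbb{C}$, $A=K[[t]]$, $F=K((t))$, $G=SL_n(K)$, $\mathcal{G}=SL_n(F)$, $G_0=SL_n(A)$. Let $T\subset B\subset G$ be the diagonal torus and the upper triangular Borel subgroup, and let $\pi^+:G_0\to G$ be the homomorphism induced by $t\mapsto 0$. Put $\mathcal{B}=(\pi^+)^{-1}(B)$. Let $P_d\subset G$ be the maximal parabolic subgroup corresponding to omitting the simple root $\alpha_d$: $P_d=\{(a_{ij})\in SL_n(K): a_{ij}=0 \text{ for } j\le d<i\}$, so that $G/P_d$ is the Grassmannian of $d$-dimensional subspaces of $K^n$. Let $\mathcal{Q}=(\pi^+)^{-1}(P_d)=\{h\in SL_n(A): h(0)\in P_d\}$, the two-step parabolic subgroup of $\mathcal{G}$ corresponding to omitting $\alpha_0,\alpha_d$. The quotient $\mathcal{G}/\mathcal{Q}$ is a partial affine flag variety, with its usual ind-variety (Zariski) topology. Let $U(P_d)$ be the unipotent radical of $P_d$ and $u(P_d)=\mathrm{Lie}(U(P_d))$,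 i.e. the space of matrices $Y=\sum_{1\le i\le d<j\le n}a_{ij}E_{ij}$, with $E_{ij}$ the elementary matrices. The cotangent bundle is $T^*G/P_d=G\times^{P_d}u(P_d)=G\times u(P_d)/\sim$, where $(g,Y)\sim(gx,x^{-1}Yx)$ for $g\in G$, $Y\in u(P_d)$, $x\in P_d$. The map $\phi$ is well defined on these equivalence classes (the sum is finite since $Y$ is nilpotent), and it is injective and $G$-equivariant; through $\phi$ one regards $T^*G/P_d$ as a subset of $\mathcal{G}/\mathcal{Q}$. The affine Weyl group is $\widehat{W}=N(K[t,t^{-1}])/T$, where $N$ is the normalizer of $T$ in $G$; it is a Coxeter group on $s_0,\dots,s_{n-1}$. For $1\le i\le n-1$, $s_i$ is represented by the matrix $(a_{rs})$ with $a_{jj}=1$ for $j\ne i,i+1$, $a_{i\,i+1}=1$, $a_{i+1\,i}=-1$, other entries $0$. The generator $s_0$ is represented by the matrix with $(1,n)$ entry $t^{-1}$, $(n,1)$ entry $-t$, $(j,j)$ entries $1$ for $2\le j\le n-1$, and other entries $0$. The element $\kappa_d\in\widehat{W}$ is $\kappa_d=w_1w_2$ with $$w_1=u_1u_2\cdots u_d,\quad u_k=s_{n-d+k-1}s_{n-d+k-2}\cdots s_k,$$ $$w_2=v_{d-1}v_{d-2}\cdots v_1v_0,\quad v_k=s_{d+k+1}s_{d+k+2}\cdots s_{n-1}s_0s_1s_2\cdots s_k\quad (0\le k\le d-1),$$ where, if $n=2d$, $v_{d-1}$ is understood as $s_0s_1\cdots s_{d-1}$. It is represented by the diagonal matrix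 $\mathrm{diag}(tI_d, I_{n-2d}, t^{-1}I_d)$. For $w\in\widehat{W}$, the affine Schubert variety in $\mathcal{G}/\mathcal{Q}$ is $X(w)=\bigcup_{\tau\le w}\mathcal{B}\tau\mathcal{Q}\ (\mathrm{mod}\ \mathcal{Q})$, where $\le$ is the Bruhat order on $\widehat{W}$. *)

(* Defs.v *)
From HB Require Import structures.
From mathcomp Require Import all_boot all_order all_algebra perm.
From mathcomp Require Import boolp classical_sets functions cardinality fsbigop.
From mathcomp Require Import topology mpoly.
From mathcomp Require Import zify.

Set Implicit Arguments.
Unset Strict Implicit.
Unset Printing Implicit Defensive.

Import Order.TTheory GRing.Theory Num.Theory.
Local Open Scope classical_set_scope.
Local Open Scope quotient_scope.
Local Open Scope ring_scope.

Section Laurent.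
Variable K : fieldType.

Definition lbounded (f : int -> K) := exists m : int, forall i : int, i < m -> f i = 0.

(* The field K((t)); [lcoef f i] is the coefficient of t^i. *)
Record laurent := Laurent { lcoef :> int -> K; lcoefP : lbounded lcoef }.

HB.instance Definition _ := gen_eqMixin laurent.
HB.instance Definition _ := gen_choiceMixin laurent.

Implicit Types f g h : laurent.

Lemma laurentP f g : f =1 g -> f = g.
Proof.
case: f => f pf; case: g => g pg /= /funext fg.
by case: _ / fg pg => pg; congr Laurent; apply: Prop_irrelevance.
Qed.

Lemma lbounded_add f g : lbounded (fun i => f i + g i).
Proof.
have [[a Ha] [b Hb]] := (lcoefP f, lcoefP g).
exists (Num.min a b) => i; rewrite lt_min => /andP[ia ib].
by rewrite Ha // Hb // addr0.
Qed.

Lemma lbounded_opp f : lbounded (fun i => - f i).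
Proof. by have [a Ha] := lcoefP f; exists a => i /Ha ->; rewrite oppr0. Qed.

Lemma lbounded_monomial (c : K) (k : int) :
  lbounded (fun i => if i == k then c else 0).
Proof. by exists k => i ik; rewrite lt_eqF. Qed.

Lemma lbounded_mul f g : lbounded (fun k => \sum_(i \in [set: int]) f i * g (k - i)).
Proof.
have [[a Ha] [b Hb]] := (lcoefP f, lcoefP g).
exists (a + b) => k kab; apply: fsbig1 => i _.
have [ia|ai] := ltP i a; first by rewrite Ha // mul0r.
by rewrite Hb ?mulr0 // ltrBlDl (lt_le_trans kab) // lerD2r.
Qed.

Definition ladd f g := Laurent (lbounded_add f g).
Definition lopp f := Laurent (lbounded_opp f).
Definition lmonomial c k := Laurent (lbounded_monomial c k).
(* Only finitely many terms of the sum are nonzero. *)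
Definition lmul f g := Laurent (lbounded_mul f g).

Let laddA : associative ladd.
Proof. by move=> f g h; apply: laurentP => i; rewrite /= addrA. Qed.
Let laddC : commutative ladd.
Proof. by move=> f g; apply: laurentP => i; rewrite /= addrC. Qed.
Let ladd0 : left_id (lmonomial 0 0) ladd.
Proof. by move=> f; apply: laurentP => i; rewrite /= if_same add0r. Qed.
Let laddN : left_inverse (lmonomial 0 0) lopp ladd.
Proof. by move=> f; apply: laurentP => i; rewrite /= if_same addNr. Qed.

HB.instance Definition _ := GRing.isZmodule.Build laurent laddA laddC ladd0 laddN.

Lemma lmul_sum f g (a b k : int) (N : nat) :
    (forall i, i < a -> f i = 0) -> (forall i, i < b -> g i = 0) ->
    k - a - b < N%:Z ->
  lmul f g k = \sum_(i < N) f (a + i%:Z) * g (k - a - i%:Z).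
Proof.
move=> Ha Hb HN /=.
pose F i := f i * g (k - i).
have -> : \sum_(i < N) f (a + i%:Z) * g (k - a - i%:Z) =
    \sum_(i < N) F (a + i%:Z).
  by apply: eq_bigr => i _; rewrite /F opprD addrA.
rewrite (fsbig_ord _ _ (fun i : nat => F (a + i%:Z))).
rewrite -(fsbig_image `I_N (fun i : nat => a + i%:Z)); last first.
  by move=> i j _ _ /addrI [].
apply/esym/fsbig_widen => // i [_ /= nI]; rewrite /F.
have [ia|ai] := ltP i a; first by rewrite Ha // mul0r.
rewrite Hb ?mulr0 //.
have [n ein] : exists n : nat, i = a + n%:Z.
  by exists `|i - a|%N; lia.
rewrite ein in nI *; rewrite ltNge; apply/negP => bk; apply: nI.
by exists n => //=; lia.
Qed.

Lemma lmul_vanish f g (a b : int) :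
    (forall i, i < a -> f i = 0) -> (forall i, i < b -> g i = 0) ->
  forall i, i < a + b -> lmul f g i = 0.
Proof.
move=> Ha Hb i iab; rewrite (@lmul_sum f g a b i 0) ?big_ord0 //.
by rewrite -addrA -opprD subr_lt0.
Qed.

Let lmulC : commutative lmul.
Proof.
move=> f g; apply: laurentP => k /=.
rewrite (reindex_fsbigT (fun i : int => k - i)); last first.
  by exists (fun i : int => k - i) => i; rewrite subKr.
by apply: eq_fsbigr => i _; rewrite subKr mulrC.
Qed.

Let lmulA : associative lmul.
Proof.
move=> f g h; apply: laurentP => k.
have [[a Ha] [b Hb] [c Hc]] := And3 (lcoefP f) (lcoefP g) (lcoefP h).
have Hfg := lmul_vanish Ha Hb; have Hgh := lmul_vanish Hb Hc.
pose N := (absz (k - a - b - c)%R).+1.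
have HN : k - a - b - c < N%:Z by rewrite /N; lia.
rewrite (@lmul_sum _ _ a (b + c) k N) //; last by rewrite opprD addrA.
rewrite (@lmul_sum _ _ (a + b) c k N) //; last by rewrite opprD addrA.
transitivity (\sum_(j < N) \sum_(l < N)
    f (a + j%:Z) * (g (b + l%:Z) * h (k - a - j%:Z - b - l%:Z))).
  apply: eq_bigr => j _; rewrite -mulr_sumr; congr (_ * _).
  by apply: (lmul_sum Hb Hc); lia.
transitivity (\sum_(i < N) \sum_(j < N)
    f (a + j%:Z) * g (b + i%:Z - j%:Z) * h (k - a - b - i%:Z)); last first.
  apply: eq_bigr => i _; rewrite -mulr_suml opprD addrA; congr (_ * _).
  have -> : lmul f g (a + b + i%:Z) =
      \sum_(j < N) f (a + j%:Z) * g (a + b + i%:Z - a - j%:Z).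
    apply: (lmul_sum Ha Hb).
    by have := ltn_ord i; lia.
  by apply: eq_bigr => j _; congr (_ * g _); lia.
rewrite [RHS]exchange_big; apply: eq_bigr => j _ /=.
rewrite -[LHS](big_mkord xpredT (fun l : nat =>
  f (a + j%:Z) * (g (b + l%:Z) * h (k - a - j%:Z - b - l%:Z)))).
rewrite -[RHS](big_mkord xpredT (fun i : nat =>
  f (a + j%:Z) * g (b + i%:Z - j%:Z) * h (k - a - b - i%:Z))).
have jN : (j <= N)%N by apply: ltnW.
rewrite [RHS](big_cat_nat (leq0n j) jN) //= [X in _ = X + _]big_nat_cond.
rewrite [X in _ = X + _]big1 ?add0r; last first.
  by move=> i ij; rewrite Hb ?mulr0 ?mul0r //; lia.
transitivity (\sum_(0 <= l < N - j) f (a + j%:Z) *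
    g (b + (l + j)%N%:Z - j%:Z) * h (k - a - b - (l + j)%N%:Z)); last first.
  by rewrite -(big_addn 0 N j xpredT (fun i : nat =>
    f (a + j%:Z) * g (b + i%:Z - j%:Z) * h (k - a - b - i%:Z))) add0n.
have NjN : (N - j <= N)%N by rewrite leq_subr.
rewrite [LHS](big_cat_nat (leq0n (N - j)) NjN) //= [X in _ + X]big_nat_cond.
rewrite [X in _ + X]big1 ?addr0; last first.
  by move=> l Nl; rewrite Hc ?mulr0 //; lia.
apply: eq_bigr => l _; by rewrite mulrA; congr (_ * g _ * h _); lia.
Qed.

Let lmul1 : left_id (lmonomial 1 0) lmul.
Proof.
move=> f; apply: laurentP => k /=.
rewrite -(fsbig_widen [set 0]) //; last first.
  by move=> i [_ /= /eqP/negPf ->]; rewrite mul0r.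
by rewrite fsbig_set1 eqxx mul1r subr0.
Qed.

Let lmulD : left_distributive lmul +%R.
Proof.
move=> f g h; apply: laurentP => k.
have [[a Ha] [b Hb] [c Hc]] := And3 (lcoefP f) (lcoefP g) (lcoefP h).
pose m := Num.min a b.
have Hf i : i < m -> f i = 0 by rewrite lt_min => /andP[/Ha].
have Hg i : i < m -> g i = 0 by rewrite lt_min => /andP[_ /Hb].
have Hs i : i < m -> (f + g : laurent) i = 0.
  by move=> im; rewrite /= Hf // Hg // addr0.
pose N := (absz (k - m - c)%R).+1.
have HN : k - m - c < N%:Z by rewrite /N; lia.
have -> : (lmul f h + lmul g h : laurent) k = lmul f h k + lmul g h k by [].
rewrite (lmul_sum Hs Hc HN) (lmul_sum Hf Hc HN) (lmul_sum Hg Hc HN).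
by rewrite -big_split; apply: eq_bigr => i _; rewrite /= mulrDl.
Qed.

Let l1_neq0 : lmonomial 1 0 != 0.
Proof.
apply/eqP => /(congr1 (fun f : laurent => f 0)) /eqP.
by rewrite /= oner_eq0.
Qed.

HB.instance Definition _ := GRing.Zmodule_isComNzRing.Build laurent
  lmulA lmulC lmul1 lmulD l1_neq0.


Definition lconst (c : K) : laurent := lmonomial c 0.

Let lconst_zmod : zmod_morphism lconst.
Proof. by move=> a b; apply: laurentP => i /=; case: eqP; rewrite ?subr0. Qed.

Let lconst_monoid : monoid_morphism lconst.
Proof.
split=> // a b; apply: laurentP => k /=.
rewrite -(fsbig_widen [set 0]) //; last first.
  by move=> i [_ /= /eqP/negPf ->]; rewrite mul0r.
by rewrite fsbig_set1 eqxx subr0; case: eqP; rewrite ?mulr0.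
Qed.

HB.instance Definition _ := GRing.isZmodMorphism.Build K laurent lconst lconst_zmod.
HB.instance Definition _ :=
  GRing.isMonoidMorphism.Build K laurent lconst lconst_monoid.

Definition lvar : laurent := lmonomial 1 1.
Definition lvarV : laurent := lmonomial 1 (-1).

Lemma lvarVK : lvarV * lvar = 1.
Proof.
apply: laurentP => k; rewrite /= -(fsbig_widen [set -1]) //; last first.
  by move=> i [_ /= /eqP/negPf ->]; rewrite mul0r.
by rewrite fsbig_set1 eqxx mul1r opprK -subr_eq0 addrK.
Qed.

(* Membership in the subrings K[[t]] and K[t, t^-1] of K((t)) *)
Definition power_series : set laurent := [set f | forall i : int, i < 0 -> f i = 0].
Definition laurent_poly : set laurent :=
  [set f | exists m : int, forall i, m < i -> f i = 0].

End Laurent.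

Section SL.
Variables (n : nat) (R : comNzRingType).

Record SL := MkSL { slmx :> 'M[R]_n; _ : \det slmx == 1 }.

HB.instance Definition _ := [isSub for slmx].
HB.instance Definition _ := [Choice of SL by <:].

Lemma det_SL (g : SL) : \det g = 1.
Proof. by case: g => g /= /eqP. Qed.

Let det_one : \det (1%:M : 'M[R]_n) == 1.
Proof. by rewrite det1. Qed.
Let det_mul (g h : SL) : \det (g *m h) == 1.
Proof. by rewrite det_mulmx !det_SL mulr1. Qed.
Let det_inv (g : SL) : \det (\adj g) == 1.
Proof.
have := congr1 determinant (mul_mx_adj g).
by rewrite det_mulmx det_SL mul1r det1 => ->.
Qed.

Definition SLone := MkSL det_one.
Definition SLmul g h := MkSL (det_mul g h).
Definition SLinv g := MkSL (det_inv g).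

Let SLmulA : associative SLmul.
Proof. by move=> f g h; apply: val_inj; rewrite /= mulmxA. Qed.
Let SLmul1 : left_id SLone SLmul.
Proof. by move=> g; apply: val_inj; rewrite /= mul1mx. Qed.
Let SLmulr1 : right_id SLone SLmul.
Proof. by move=> g; apply: val_inj; rewrite /= mulmx1. Qed.
Let SLmulV : left_inverse SLone SLinv SLmul.
Proof. by move=> g; apply: val_inj; rewrite /= mul_adj_mx det_SL. Qed.
Let SLmulrV : right_inverse SLone SLinv SLmul.
Proof. by move=> g; apply: val_inj; rewrite /= mul_mx_adj det_SL. Qed.

HB.instance Definition _ := isGroup.Build SL SLmulA SLmul1 SLmulr1 SLmulV SLmulrV.

Lemma slmxM (g h : SL) : slmx (g * h)%g = g *m h. Proof. by []. Qed.
Lemma slmx1 : slmx 1%g = 1%:M. Proof. by []. Qed.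

End SL.

Section Groups.
Variables (K : fieldType) (n : nat).
Notation F := (laurent K).

Lemma det_lconst (g : SL n K) : \det (map_mx (@lconst K) g) == 1.
Proof. by rewrite det_map_mx det_SL rmorph1. Qed.

Definition constSL (g : SL n K) : SL n F := MkSL (det_lconst g).

Lemma constSLM (g h : SL n K) : constSL (g * h)%g = (constSL g * constSL h)%g.
Proof. by apply: val_inj; rewrite /= map_mxM. Qed.

Lemma constSLV (g : SL n K) : constSL g^-1%g = (constSL g)^-1%g.
Proof. by apply: val_inj; rewrite /= map_mx_adj. Qed.

Definition borel : set (SL n K) :=
  [set g | forall i j : 'I_n, (j < i)%N -> g i j = 0].

Definition torus : set (SL n K) :=
  [set g | forall i j : 'I_n, i != j -> g i j = 0].

Definition max_parabolic (d : nat) : set (SL n K) :=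
  [set g | forall i j : 'I_n, (j < d <= i)%N -> g i j = 0].

Definition SL_power_series : set (SL n F) :=
  [set g | forall i j, power_series (g i j)].

Definition at_t0 (M : 'M[F]_n) : 'M[K]_n := map_mx (fun f : F => f 0) M.

(* The preimage of P under the map SL_n(K[[t]]) -> SL_n(K), t |-> 0 *)
Definition parahoric (P : set (SL n K)) : set (SL n F) :=
  [set g | SL_power_series g /\ exists2 p, P p & at_t0 g = p].

Definition iwahori : set (SL n F) := parahoric borel.

Definition two_step (d : nat) : set (SL n F) := parahoric (max_parabolic d).


Lemma max_parabolicM d g h :
  max_parabolic d g -> max_parabolic d h -> max_parabolic d (g * h)%g.
Proof.
move=> Pg Ph i j /andP[jd di]; rewrite slmxM mxE big1 // => k _.
have [kd|dk] := ltnP k d; first by rewrite Pg ?mul0r // kd.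
by rewrite Ph ?mulr0 // jd.
Qed.

Lemma max_parabolicV d g : max_parabolic d g -> max_parabolic d g^-1%g.
Proof.
move=> Pg.
pose U : 'M[K]_n := \matrix_(i, j) ((i == j) && (d <= i)%N)%:R.
have U1 (M : 'M[K]_n) i j : (U *m M) i j = (d <= i)%:R * M i j.
  rewrite mxE (bigD1 i) //= mxE eqxx big1 ?addr0 // => k /negPf ki.
  by rewrite mxE eq_sym ki mul0r.
have UE (M : 'M[K]_n) : (forall i j : 'I_n, (j < d <= i)%N -> M i j = 0) <->
    (U *m M <= U)%MS.
  split=> [HM | /submxP[D HD] i j /andP[jd di]].
    apply/submxP; exists (U *m M); apply/matrixP => i j.
    rewrite U1 [RHS]mxE (bigD1 j) //= [U j j]mxE eqxx big1 ?addr0; last first.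
      by move=> k /negPf kj; rewrite [U k j]mxE kj mulr0.
    rewrite U1; have [di|_] := boolP (d <= i)%N; last by rewrite !mul0r.
    by rewrite !mul1r; case: leqP => jd /=; rewrite ?mulr1 // HM ?mul0r // jd.
  have := U1 M i j; rewrite di mul1r => <-; rewrite HD mxE big1 // => k _.
  rewrite mxE; case: eqP => [->|]; rewrite ?mulr0 //=.
  by rewrite leqNgt jd mulr0.
have gV : g *m g^-1%g = 1%:M by rewrite -slmxM mulgV.
have uV : row_free (g : 'M[K]_n) by apply/row_freeP; exists g^-1%g.
have Ug : (U *m g <= U)%MS by apply/UE.
have UUg : (U <= U *m g)%MS.
  by rewrite -(geq_leqif (mxrank_leqif_sup Ug)) mxrankMfree.
by apply/UE; have := submxMr g^-1%g UUg; rewrite -mulmxA gV mulmx1.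
Qed.

Lemma lcoef_sum I (r : seq I) (P : pred I) (f : I -> F) k :
  (\sum_(i <- r | P i) f i : F) k = \sum_(i <- r | P i) f i k.
Proof. by elim/big_rec2: _ => [|i y x _ <-] //=; rewrite if_same. Qed.

Lemma lcoef_constM c (f : F) k : (lconst c * f : F) k = c * f k.
Proof.
rewrite /= -(fsbig_widen [set 0]) //; last first.
  by move=> i [_ /= /eqP/negPf ->]; rewrite mul0r.
by rewrite fsbig_set1 eqxx subr0.
Qed.

Lemma two_step_constM d x q :
  max_parabolic d x -> two_step d q -> two_step d (constSL x * q)%g.
Proof.
have E i j k : (constSL x * q)%g i j k = \sum_l x i l * q l j k.
  rewrite slmxM mxE lcoef_sum; apply: eq_bigr => l _.
  by rewrite mxE lcoef_constM.
move=> Px [Aq [p Pp qp]]; split.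
  by move=> i j k k0; rewrite E big1 // => l _; rewrite Aq // mulr0.
exists (x * p)%g; first exact: max_parabolicM.
rewrite slmxM -qp; apply/matrixP => i j; rewrite mxE E mxE.
by apply: eq_bigr => l _; rewrite mxE.
Qed.

Section Flag.
Variable d : nat.

Definition coset (g : SL n F) : set (SL n F) :=
  [set (g * q)%g | q in two_step d].

Definition flag_eq (g h : SL n F) : bool := `[< coset g = coset h >].

Lemma flag_eq_equiv : equiv_class_of flag_eq.
Proof.
split=> [g|g h|h g k]; first exact/asboolP.
  by apply/asboolP/asboolP => ->.
by move=> /asboolP gh /asboolP hk; apply/asboolP; rewrite gh.
Qed.

Canonical flag_equiv : equiv_rel (SL n F) := EquivRelPack flag_eq_equiv.

(* The partial affine flag variety SL_n(K((t))) / Q, Q = two_step d *)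
Definition flag := {eq_quot flag_equiv}.
HB.instance Definition _ := Choice.on flag.
HB.instance Definition _ := Quotient.on flag.

Definition flag_pi (g : SL n F) : flag := \pi_flag g.

Lemma flag_pi_constM g x : max_parabolic d x ->
  flag_pi (g * constSL x)%g = flag_pi g.
Proof.
move=> Px; apply/eqquotP/asboolP/seteqP; split=> _ [q Qq <-].
  by exists (constSL x * q)%g; [exact: two_step_constM|rewrite mulgA].
exists (constSL x^-1 * q)%g.
  exact/two_step_constM/Qq/max_parabolicV.
by rewrite constSLV -mulgA mulVKg.
Qed.

End Flag.

End Groups.

(* The ind-variety structure of the partial affine flag variety.  Let
   E0 = A^n and E1 = <e_1, ..., e_d> + t A^n, where A = K[[t]].  Since Q is the
   stabiliser of (E0, E1) in SL_n(K((t))), the map gQ |-> (g E0, g E1) identifies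
   SL_n(K((t))) / Q with a set of pairs of lattices in K((t))^n.  For each m, the
   points such that t^m A^n <= g E1 <= g E0 <= t^-m A^n form a projective variety,
   namely a closed subvariety of a product of two Grassmannians of subspaces of
   t^-m A^n / t^m A^n = K^(n * 2m).  A set is closed when its trace on each of
   these varieties is. *)
Section IndVariety.
Variables (K : fieldType) (n : nat).
Notation F := (laurent K).

Definition lattice0 : set 'cV[F]_n := [set v | forall i, power_series (v i 0)].

Definition lattice1 (d : nat) : set 'cV[F]_n :=
  [set v | lattice0 v /\ forall i : 'I_n, (d <= i)%N -> v i 0 (0 : int) = 0].

Definition act_lattice (g : SL n F) (L : set 'cV[F]_n) : set 'cV[F]_n :=
  [set slmx g *m v | v in L].

(* The class in K^(n * 2m) of a vector of t^-m A^n modulo t^m A^n: its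
   coefficients at t^-m, ..., t^(m-1) *)
Definition window (m : nat) (v : 'cV[F]_n) : 'rV[K]_(n * (m + m)) :=
  mxvec (\matrix_(i < n, k < m + m) v i 0 (k%:Z - m%:Z)).

(* The rows of M form a basis of L / t^m A^n.  The condition forces
   t^m A^n <= L <= t^-m A^n. *)
Definition frames (m k : nat) (M : 'M[K]_(k, n * (m + m))) (L : set 'cV[F]_n) :=
  row_free M /\
  forall v : 'cV[F]_n, L v <->
    (forall i (j : int), j < - m%:Z -> v i 0 j = 0) /\ (window m v <= M)%MS.

(* The k x k minors of M, with repetitions *)
Definition plucker (k N : nat) (M : 'M[K]_(k, N)) :
    'rV[K]_#|{: {ffun 'I_k -> 'I_N}}| :=
  \row_s \det (colsub (enum_val s : {ffun 'I_k -> 'I_N}) M).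

(* Zero loci in a product of two Grassmannians are given by polynomials in the
   two vectors of Pluecker coordinates.  There is no need to require them to be
   bihomogeneous, as below their vanishing is tested on all frames, hence on
   all rescalings of the Pluecker vectors.  The dimensions k0 and k1 are
   determined by m, n and d. *)
Definition plucker_eval (m k0 k1 : nat)
    (M0 : 'M[K]_(k0, n * (m + m))) (M1 : 'M[K]_(k1, n * (m + m)))
    (p : {mpoly K[#|{: {ffun 'I_k0 -> 'I_(n * (m + m))}}| +
                   #|{: {ffun 'I_k1 -> 'I_(n * (m + m))}}|]}) : K :=
  p.@[fun i => row_mx (plucker M0) (plucker M1) 0 i].

Variable d : nat.

Definition zariski_closed (Z : set (flag K n d)) : Prop :=
  forall m k0 k1 : nat, exists S : set {mpoly K[_]},
    forall g (M0 : 'M[K]_(k0, n * (m + m))) (M1 : 'M[K]_(k1, n * (m + m))),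
      frames M0 (act_lattice g lattice0) ->
      frames M1 (act_lattice g (lattice1 d)) ->
    Z (flag_pi d g) <-> forall p, S p -> plucker_eval M0 M1 p = 0.

Let zopen (U : set (flag K n d)) := zariski_closed (~` U).

Let zopenT : zopen setT.
Proof.
move=> m k0 k1; exists [set 1] => g M0 M1 _ _; rewrite setCT; split=> //.
by move/(_ 1 erefl)/eqP; rewrite /plucker_eval meval1 oner_eq0.
Qed.

Let zopenI : setI_closed zopen.
Proof.
move=> U V cU cV m k0 k1.
have [[S HS] [S' HS']] := (cU m k0 k1, cV m k0 k1).
exists [set p * q | p in S & q in S'] => g M0 M1 f0 f1; rewrite setCI.
have {HS}HS := HS _ _ _ f0 f1; have {HS'}HS' := HS' _ _ _ f0 f1.
split=> [[/HS H | /HS' H] _ [p Sp [q Sq <-]] | H].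
- by rewrite /plucker_eval mevalM [p.@[_]](H p Sp) mul0r.
- by rewrite /plucker_eval mevalM [q.@[_]](H q Sq) mulr0.
have [/HS ? | nU] := EM ((~` U) (flag_pi d g)); first by left; apply/HS.
right; apply/HS' => q Sq.
have [p Sp /eqP p0] : exists2 p, S p & plucker_eval M0 M1 p <> 0.
  apply: contrapT => nE; apply: nU; apply/HS => p Sp.
  by apply: contrapT => p0; apply: nE; exists p.
have : plucker_eval M0 M1 (p * q) = 0 by apply: H; exists p => //; exists q.
rewrite /plucker_eval mevalM => /eqP; rewrite mulf_eq0.
by rewrite (negPf p0) => /eqP.
Qed.

Let zopen_bigU (I : Type) (f : I -> set (flag K n d)) :
  (forall i, zopen (f i)) -> zopen (\bigcup_i f i).
Proof.
move=> cf m k0 k1.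
have /choice[S HS] : forall i, exists S : set {mpoly K[_]},
    forall g (M0 : 'M[K]_(k0, n * (m + m))) (M1 : 'M[K]_(k1, n * (m + m))),
      frames M0 (act_lattice g lattice0) ->
      frames M1 (act_lattice g (lattice1 d)) ->
    (~` f i) (flag_pi d g) <-> forall p, S p -> plucker_eval M0 M1 p = 0.
  by move=> i; apply: cf.
exists (\bigcup_i S i) => g M0 M1 f0 f1; split=> [H p [i _ Sip] | H].
  have /(HS i _ _ _ f0 f1) : (~` f i) (flag_pi d g).
    by move=> fi; apply: H; exists i.
  exact.
move=> [i _]; apply/(HS i _ _ _ f0 f1) => p Sip.
by apply: H; exists i.
Qed.

HB.instance Definition _ :=
  isOpenTopological.Build (flag K n d) zopenT zopenI zopen_bigU.

End IndVariety.

Section Cotangent.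
Variables (K : fieldType) (n d : nat).
Notation F := (laurent K).

(* The Lie algebra of the unipotent radical of P_d *)
Definition in_nilradical : pred 'M[K]_n := fun Y =>
  [forall i : 'I_n, forall j : 'I_n, ~~ (i < d <= j)%N ==> (Y i j == 0)].

Record nilradical := Nilradical { nilmx :> 'M[K]_n; _ : in_nilradical nilmx }.

HB.instance Definition _ := [isSub for nilmx].
HB.instance Definition _ := [Choice of nilradical by <:].

Definition cotangent_eq (a b : SL n K * nilradical) : bool :=
  `[< exists x, [/\ max_parabolic d x, b.1 = (a.1 * x)%g &
       b.2 = x^-1%g *m a.2 *m x :> 'M[K]_n] >].

Lemma cotangent_eq_equiv : equiv_class_of cotangent_eq.
Proof.
have sym a b : cotangent_eq a b -> cotangent_eq b a.
  move=> /asboolP[x [Px b1 b2]]; apply/asboolP; exists x^-1%g; split.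
  - exact: max_parabolicV.
  - by rewrite b1 mulgK.
  rewrite b2 invgK !mulmxA -slmxM mulgV slmx1 mul1mx -mulmxA -slmxM mulgV.
  by rewrite slmx1 mulmx1.
split=> [a|a b|a b c].
- apply/asboolP; exists 1%g; split; rewrite ?mulg1 //.
    by move=> i j /andP[jd di]; rewrite slmx1 mxE -val_eqE gtn_eqF // (leq_trans jd).
  by rewrite invg1 slmx1 mul1mx mulmx1.
- by apply/idP/idP; apply: sym.
move=> /asboolP[x [Px a1 a2]] /asboolP[y [Py b1 b2]].
apply/asboolP; exists (x * y)%g; split; first exact: max_parabolicM.
  by rewrite b1 a1 mulgA.
by rewrite b2 a2 invgM !slmxM !mulmxA.
Qed.

Canonical cotangent_equiv : equiv_rel (SL n K * nilradical) :=
  EquivRelPack cotangent_eq_equiv.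

Definition cotangent := {eq_quot cotangent_equiv}.

(* Id + t^-1 Y + t^-2 Y^2 + ..., where Y^n = 0 *)
Definition geom_mx (Y : 'M[K]_n) : 'M[F]_n :=
  \sum_(k < n) lvarV K ^+ k *: map_mx (@lconst K) (Y ^+ k).

Lemma det_geom (Y : nilradical) : \det (geom_mx Y) == 1.
Proof.
have Y0 (i j : 'I_n) : ~~ (i < d <= j)%N -> Y i j = 0.
  by case: Y => Y /= /forallP/(_ i)/forallP/(_ j)/implyP H /H/eqP.
have Y2 : (Y : 'M[K]_n) ^+ 2 = 0.
  apply/matrixP => i j; rewrite expr2 mxE [RHS]mxE big1 // => k _.
  have [kd|dk] := ltnP k d; last by rewrite [Y k j]Y0 ?mulr0 // ltnNge dk.
  by rewrite Y0 ?mul0r // negb_and [(d <= k)%N]leqNgt kd orbT.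
have Yk k (i j : 'I_n) : (j <= i)%N -> ((Y : 'M[K]_n) ^+ k.+1) i j = 0.
  move=> ji; case: k => [|k].
    rewrite expr1 Y0 //; apply/negP => /andP[id dj].
    by have := leq_trans id (leq_trans dj ji); rewrite ltnn.
  by rewrite -addn2 exprD Y2 mulr0 mxE.
have E (i j : 'I_n) : (j <= i)%N -> geom_mx Y i j = (i == j)%:R.
  move=> ji; rewrite /geom_mx summxE.
  have n0 : (0 < n)%N by apply: leq_trans (ltn_ord i).
  rewrite (bigD1 (Ordinal n0)) //= big1 ?addr0.
    by rewrite !mxE expr0 mul1r rmorph_nat.
  case=> -[|k] //= kn _.
  by rewrite mxE [map_mx _ _ _ _]mxE Yk ?rmorph0 ?mulr0.
apply/eqP; rewrite -det_tr det_trig.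
  by rewrite big1 // => i _; rewrite mxE E // eqxx.
apply/is_trig_mxP => i j ij.
by rewrite mxE (E _ _ (ltnW ij)) -val_eqE gtn_eqF.
Qed.

Definition geomSL (Y : nilradical) : SL n F := MkSL (det_geom Y).

Definition phi_rep (a : SL n K * nilradical) : flag K n d :=
  flag_pi d (constSL a.1 * geomSL a.2)%g.

Definition phi (a : cotangent) : flag K n d := phi_rep (repr a).

Lemma phi_rep_eq a b : cotangent_eq a b -> phi_rep a = phi_rep b.
Proof.
move=> /asboolP[x [Px b1 b2]]; rewrite /phi_rep b1.
rewrite -(flag_pi_constM _ Px); congr flag_pi.
rewrite constSLM -!mulgA; congr (_ * _)%g; apply: val_inj => /=.
have xV : slmx x *m x^-1%g = 1%:M by rewrite -slmxM mulgV.
rewrite mulmx_suml mulmx_sumr; apply: eq_bigr => k _.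
rewrite -scalemxAl -scalemxAr -!map_mxM; congr (_ *: map_mx _ _).
elim: (nat_of_ord k) => [|m IHm]; first by rewrite !expr0 mul1mx mulmx1.
by rewrite !exprS -!mulmxA IHm b2 !mulmxA xV mul1mx.
Qed.

Lemma phi_pi a : phi (\pi_cotangent a) = phi_rep a.
Proof.
apply: phi_rep_eq; apply/(@eqquotP _ cotangent_equiv cotangent).
exact: reprK.
Qed.

End Cotangent.

Section Schubert.
Variables (K : fieldType) (n : nat).
Notation F := (laurent K).
Local Open Scope group_scope.

Definition const_torus : set (SL n F) := [set constSL x | x in @torus K n].

(* The group N(K[t, t^-1]), whose quotient by const_torus is the affine Weyl
   group.  The elements of the latter are represented by elements of the former,
   and compared with weyl_eq. *)
Definition affine_normalizer : set (SL n F) :=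
  [set g : SL n F | (forall i j, laurent_poly (g i j)) /\
    (forall x, const_torus x -> const_torus (x ^ g) /\ const_torus (x ^ g^-1))].

Definition weyl_eq (g h : SL n F) : Prop := const_torus (g^-1 * h).

Definition swap_mx (p q : nat) (a b : F) : 'M[F]_n :=
  \matrix_(i, j)
    if (i == p :> nat) && (j == q :> nat) then a else
    if (i == q :> nat) && (j == p :> nat) then b else
    ((i == j) && (i != p :> nat) && (i != q :> nat))%:R%R.

(* Rows and columns are numbered from 0. *)
Definition simple_mx (i : nat) : 'M[F]_n :=
  if i is i'.+1 then swap_mx i' i 1%R (- 1)%R
  else swap_mx 0 n.-1 (lvarV K) (- lvar K)%R.

(* The default value is irrelevant, see simple_reflE. *)
Definition simple_refl (i : nat) : SL n F := insubd (1 : SL n F) (simple_mx i).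

Lemma det_swap_mx p q a b : (p < q < n)%N -> (a * b = -1 :> F)%R ->
  \det (swap_mx p q a b) = 1%R.
Proof.
case/andP=> pq qn ab.
pose P := Ordinal (ltn_trans pq qn); pose Q := Ordinal qn.
have PQ : P != Q by rewrite -val_eqE /= ltn_eqF.
pose D : 'rV[F]_n := (\row_i if i == P then a else if i == Q then b else 1)%R.
have -> : swap_mx p q a b = (diag_mx D *m tperm_mx P Q)%R.
  apply/matrixP => i j; rewrite mul_diag_mx !mxE.
  have vP (k : 'I_n) : (k == p :> nat) = (k == P) by [].
  have vQ (k : 'I_n) : (k == q :> nat) = (k == Q) by [].
  rewrite !vP !vQ.
  have [->|iP] := eqVneq i P.
    rewrite tpermL (negPf PQ) [Q == j]eq_sym andbF /=.
    by case: eqP => _; rewrite ?mulr1 ?mulr0.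
  have [->|iQ] := eqVneq i Q.
    rewrite tpermR [P == j]eq_sym andbF /=.
    by case: eqP => _; rewrite ?mulr1 ?mulr0.
  by rewrite tpermD 1?eq_sym // !andbT mul1r.
rewrite det_mulmx det_diag det_perm odd_tperm PQ expr1.
rewrite (bigD1 P) //= (bigD1 Q) /= 1?eq_sym //= big1 => [|i /andP[/negPf iP /negPf iQ]].
  by rewrite !mxE eqxx [Q == P]eq_sym (negPf PQ) eqxx mulr1 ab mulrNN mulr1.
by rewrite mxE iP iQ.
Qed.

Lemma simple_reflE i : (1 < n)%N -> (i < n)%N ->
  slmx (simple_refl i) = simple_mx i.
Proof.
move=> n1 ilt; rewrite [LHS]val_insubd.
suff -> : \det (simple_mx i) == 1%R by [].
case: i ilt => [_|i ilt]; apply/eqP; apply: det_swap_mx.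
- by lia.
- by rewrite mulrN lvarVK.
- by rewrite ltnSn.
by rewrite mul1r.
Qed.

Definition word_prod (w : seq nat) : SL n F := \prod_(i <- w) simple_refl i.

Definition expressible (g : SL n F) (k : nat) : Prop :=
  exists w : seq nat,
    [/\ size w = k, all (gtn n) w & weyl_eq (word_prod w) g].

Definition weyl_length (g : SL n F) : nat :=
  xget 0%N [set k | expressible g k /\ forall j, expressible g j -> (k <= j)%N].

Definition reflection (r : SL n F) : Prop :=
  exists i x, [/\ (i < n)%N, affine_normalizer x & r = simple_refl i ^ x].

Definition bruhat_step (u w : SL n F) : Prop :=
  exists r, [/\ reflection r, weyl_eq (u * r) w &
                (weyl_length u < weyl_length w)%N].

Inductive bruhat (u : SL n F) : SL n F -> Prop :=
| bruhat_refl w : weyl_eq u w -> bruhat u w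
| bruhat_trans v w : bruhat u v -> bruhat_step v w -> bruhat u w.

Definition schubert (d : nat) (w : SL n F) : set (flag K n d) :=
  \bigcup_(tau in [set tau | affine_normalizer tau /\ bruhat tau w])
    [set flag_pi d (b * tau * q) | b in @iwahori K n & q in @two_step K n d].

Section Kappa.
Variable d : nat.

Definition u_word (k : nat) : seq nat := rev (iota k (n - d)).
Definition v_word (k : nat) : seq nat :=
  iota (d + k).+1 (n - (d + k).+1) ++ iota 0 k.+1.
Definition w1_word : seq nat := flatten [seq u_word k | k <- iota 1 d].
Definition w2_word : seq nat := flatten [seq v_word k | k <- rev (iota 0 d)].

Definition kappa : SL n F := word_prod w1_word * word_prod w2_word.

End Kappa.

End Schubert.

(* Main.v *)
(* Write E0 = A^n and E1 = <e_1, ..., e_d> + t A^n. Both sides are equal to the locus Z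
   of the cosets gQ such that t E0 <= g E1 <= E0, a bundle over the Grassmannian of
   the d-dimensional subspaces g E1 / t E0 of K^n.

   Closure. Z is closed, since its conditions are linear equations in the Pluecker
   coordinates of g E1, and it contains the image of phi. Conversely, a point of Z
   is of the form h q with h in SL_n(K) and q stabilising E1, and q acts on
   t^-1 E1 / E1 by a matrix a; the point lies in the image of phi as soon as the lower
   right block a22 is invertible. Multiplying q on the left by the lower shear
   1 + s t X replaces a22 by a22 + s X a12, which is invertible for almost all s if X
   is well chosen, so that polynomials vanishing on the image of phi vanish at s = 0.

   Schubert variety. Monomial matrices act on the vectors t^a e_i, numbered by
   i - a n, through affine permutations f of the integers, and Z becomes a condition
   on the values of f at 0, ..., n - 1. The exchange condition translates Bruhat steps
   into exchanges of two values of f. The condition is inherited downwards, and from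
   any f satisfying it one climbs to kappa, up to the Weyl group of P_d, by exchanges
   that increase the sum of the f(i)^2. The Bruhat decomposition of SL_n(F) reduces Z
   to its monomial matrices. *)

Require Import Defs.
From mathcomp Require Import all_boot all_order all_algebra perm.
From mathcomp Require Import boolp classical_sets functions cardinality fsbigop.
From mathcomp Require Import reals topology complex mpoly.
From mathcomp Require Import zify ring.

(** Closed sets are tested one window t^-m A^n / t^m A^n at a time, so a curve through a point of Z
    must stay in one window and move its frames polynomially. Hence the shear is rewritten as left
    multiplication of g by 1 + s t W with W constant and W^2 = 0: it preserves every t^k A^n and
    acts on frames by an invertible matrix affine in s. Characteristic zero supplies enough values
    of s.

    On the Schubert side, the permutation of [kappa] is increasing on 0, ..., d - 1 and on d, ..., n
    - 1, so [kappa] is the shortest element of its coset modulo the Weyl group of P_d. A monomial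
    matrix in Z need not lie below [kappa] itself, which is why the climb carries a right factor y
    from that group. Lengths are minima over words, with a default value when there is no word, so
    comparisons of lengths carry expressibility along; it spreads from [kappa] through the
    exchanges.

    Lattice inclusions are encoded as entrywise valuation bounds between two weight functions, a
    form stable under products, inverses and determinants. *)

Set Implicit Arguments.
Unset Strict Implicit.
Unset Printing Implicit Defensive.

(** * Valuations and leading coefficients in K((t)) *)

Section LaurentValuation.
Import Order.TTheory GRing.Theory Num.Theory.
Local Open Scope classical_set_scope.
Local Open Scope ring_scope.
Variable K : fieldType.
Implicit Types (f g : laurent K) (c : K) (k : int).

(** A lower bound rather than a valuation function: zero needs no special value, and sums and
    products need no case distinction. *)
Definition val_ge k f := forall i, i < k -> f i = 0.

Lemma coefD f g i : (f + g) i = f i + g i. Proof. by []. Qed.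

Lemma coefN f i : (- f) i = - f i. Proof. by []. Qed.

Lemma coef1 i : (1 : laurent K) i = (i == 0)%:R.
Proof. by rewrite /=; case: eqP. Qed.

Lemma val_geW k l f : l <= k -> val_ge k f -> val_ge l f.
Proof. by move=> lk fk i il; apply: fk; apply: lt_le_trans lk. Qed.

Lemma val_ge0 k : val_ge k 0.
Proof. by move=> i _ /=; rewrite if_same. Qed.

Lemma val_geD k f g : val_ge k f -> val_ge k g -> val_ge k (f + g).
Proof. by move=> fk gk i ik /=; rewrite fk // gk // addr0. Qed.

Lemma val_geN k f : val_ge k f -> val_ge k (- f).
Proof. by move=> fk i ik /=; rewrite fk // oppr0. Qed.

Lemma val_ge_sum I (r : seq I) (P : pred I) (f : I -> laurent K) k :
  (forall i, P i -> val_ge k (f i)) -> val_ge k (\sum_(i <- r | P i) f i).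
Proof. by move=> fk; elim/big_ind: _ => //; [exact: val_ge0|exact: val_geD]. Qed.

Lemma val_geM k l f g : val_ge k f -> val_ge l g -> val_ge (k + l) (f * g).
Proof. exact: lmul_vanish. Qed.

Lemma coefM_lead k l f g :
  val_ge k f -> val_ge l g -> (f * g) (k + l) = f k * g l.
Proof.
move=> fk gl; rewrite [LHS](@lmul_sum _ f g k l (k + l) 1) //; last by lia.
by rewrite big_ord1 addr0 subr0 addrC addKr.
Qed.

Lemma val_ge_lmonomial c k : val_ge k (lmonomial c k).
Proof. by move=> i ik /=; rewrite lt_eqF. Qed.

Lemma coef_lmonomialM c k f i : (lmonomial c k * f) i = c * f (i - k).
Proof.
rewrite /= -(fsbig_widen [set k]) //; last first.
  by move=> j [_ /= /eqP/negPf ->]; rewrite mul0r.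
by rewrite fsbig_set1 eqxx.
Qed.

Lemma lmonomialM a b k l : lmonomial a k * lmonomial b l = lmonomial (a * b) (k + l) :> laurent K.
Proof.
apply: laurentP => i; rewrite coef_lmonomialM /=.
by rewrite subr_eq [l + k]addrC; case: eqP => _; rewrite ?mulr0.
Qed.

Lemma lmonomial1 : lmonomial (1 : K) 0 = 1 :> laurent K.
Proof. by []. Qed.

Lemma lmonomial_eq0 c k : (lmonomial c k == 0 :> laurent K) = (c == 0).
Proof.
apply/eqP/eqP => [/(congr1 (fun f : laurent K => f k)) /=|->].
  by rewrite eqxx if_same.
by apply: laurentP => i /=; rewrite !if_same.
Qed.

Lemma lconst_eq0 c : (lconst c == 0 :> laurent K) = (c == 0).
Proof. exact: lmonomial_eq0. Qed.

Lemma val_ge_lconst c : val_ge 0 (lconst c).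
Proof. exact: val_ge_lmonomial. Qed.

Lemma coef_lconst0 c : lconst c 0 = c.
Proof. by []. Qed.

Lemma val_ge_lconst_neq0 k c : c != 0 -> val_ge k (lconst c) -> k <= 0.
Proof.
move=> c0 H; rewrite leNgt; apply/negP => /H; rewrite coef_lconst0 => /eqP.
by rewrite (negPf c0).
Qed.

Lemma val_ge_prod I (r : seq I) (P : pred I) (f : I -> laurent K) (k : I -> int) :
  (forall i, P i -> val_ge (k i) (f i)) ->
  val_ge (\sum_(i <- r | P i) k i) (\prod_(i <- r | P i) f i).
Proof.
move=> fk; elim/big_ind2: _ => //; last by move=> *; apply: val_geM.
exact: val_ge_lmonomial.
Qed.

Lemma coef_prod_lead I (r : seq I) (f : I -> laurent K) (k : I -> int) :
  (forall i, val_ge (k i) (f i)) ->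
  (\prod_(i <- r) f i) (\sum_(i <- r) k i) = \prod_(i <- r) f i (k i).
Proof.
move=> fk; elim: r => [|i r IH]; first by rewrite !big_nil.
by rewrite !big_cons coefM_lead ?IH //; apply: val_ge_prod.
Qed.

(* The geometric series: the coefficient of t^k in sum_j x^j only involves j <= k. *)
Lemma laurent_inv1 x : val_ge 1 x -> exists2 g, val_ge 0 g & (1 - x) * g = 1.
Proof.
move=> x1.
have xX j : val_ge j%:Z (x ^+ j).
  elim: j => [|j IH]; first exact: val_ge_lmonomial.
  by rewrite exprS; apply: val_geW (val_geM x1 IH); rewrite -addn1 PoszD addrC.
pose G N := \sum_(j < N) x ^+ j.
pose c (k : int) := if k < 0 then 0 else G (absz k).+1 k.
have bc : lbounded c by exists 0 => i i0; rewrite /c i0.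
exists (Laurent bc); first by move=> i i0 /=; rewrite /c i0.
apply: laurentP => k.
have [k0|k0] := ltP k 0.
  have H : val_ge 0 (1 - x).
    apply: val_geD; first exact: val_ge_lmonomial.
    by apply: val_geN; apply: val_geW x1.
  rewrite [RHS]/= lt_eqF //.
  by apply: (@val_geM 0 0) => // i i0 /=; rewrite /c i0.
case: k k0 => // k _.
have GE i N : (i < N)%N -> G N i = G i.+1 i.
  move=> iN; rewrite /G -!(big_mkord xpredT (fun j => x ^+ j)).
  rewrite (big_cat_nat (n := i.+1)) //= [X in _ + X]lcoef_sum.
  rewrite [X in _ + X]big_nat_cond [X in _ + X]big1 ?addr0 // => j /andP[/andP[ij _] _].
  by apply: xX; rewrite ltz_nat.
(* The series and its truncation agree up to t^k, and 1 - x does not lower valuations, so the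
   coefficient of t^k can be read off the telescoping finite sum. *)
have D : val_ge k.+1%:Z (Laurent bc - G k.+1).
  move=> i ik /=; rewrite /c; case: ltP => i0.
    have -> : G k.+1 i = 0; last by rewrite subr0.
    rewrite lcoef_sum big1 // => j _; apply: xX.
    by apply: lt_le_trans i0 _.
  case: i i0 ik => // i _ ik; rewrite [G k.+1 i]GE //; first by rewrite subrr.
have -> : Laurent bc = G k.+1 + (Laurent bc - G k.+1) by rewrite addrC subrK.
have x0 : val_ge 0 (1 - x).
  apply: val_geD; first exact: val_ge_lmonomial.
  by apply: val_geN; apply: val_geW x1.
rewrite mulrDr.
have -> : (1 - x) * G k.+1 = 1 - x ^+ k.+1.
  by rewrite -[in RHS](expr1n _ k.+1) subrXX; congr (_ * _);
     apply: eq_bigr => i _; rewrite expr1n mul1r.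
rewrite !coefD coefN xX; last by rewrite ltz_nat.
rewrite (val_geM x0 D); last by rewrite add0r ltz_nat.
by rewrite oppr0 !addr0.
Qed.

Lemma laurent_inv k f : val_ge k f -> f k != 0 ->
  exists2 g, val_ge (- k) g & f * g = 1.
Proof.
move=> fk c0; pose c := f k.
pose u := lmonomial c^-1 (- k) * f.
have ui i : u i = c^-1 * f (i + k) by rewrite coef_lmonomialM opprK.
have x1 : val_ge 1 (1 - u).
  move=> i i1; rewrite coefD coefN coef1 ui; have [->|i0] := eqVneq i 0.
    by rewrite add0r mulVf // subrr.
  by rewrite fk ?mulr0 ?subr0 //; lia.
have [g g0] := laurent_inv1 x1; rewrite opprB addrCA subrr addr0 => ug.
exists (lmonomial c^-1 (- k) * g); last first.
  by rewrite mulrCA mulrA.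
by have := val_geM (@val_ge_lmonomial c^-1 (- k)) g0; rewrite addr0.
Qed.

Lemma laurent_valP f : f != 0 -> exists2 k, val_ge k f & f k != 0.
Proof.
move=> f0; have [m fm] := lcoefP f.
have [|k kP kmin] := @ex_minnP (fun j : nat => f (m + j%:Z) != 0).
  apply: contrapT => H; case/eqP: f0; apply: laurentP => i.
  rewrite [RHS]/= if_same; have [/fm //|mi] := ltP i m.
  apply/eqP; apply: contrapT => fi; apply: H.
  exists `|i - m|%N; rewrite (_ : m + _ = i); first exact/negP.
  by lia.
exists (m + k%:Z) => // i ik; have [/fm //|mi] := ltP i m.
apply/eqP; apply: contrapT => /negP fi.
suff : (k <= `|i - m|)%N by lia.
by apply: kmin; rewrite (_ : m + _ = i) //; lia.
Qed.

Lemma laurent_mulf_eq0 f g : f * g = 0 -> f = 0 \/ g = 0.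
Proof.
have [->|/laurent_valP[k fk f0]] := eqVneq f 0; first by left.
have [->|/laurent_valP[l gl g0]] := eqVneq g 0; first by right.
move=> /(congr1 (fun h : laurent K => h (k + l))); rewrite coefM_lead //.
by rewrite /= if_same => /eqP; rewrite mulf_eq0 (negPf f0) (negPf g0).
Qed.

End LaurentValuation.

(** * Matrices bounded by weights, and their leading parts *)

Section WeightedMatrices.
Import Order.TTheory GRing.Theory Num.Theory.
Local Open Scope ring_scope.
Variable K : fieldType.
Notation F := (laurent K).

(* M maps the lattice spanned by the t^(b j) e_j into the one spanned by the
   t^(a i) e_i; [lead_mx a b M] is the map induced modulo t. *)
Definition weighted m n (a : 'I_m -> int) (b : 'I_n -> int) (M : 'M[F]_(m, n)) :=
  forall i j, val_ge (a i - b j) (M i j).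

Definition lead_mx m n (a : 'I_m -> int) (b : 'I_n -> int) (M : 'M[F]_(m, n)) :
  'M[K]_(m, n) := \matrix_(i, j) M i j (a i - b j).

Lemma weightedM m n p a b c (M : 'M_(m, n)) (N : 'M_(n, p)) :
  weighted a b M -> weighted b c N -> weighted a c (M *m N).
Proof.
move=> wM wN i j; rewrite mxE; apply: val_ge_sum => k _.
by have := val_geM (wM i k) (wN k j); rewrite addrA subrK.
Qed.

Lemma lead_mxM m n p a b c (M : 'M_(m, n)) (N : 'M_(n, p)) :
  weighted a b M -> weighted b c N ->
  lead_mx a c (M *m N) = lead_mx a b M *m lead_mx b c N.
Proof.
move=> wM wN; apply/matrixP => i j; rewrite !mxE lcoef_sum.
apply: eq_bigr => k _; rewrite !mxE -(coefM_lead (wM i k) (wN k j)).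
by rewrite addrA subrK.
Qed.

Lemma weightedW m n a b a' b' (M : 'M_(m, n)) :
  (forall i j, a' i - b' j <= a i - b j) -> weighted a b M -> weighted a' b' M.
Proof. by move=> H wM i j; apply: val_geW (wM i j). Qed.

Lemma weightedD m n a b (M N : 'M_(m, n)) :
  weighted a b M -> weighted a b N -> weighted a b (M + N).
Proof. by move=> wM wN i j; rewrite mxE; apply: val_geD. Qed.

Lemma weighted1 n (a : 'I_n -> int) : weighted a a 1%:M.
Proof.
move=> i j; rewrite mxE; case: eqP => [->|_]; last exact: val_ge0.
by rewrite subrr; apply: val_ge_lmonomial.
Qed.

Lemma weighted_const m n (c : int) (M : 'M[K]_(m, n)) :
  weighted (fun=> c) (fun=> c) (map_mx (@lconst K) M).
Proof. by move=> i j; rewrite mxE subrr; apply: val_ge_lconst. Qed.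

Lemma lead_mx_const m n (c : int) (M : 'M[K]_(m, n)) :
  lead_mx (fun=> c) (fun=> c) (map_mx (@lconst K) M) = M.
Proof. by apply/matrixP => i j; rewrite !mxE subrr. Qed.

(** Reindexing the column weights by s makes the bound independent of s, so all terms of the Leibniz
    expansion share it. *)
Lemma lead_mx_mono n (a b : 'I_n -> int) (M : 'M_n) (s : 'S_n) :
  weighted a b M ->
  val_ge (\sum_i a i - \sum_i b i) (\prod_i M i (s i)) /\
  (\prod_i M i (s i)) (\sum_i a i - \sum_i b i) = \prod_i lead_mx a b M i (s i).
Proof.
move=> wM; rewrite [X in _ - X](reindex_inj (@perm_inj _ s)) /= -sumrB; split.
  exact: val_ge_prod.
by rewrite coef_prod_lead //; apply: eq_bigr => i _; rewrite mxE.
Qed.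

Lemma signr_lconst (s : bool) : (-1) ^+ s = lconst ((-1) ^+ s) :> F.
Proof. by rewrite rmorphXn rmorphN rmorph1. Qed.

Lemma weighted_det n (a b : 'I_n -> int) (M : 'M_n) :
  weighted a b M -> val_ge (\sum_i a i - \sum_i b i) (\det M).
Proof.
move=> wM; apply: val_ge_sum => s _; rewrite signr_lconst -[X in val_ge X]add0r.
by apply: val_geM; [exact: val_ge_lconst|case: (lead_mx_mono s wM)].
Qed.

Lemma det_lead_mx n (a b : 'I_n -> int) (M : 'M_n) :
  weighted a b M -> \det (lead_mx a b M) = (\det M) (\sum_i a i - \sum_i b i).
Proof.
move=> wM; rewrite lcoef_sum; apply: eq_bigr => s _.
by rewrite signr_lconst lcoef_constM; case: (lead_mx_mono s wM) => _ ->.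
Qed.

(** Removing row j and column i leaves a minor of weight b i - a j because the total weights agree.
    For determinant 1 this bounds the inverse. *)
Lemma weighted_adj n (a b : 'I_n -> int) (M : 'M_n) :
  \sum_i a i = \sum_i b i -> weighted a b M -> weighted b a (\adj M).
Proof.
move=> ab wM i j; rewrite mxE /cofactor.
have -> : (-1) ^+ (j + i) = lconst ((-1) ^+ (j + i)) :> F.
  by rewrite rmorphXn rmorphN rmorph1.
rewrite -[X in val_ge X]add0r; apply: val_geM; first exact: val_ge_lconst.
have -> : b i - a j = \sum_k a (lift j k) - \sum_k b (lift i k).
  move: ab; rewrite (bigD1_ord j) //= (bigD1_ord i (F := b)) //= => ab.
  by apply/eqP; rewrite subr_eq addrAC -subr_eq opprK [_ + a j]addrC ab.
by apply: weighted_det => k l; rewrite !mxE.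
Qed.

(** Turns a rank defect of the leading matrix into a gain of valuation, hence into a constraint on
    determinants. *)
Lemma weighted_rowS m n (a : 'I_m -> int) (b : 'I_n -> int) (p : pred 'I_m) (M : 'M_(m, n)) :
  weighted a b M -> (forall i j, p i -> lead_mx a b M i j = 0) ->
  weighted (fun i => a i + (p i)%:R) b M.
Proof.
move=> wM H i j; case: (boolP (p i)) => [pi|_]; last by rewrite addr0; apply: wM.
move=> k; rewrite addrAC ltzD1 le_eqVlt => /orP[/eqP->|]; last exact: wM.
by have := H i j pi; rewrite mxE.
Qed.

Lemma weighted_colS m n (a : 'I_m -> int) (b : 'I_n -> int) (p : pred 'I_n) (M : 'M_(m, n)) :
  weighted a b M -> (forall i j, p j -> lead_mx a b M i j = 0) ->
  weighted a (fun j => b j - (p j)%:R) M.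
Proof.
move=> wM H i j; case: (boolP (p j)) => [pj|_]; last by rewrite subr0; apply: wM.
move=> k; rewrite opprB addrC -addrA [- _ + _]addrC addrC ltzD1 le_eqVlt.
case/orP=> [/eqP->|]; last exact: wM.
by have := H i j pj; rewrite mxE.
Qed.

End WeightedMatrices.

(** * Stabilisers of E0 and E1, and the locus Z *)

Section Parahorics.
Import Order.TTheory GRing.Theory Num.Theory.
Local Open Scope classical_set_scope.
Local Open Scope ring_scope.
Variables (K : fieldType) (n : nat).
Notation F := (laurent K).

(** Exponents of the basis e_1, ..., e_d, t e_(d+1), ..., t e_n of E1. *)
Definition eps (d : nat) (i : 'I_n) : int := (d <= i)%N%:R.

Lemma sum_eps d : (d <= n)%N -> \sum_i eps d i = (n - d)%N%:Z.
Proof.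
move=> dn; rewrite /eps -(big_mkord xpredT (fun i => (d <= i)%N%:R)).
rewrite (big_cat_nat (leq0n d) dn) /= big_nat big1 ?add0r; last first.
  by move=> i /andP[_ id]; rewrite leqNgt id.
rewrite big_nat_cond (eq_bigr (fun=> 1)); last by move=> i /andP[/andP[-> _] _].
by rewrite -big_nat_cond big_const_nat iter_addr_0 pmulrn intz.
Qed.

Lemma weighted_inv (a b : 'I_n -> int) (g : SL n F) :
  \sum_i a i = \sum_i b i -> weighted a b g -> weighted b a g^-1%g.
Proof. exact: weighted_adj. Qed.

Lemma SL_power_series_weighted (g : SL n F) :
  SL_power_series g -> weighted (fun=> 0) (fun=> 0) g.
Proof. by []. Qed.

Lemma weighted_SL_power_series (g : SL n F) :
  weighted (fun=> 0) (fun=> 0) g -> SL_power_series g.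
Proof. by []. Qed.

Lemma at_t0E (M : 'M[F]_n) : at_t0 M = lead_mx (fun=> 0) (fun=> 0) M.
Proof. by apply/matrixP => i j; rewrite !mxE. Qed.

Lemma det_at_t0 (g : SL n F) : SL_power_series g -> \det (at_t0 g) == 1.
Proof.
move/SL_power_series_weighted => wg; rewrite at_t0E det_lead_mx // det_SL.
by rewrite subrr.
Qed.

(** Q is the common stabiliser of E0 and E1. Given the first bound, the second one only bears on the
    lower left block, whose constant term it kills. *)
Lemma two_stepP d (g : SL n F) : two_step d g <->
  weighted (fun=> 0) (fun=> 0) g /\ weighted (eps d) (eps d) g.
Proof.
split=> [[/SL_power_series_weighted wg [p Pp gp]]|[w0 w1]].
  split=> // i j; have := wg i j; rewrite /eps.
  have [id|di] := leqP d i; have [jd|dj] := leqP d j => //=; last first.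
    by apply: val_geW.
  rewrite !subr0 => H k; rewrite -[1]add0r ltzD1 le_eqVlt => /orP[/eqP->|]; last exact: H.
  by have := congr1 (fun M : 'M_n => M i j) gp; rewrite mxE Pp // id dj.
have Ag : SL_power_series g by apply: weighted_SL_power_series.
split=> //; exists (MkSL (det_at_t0 Ag)) => // i j /andP[jd di].
by rewrite /= mxE; apply: (w1 i j); rewrite /eps di leqNgt jd.
Qed.

Lemma two_stepM d (g h : SL n F) : two_step d g -> two_step d h -> two_step d (g * h)%g.
Proof.
move=> /two_stepP[g0 g1] /two_stepP[h0 h1]; apply/two_stepP.
by split; apply: weightedM; eauto.
Qed.

Lemma two_stepV d (g : SL n F) : two_step d g -> two_step d g^-1%g.
Proof.
move=> /two_stepP[g0 g1]; apply/two_stepP.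
by split; apply: weighted_inv.
Qed.

Lemma two_step1 d : two_step d (1%g : SL n F).
Proof. by apply/two_stepP; split; apply: weighted1. Qed.

(** The Borel subgroup is the intersection of the P_d, so Iwahori facts follow from those on Q for
    varying d. *)
Lemma iwahoriP (g : SL n F) : iwahori g <-> forall d, two_step d g.
Proof.
split=> [[Ag [p Bp gp]] d|H].
  split=> //; exists p => // i j /andP[jd di]; apply: Bp.
  exact: leq_trans jd di.
have [Ag _] := H 0; split=> //; exists (MkSL (det_at_t0 Ag)) => // i j ji.
have [_ [p Pp gp]] := H i; rewrite [slmx _ _ _]/= gp.
by apply: Pp; rewrite ji leqnn.
Qed.

Lemma flag_pi_mul d (g q : SL n F) : two_step d q -> flag_pi d (g * q)%g = flag_pi d g.
Proof.
move=> Qq; apply/eqquotP/asboolP/seteqP; split=> _ [r Qr <-].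
  by exists (q * r)%g; [apply: two_stepM|rewrite mulgA].
exists (q^-1 * r)%g; first by apply: two_stepM => //; apply: two_stepV.
by rewrite -mulgA mulVKg.
Qed.

Lemma flag_piP d (g h : SL n F) :
  flag_pi d g = flag_pi d h -> exists2 q, two_step d q & h = (g * q)%g.
Proof.
move=> /eqquotP/asboolP E.
have [q Qq <-] : coset d g h by rewrite E; exists 1%g; [exact: two_step1|rewrite mulg1].
by exists q.
Qed.

(* With E0 = A^n and E1 = <e_1, ..., e_d> + t A^n, this is t E0 <= g E1 <= E0. *)
Definition over_grassmannian d (g : SL n F) :=
  weighted (fun=> 0) (eps d) g /\ weighted (eps d) (fun=> 1) g^-1%g.

Lemma over_grassmannianM d (b g q : SL n F) :
  SL_power_series b -> weighted (eps d) (eps d) q ->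
  over_grassmannian d g -> over_grassmannian d (b * g * q)%g.
Proof.
move=> /SL_power_series_weighted wb wq [g0 g1]; split.
  by rewrite !slmxM; apply: (weightedM (weightedM wb g0) wq).
rewrite invgM invgM !slmxM; apply: (weightedM (weighted_inv _ wq)) => //.
apply: (weightedM g1).
by apply: weightedW (weighted_inv _ wb) => // i j; rewrite !subrr.
Qed.

Lemma over_grassmannian_stab d (q : SL n F) :
  weighted (eps d) (eps d) q -> over_grassmannian d q.
Proof.
move=> wq; split; first by apply: weightedW wq => i j; rewrite /eps; lia.
by apply: weightedW (weighted_inv _ wq) => // i j; rewrite /eps; lia.
Qed.

Lemma two_step_stab d (q : SL n F) : two_step d q -> weighted (eps d) (eps d) q.
Proof. by case/two_stepP. Qed.

Lemma constSL_power_series (h : SL n K) : SL_power_series (constSL h).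
Proof. by apply: weighted_SL_power_series; apply: weighted_const. Qed.

Lemma over_grassmannian_const d (h : SL n K) (q : SL n F) :
  weighted (eps d) (eps d) q -> over_grassmannian d (constSL h * q)%g.
Proof.
move=> /over_grassmannian_stab Zq.
have w1 : weighted (eps d) (eps d) (1%g : SL n F) by exact: weighted1.
by have := over_grassmannianM (@constSL_power_series h) w1 Zq; rewrite mulg1.
Qed.

(* h0 kills the rows of the leading part of g beyond its rank; comparing
   valuations of determinants for g and g^-1 shows that this rank is d. *)
Lemma over_grassmannian_factor d (g : SL n F) : (0 < n)%N -> (d <= n)%N ->
  over_grassmannian d g ->
  exists (h : SL n K) (q : SL n F), weighted (eps d) (eps d) q /\ g = (constSL h * q)%g.
Proof.
move=> n0 dn [w0 w1].
pose M := lead_mx (fun=> 0) (eps d) g.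
pose N := lead_mx (eps d) (fun=> 1) g^-1%g.
(* Between the weights 0 and 1, the leading part of the identity is its coefficient at t^-1, which
   is zero. *)
have MN0 : M *m N = 0.
  rewrite -lead_mxM // -slmxM mulgV slmx1; apply/matrixP => i j.
  by rewrite !mxE; case: eqP.
have rMN := mulmx0_rank_max MN0.
pose L := invmx (col_ebase M).
have uL : L \in unitmx by rewrite unitmx_inv col_ebase_unit.
have LM : L *m M = pid_mx (\rank M) *m row_ebase M.
  by rewrite -[RHS](mulKmx (col_ebase_unit M)) [col_ebase M *m _]mulmxA mulmx_ebase.
pose R := invmx (row_ebase N).
have uR : R \in unitmx by rewrite unitmx_inv row_ebase_unit.
have NR : N *m R = col_ebase N *m pid_mx (\rank N).
  by rewrite -[RHS](mulmxK (row_ebase_unit N)) mulmx_ebase.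
have wL : weighted (eps (\rank M)) (eps d) (map_mx (@lconst K) L *m g).
  have H (i j : 'I_n) : (\rank M <= i)%N ->
      lead_mx (fun=> 0) (eps d) (map_mx (@lconst K) L *m g) i j = 0.
    move=> ri; rewrite (lead_mxM (@weighted_const K n n 0 L) w0) lead_mx_const LM mxE.
    by rewrite big1 // => k _; rewrite mxE ltnNge ri andbF mul0r.
  have := weighted_rowS (weightedM (@weighted_const K n n 0 L) w0) H.
  by apply: weightedW => i j; rewrite add0r.
have wR : weighted (eps d) (fun i => 1 - eps (\rank N) i) (g^-1%g *m map_mx (@lconst K) R).
  have H (i j : 'I_n) : (\rank N <= j)%N ->
      lead_mx (eps d) (fun=> 1) (g^-1%g *m map_mx (@lconst K) R) i j = 0.
    move=> rj; rewrite (lead_mxM w1 (@weighted_const K n n 1 R)) lead_mx_const NR mxE.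
    rewrite big1 // => k _; rewrite [pid_mx _ _ _]mxE; case: eqP => [->|_].
      by rewrite ltnNge rj mulr0.
    by rewrite mulr0.
  exact: (weighted_colS (weightedM w1 (@weighted_const K n n 1 R)) H).
have dL : \det L != 0 by rewrite -unitfE -unitmxE.
have dR : \det R != 0 by rewrite -unitfE -unitmxE.
have rM : (d <= \rank M)%N.
  have := weighted_det wL; rewrite det_mulmx det_SL mulr1 det_map_mx.
  move/(val_ge_lconst_neq0 dL); rewrite !sum_eps ?rank_leq_row // subr_le0 lez_nat.
  by have := rank_leq_row M; lia.
have rN : (n - d <= \rank N)%N.
  have := weighted_det wR; rewrite det_mulmx det_SL mul1r det_map_mx.
  move/(val_ge_lconst_neq0 dR); rewrite sumrB !sum_eps ?rank_leq_row //.
  rewrite sumr_const card_ord; have := rank_leq_row N; lia.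
have rd : \rank M = d by lia.
pose D : 'rV[K]_n := \row_i (if i == Ordinal n0 then (\det L)^-1 else 1).
have dD : \det (diag_mx D *m L) == 1.
  rewrite det_mulmx det_diag (bigD1 (Ordinal n0)) //= mxE eqxx big1 ?mulr1 ?mulVf //.
  by move=> i /negPf ni; rewrite mxE ni.
pose h := MkSL dD.
exists h^-1%g, (constSL h * g)%g; split; last by rewrite constSLV mulKg.
rewrite rd in wL; rewrite slmxM /= map_mxM -mulmxA => i j.
rewrite map_diag_mx mul_diag_mx mxE [map_mx _ _ _ _]mxE -[X in val_ge X]add0r.
by apply: val_geM; [apply: val_ge_lconst|apply: wL].
Qed.

End Parahorics.

(** * The image of phi inside Z, and curves leading into it *)

Section OpenCell.
Import Order.TTheory GRing.Theory Num.Theory.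
Local Open Scope classical_set_scope.
Local Open Scope quotient_scope.
Local Open Scope ring_scope.
Variables (K : fieldType) (d e : nat).
Hypotheses (d0 : (0 < d)%N) (e0 : (0 < e)%N).
Notation F := (laurent K).
Notation n := (d + e)%N.

(* With B = L pid U and copid = 1 - pid, the choice X = L copid U N1 gives
   B + X A = L (1 - copid (U N2 L) pid) U, and copid (U N2 L) pid squares to 0. *)
Lemma unitmx_addM (p q : nat) (A : 'M[K]_(p, q)) (B : 'M[K]_q) N1 N2 :
  N1 *m A + N2 *m B = 1%:M -> exists X, B + X *m A \in unitmx.
Proof.
move=> NAB; pose L := col_ebase B; pose U := row_ebase B.
pose P : 'M[K]_q := pid_mx (\rank B).
have BE : L *m P *m U = B by apply: mulmx_ebase.
have PP : P *m P = P by rewrite /P mul_pid_mx; congr pid_mx; have := rank_leq_row B; lia.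
exists (L *m (1%:M - P) *m U *m N1).
pose N := (1%:M - P) *m (U *m N2 *m L) *m P.
have NN : N *m N = 0.
  rewrite /N -!mulmxA [P *m ((1%:M - P) *m _)]mulmxA mulmxBr mulmx1 PP subrr.
  by rewrite mul0mx !mulmx0.
have -> : B + L *m (1%:M - P) *m U *m N1 *m A = L *m (1%:M - N) *m U.
  have LcU : L *m (1%:M - P) *m U = L *m U - B by rewrite mulmxBr mulmx1 mulmxBl BE.
  have LNU : L *m N *m U = L *m (1%:M - P) *m U *m (N2 *m B).
    by rewrite /N -[in RHS]BE !mulmxA.
  rewrite -[_ *m N1 *m A]mulmxA (canRL (addrK _) NAB).
  rewrite [in RHS]mulmxBr [in RHS]mulmx1 [in RHS]mulmxBl LNU mulmxBr mulmx1 {1}LcU.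
  by rewrite addrA [B + _]addrC subrK.
rewrite !unitmx_mul col_ebase_unit row_ebase_unit andbT /=.
have : (1%:M - N) *m (1%:M + N) = 1%:M.
  by rewrite mulmxDr mulmx1 mulmxBl mul1mx NN subr0 subrK.
by case/mulmx1_unit.
Qed.

Lemma horner_det_affine (q : nat) (B C : 'M[K]_q) s :
  (\det (map_mx polyC B + 'X *: map_mx polyC C)).[s] = \det (B + s *: C).
Proof.
rewrite -[LHS]/(horner_eval s _) -det_map_mx; congr determinant.
by apply/matrixP => i j; rewrite !mxE /= /horner_eval !hornerE.
Qed.

Lemma lshift_eps (i : 'I_d) : eps d (lshift e i) = 0.
Proof. by rewrite /eps /= leqNgt ltn_ord. Qed.

Lemma rshift_eps (i : 'I_e) : eps d (rshift d i) = 1.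
Proof. by rewrite /eps /= leq_addr. Qed.

Lemma block_nilradical (Y : 'M[K]_(d, e)) : in_nilradical d (block_mx 0 Y 0 0).
Proof.
apply/forallP => i; apply/forallP => j; apply/implyP.
case: (split_ordP i) => i' ->; case: (split_ordP j) => j' ->.
- by rewrite block_mxEul mxE.
- by rewrite /= leq_addr.
- by rewrite block_mxEdl mxE.
- by rewrite block_mxEdr mxE.
Qed.

Lemma block_nilradical_sqr (Y : 'M[K]_(d, e)) : (block_mx 0 Y 0 0 : 'M_n) ^+ 2 = 0.
Proof.
rewrite expr2 [LHS]mulmx_block !(mulmx0, mul0mx, addr0).
apply/matrixP => i j; rewrite !mxE.
by case: splitP => ? _; rewrite mxE; case: splitP => ? _; rewrite mxE.
Qed.

Lemma geomSL_block (Y : 'M[K]_(d, e)) :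
  geomSL (Nilradical (block_nilradical Y)) =
  block_mx 1%:M (lvarV K *: map_mx (@lconst K) Y) 0 1%:M :> 'M_n.
Proof.
rewrite /= /geom_mx.
have n2 : (1 < n)%N by lia.
rewrite (bigD1 (Ordinal (ltnW n2))) //= (bigD1 (Ordinal n2)) //= big1 ?addr0; last first.
  case=> [[|[|k]]] kn //= _; rewrite -[in X in map_mx _ X]addn2 [in X in map_mx _ X]exprD.
  by rewrite block_nilradical_sqr mulr0 map_mx0 scaler0.
rewrite !expr0 !expr1 scale1r map_mx1 map_block_mx !map_mx0.
by rewrite scale_block_mx !scaler0 scalar_mx_block add_block_mx !(addr0, add0r).
Qed.

Lemma geomSL_weighted (Y : 'M[K]_(d, e)) :
  weighted (eps d) (eps d) (geomSL (Nilradical (block_nilradical Y))).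
Proof.
rewrite geomSL_block => i j.
case: (split_ordP i) => i' ->; case: (split_ordP j) => j' ->;
  rewrite ?lshift_eps ?rshift_eps.
- by rewrite block_mxEul; have := @weighted1 K _ (fun=> 0) i' j'.
- rewrite block_mxEur !mxE -[X in val_ge X]addr0.
  by apply: val_geM; [apply: val_ge_lmonomial|apply: val_ge_lconst].
- by rewrite block_mxEdl mxE; apply: val_ge0.
- by rewrite block_mxEdr; have := @weighted1 K _ (fun=> 1) i' j'.
Qed.

Lemma geomSL_lead (Y : 'M[K]_(d, e)) :
  lead_mx (eps d) (eps d) (geomSL (Nilradical (block_nilradical Y))) =
  block_mx 1%:M Y 0 1%:M.
Proof.
rewrite geomSL_block; apply/matrixP => i j; rewrite [LHS]mxE.
case: (split_ordP i) => i' ->; case: (split_ordP j) => j' ->;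
  rewrite ?lshift_eps ?rshift_eps ?(block_mxEul, block_mxEur, block_mxEdl, block_mxEdr).
- by rewrite !mxE; case: eqP.
- by rewrite !mxE coef_lmonomialM /= mul1r.
- by rewrite !mxE.
- by rewrite !mxE; case: eqP.
Qed.

(** Factor a = (1 Y; 0 1) c with Y = a12 a22^-1 and c12 = 0. The first factor is the leading part of
    a point of the fibre of the cotangent bundle; c12 = 0 removes the only possible pole of the
    remaining factor, which therefore lies in Q. *)
Lemma range_phiP (h : SL n K) (q : SL n F) :
  weighted (eps d) (eps d) q -> drsubmx (lead_mx (eps d) (eps d) q) \in unitmx ->
  range (@phi K n d) (flag_pi d (constSL h * q)%g).
Proof.
set a := lead_mx _ _ _ => wq ua.
pose Y0 := ursubmx a *m invmx (drsubmx a).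
pose Y := Nilradical (block_nilradical Y0).
pose r := ((geomSL Y)^-1 * q)%g.
have wY : weighted (eps d) (eps d) (geomSL Y) by apply: geomSL_weighted.
have wr : weighted (eps d) (eps d) r.
  by rewrite /r slmxM; apply: weightedM wq; apply: weighted_inv.
pose c := lead_mx (eps d) (eps d) r.
have c0 : ursubmx c = 0.
  have : a = lead_mx (eps d) (eps d) (geomSL Y) *m c.
    by rewrite -lead_mxM // -slmxM /r mulVKg.
  rewrite geomSL_lead -{1}[a]submxK -[c]submxK mulmx_block.
  rewrite !(mul1mx, mul0mx, add0r) => /eq_block_mx[_ aur _ adr].
  move: aur; rewrite -adr /Y0 mulmxKV // => /eqP.
  by rewrite -subr_eq subrr eq_sym block_mxKur => /eqP.
have Qr : two_step d r.
  apply/two_stepP; split=> // i j; have := wr i j.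
  have : forall i' j', ursubmx c i' j' = 0 by move=> *; rewrite c0 mxE.
  case: (split_ordP i) => i' ->; case: (split_ordP j) => j' -> H;
    rewrite ?lshift_eps ?rshift_eps //; last by apply: val_geW.
  move=> {}wr k k0; have [->|k1] := eqVneq k (-1); last by apply: wr; lia.
  by have := H i' j'; rewrite !mxE lshift_eps rshift_eps.
exists (\pi_(cotangent K n d) (h, Y)) => //.
rewrite phi_pi /phi_rep /=.
rewrite -(flag_pi_mul (constSL h * geomSL Y)%g Qr) /r.
by rewrite -mulgA mulVKg.
Qed.

Definition lower_shear (X : 'M[K]_(e, d)) (s : K) : 'M[F]_n :=
  1%:M + lmonomial s 1 *: map_mx (@lconst K) (block_mx 0 0 X 0).

Lemma lower_shear_block X s :
  lower_shear X s = block_mx 1%:M 0 (lmonomial s 1 *: map_mx (@lconst K) X) 1%:M.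
Proof.
rewrite /lower_shear map_block_mx !map_mx0 scale_block_mx !scaler0.
by rewrite scalar_mx_block add_block_mx !(addr0, add0r).
Qed.

Lemma det_lower_shear X s : \det (lower_shear X s) == 1.
Proof. by rewrite lower_shear_block det_lblock !det1 mulr1. Qed.

Lemma lower_shear_weighted X s : weighted (eps d) (eps d) (lower_shear X s).
Proof.
rewrite lower_shear_block => i j.
case: (split_ordP i) => i' ->; case: (split_ordP j) => j' ->;
  rewrite ?lshift_eps ?rshift_eps ?(block_mxEul, block_mxEur, block_mxEdl, block_mxEdr).
- by have := @weighted1 K _ (fun=> 0) i' j'.
- by rewrite mxE; apply: val_ge0.
- rewrite !mxE -[X in val_ge X]addr0.
  by apply: val_geM; [apply: val_ge_lmonomial|apply: val_ge_lconst].
- by have := @weighted1 K _ (fun=> 1) i' j'.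
Qed.

Lemma lower_shear_lead X s :
  lead_mx (eps d) (eps d) (lower_shear X s) = block_mx 1%:M 0 (s *: X) 1%:M.
Proof.
rewrite lower_shear_block; apply/matrixP => i j; rewrite [LHS]mxE.
case: (split_ordP i) => i' ->; case: (split_ordP j) => j' ->;
  rewrite ?lshift_eps ?rshift_eps ?(block_mxEul, block_mxEur, block_mxEdl, block_mxEdr).
- by rewrite !mxE; case: eqP.
- by rewrite !mxE.
- by rewrite !mxE coef_lmonomialM.
- by rewrite !mxE; case: eqP.
Qed.

(** Moves the shear past the constant factor h, to the left of the whole of g. *)
Lemma shear_mulmxC (R : comNzRingType) (m : nat) (A B B' M : 'M[R]_m) (x : R) :
  A *m B = B' *m A ->
  A *m ((1%:M + x *: B) *m M) = (1%:M + x *: B') *m (A *m M).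
Proof.
move=> AB; rewrite !mulmxA; congr (_ *m _).
by rewrite mulmxDr mulmxDl mulmx1 mul1mx -scalemxAr -scalemxAl AB.
Qed.

(** W is the direction of the shear conjugated by h. P is the determinant of the lower right block
    along the curve; the choice of X makes it nonzero at s = 1. *)
Lemma curve_to_open_cell (g : SL n F) : over_grassmannian d g ->
  exists (W : 'M[K]_n) (P : {poly K}) (gs : K -> SL n F),
  [/\ W *m W = 0, P != 0,
      forall s, slmx (gs s) =
        (1%:M + lmonomial s 1 *: map_mx (@lconst K) W) *m g &
      forall s, P.[s] != 0 -> range (@phi K n d) (flag_pi d (gs s))].
Proof.
have [n0 dn] : (0 < n)%N /\ (d <= n)%N by lia.
case/(over_grassmannian_factor n0 dn) => h [q [wq ->]].
pose a := lead_mx (eps d) (eps d) q.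
have a1 : \det a = 1 by rewrite det_lead_mx // det_SL subrr.
have ua : a \in unitmx by rewrite unitmxE a1 unitr1.
(* The lower right block of a^-1 a = 1 is the relation N1 a12 + N2 a22 = 1. *)
have [X uX] : exists X, drsubmx a + X *m ursubmx a \in unitmx.
  have := mulVmx ua; rewrite -{2}[a]submxK -[invmx a]submxK mulmx_block.
  by rewrite scalar_mx_block => /eq_block_mx[_ _ _]; apply: unitmx_addM.
have [E EE] : exists E : K -> SL n F, forall s, slmx (E s) = lower_shear X s.
  by exists (fun s => MkSL (det_lower_shear X s)).
pose P := \det (map_mx polyC (drsubmx a) + 'X *: map_mx polyC (X *m ursubmx a)).
have PE s : P.[s] = \det (drsubmx a + s *: (X *m ursubmx a)) by apply: horner_det_affine.
have hh : h^-1%g *m h = 1%:M by rewrite -slmxM mulVg.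
move: (h^-1%g) hh => hV hh.
exists (h *m block_mx 0 0 X 0 *m hV), P, (fun s => constSL h * (E s * q))%g.
split.
- rewrite !mulmxA -[_ *m _ *m h]mulmxA hh mulmx1 -[_ *m _ *m block_mx _ _ _ _]mulmxA.
  by rewrite mulmx_block !(mulmx0, mul0mx, addr0) block_mx0 mulmx0 mul0mx.
- apply/eqP => P0; have := PE 1; rewrite P0 horner0 scale1r => /esym/eqP.
  by apply/negP; rewrite -unitfE -unitmxE.
- move=> s; rewrite slmxM (slmxM (E s)) (slmxM (constSL h)) EE; apply: shear_mulmxC.
  by rewrite -[LHS]map_mxM -[RHS]map_mxM -(mulmxA (h *m _)) hh mulmx1.
move=> s; rewrite PE => us.
have wE : weighted (eps d) (eps d) (E s) by rewrite EE; apply: lower_shear_weighted.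
apply: range_phiP; first exact: weightedM wE wq.
rewrite (lead_mxM wE wq) EE lower_shear_lead -/a -[a]submxK mulmx_block block_mxKdr.
by rewrite mul1mx -scalemxAl addrC unitmxE unitfE.
Qed.

End OpenCell.

(** * Linear algebra of minors and row spaces *)

Section Minors.
Import Order.TTheory GRing.Theory Num.Theory.
Local Open Scope classical_set_scope.
Local Open Scope ring_scope.
Variable K : fieldType.

Lemma row_free_minor k N (M : 'M[K]_(k, N)) : row_free M ->
  exists f : {ffun 'I_k -> 'I_N}, colsub f M \in unitmx.
Proof.
move=> fM; have fT : row_full M^T by rewrite /row_full mxrank_tr.
exists (fullrankfun fT); rewrite -unitmx_tr.
rewrite (_ : _^T = rowsub (fullrankfun fT) M^T) ?fullrowsub_unit //.
by apply/matrixP => i j; rewrite !mxE.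
Qed.

Lemma minor0 k N (M : 'M[K]_(k, N)) (s : 'I_k -> 'I_N) l :
  col (s l) M = 0 -> \det (colsub s M) = 0.
Proof.
move=> M0; rewrite (expand_det_col _ l) big1 // => i _.
by have := congr1 (fun v : 'cV_k => v i 0) M0; rewrite !mxE => ->; rewrite mul0r.
Qed.

(* By Cramer's rule, the minors through column j express it in a basis of columns. *)
Lemma col_eq0_minors k N (M : 'M[K]_(k, N)) j : row_free M ->
  col j M = 0 <->
  forall s : {ffun 'I_k -> 'I_N}, (exists l, s l = j) -> \det (colsub s M) = 0.
Proof.
move=> fM; split=> [M0 s [l sl]|H]; first by apply: (minor0 (l := l)); rewrite sl.
have [f uf] := row_free_minor fM.
suff : \adj (colsub f M) *m col j M = 0.
  move=> /(congr1 (mulmx (colsub f M))); rewrite mulmxA mul_mx_adj mulmx0.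
  rewrite mul_scalar_mx => /eqP; rewrite scalemx_eq0.
  by case/orP=> /eqP // f0; move: uf; rewrite unitmxE f0 unitr0.
apply/colP => i; rewrite [RHS]mxE.
pose s : {ffun 'I_k -> 'I_N} := [ffun l => if l == i then j else f l].
have := H s; rewrite (expand_det_col _ i) => <-; last by exists i; rewrite ffunE eqxx.
rewrite mxE; apply: eq_bigr => l _; rewrite !mxE mulrC ffunE eqxx; congr (_ * _).
rewrite /cofactor; congr (_ * \det _); apply/matrixP => x y; rewrite !mxE ffunE.
by rewrite eq_sym (negPf (neq_lift _ _)).
Qed.

(** Erasing column j lowers the rank exactly when some combination of the rows is a nonzero multiple
    of the unit vector at j, and the minors avoiding j detect this. *)
Lemma delta_mx_minors k N (M : 'M[K]_(k, N)) j : row_free M ->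
  ((delta_mx 0 j : 'rV_N) <= M)%MS <->
  forall s : {ffun 'I_k -> 'I_N}, (forall l, s l <> j) -> \det (colsub s M) = 0.
Proof.
move=> fM; split=> [/submxP[x xM] s sj|H].
  have x0 : x != 0.
    apply: contraPneq xM => ->; rewrite mul0mx => /rowP/(_ j).
    by rewrite !mxE !eqxx => /eqP; rewrite oner_eq0.
  apply/eqP; apply: contraT => ds; case/negP: x0.
  have us : colsub s M \in unitmx by rewrite unitmxE unitfE.
  rewrite -[x](mulmxK us) mulmx_colsub -xM; apply/eqP.
  rewrite (_ : colsub _ _ = 0) ?mul0mx //; apply/rowP => i; rewrite !mxE.
  by case: (s i =P j) => [/sj|_]; rewrite ?andbF.
pose Z : 'M[K]_(k, N) := M *m (1%:M - delta_mx j j).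
have ZE i l : Z i l = if l == j then 0 else M i l.
  rewrite /Z mulmxBr mulmx1 !mxE (bigD1 j) //= mxE eqxx /= big1 ?addr0; last first.
    by move=> x /negPf xj; rewrite mxE xj mulr0.
  by case: eqP => [->|_]; rewrite ?mulr1 ?mulr0 ?subrr ?subr0.
have nfZ : ~~ row_free Z.
  apply/negP => /row_free_minor[s]; rewrite unitmxE unitfE => /negP; apply; apply/eqP.
  have [[l sl]|ns] := pselect (exists l, s l = j).
    apply: (minor0 (l := l)); apply/colP => i.
    by rewrite [LHS]mxE ZE sl eqxx mxE.
  rewrite -(H s); last by move=> l sl; apply: ns; exists l.
  congr determinant; apply/matrixP => i l; rewrite [LHS]mxE ZE [RHS]mxE.
  by case: eqP => // sl; case: ns; exists l.
have /rowV0Pn[x /sub_kermxP xZ x0] : kermx Z != 0.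
  by move: nfZ; rewrite -kermx_eq0.
have xM : x *m M = (x *m M) 0 j *: delta_mx 0 j.
  apply/rowP => l; rewrite [RHS]mxE [delta_mx _ _ _ _]mxE eqxx /=.
  have [->|lj] := eqVneq l j; first by rewrite mulr1.
  rewrite mulr0; have := congr1 (fun v : 'rV_N => v 0 l) xZ; rewrite mxE [RHS]mxE => <-.
  by rewrite mxE; apply: eq_bigr => i _; rewrite ZE (negPf lj).
have c0 : (x *m M) 0 j != 0.
  apply: contra x0 => /eqP c0; move: xM; rewrite c0 scale0r => /eqP.
  by rewrite mulmx_free_eq0.
move: xM c0; set c := (x *m M) 0 j => xM c0; apply/submxP; exists (c^-1 *: x).
by rewrite -scalemxAl xM scalerA mulVf // scale1r.
Qed.

(** A row-free matrix with rows in W and as many rows as possible spans W. This yields frames of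
    lattices that are only known as sets of vectors. *)
Lemma row_spaceP N (W : set 'rV[K]_N) :
  W 0 -> (forall c v w, W v -> W w -> W (c *: v + w)) ->
  exists k (M : 'M[K]_(k, N)), row_free M /\ forall v, W v <-> (v <= M)%MS.
Proof.
move=> W0 WD.
pose P r := `[< exists M : 'M[K]_(r, N), row_free M /\ forall i, W (row i M) >].
have P0 : exists r, P r.
  exists 0; apply/asboolP; exists 0; split; last by case.
  by rewrite /row_free mxrank0.
have Pub r : P r -> (r <= N)%N.
  by move=> /asboolP[M [/eqP rM _]]; rewrite -rM; apply: rank_leq_col.
have [r /asboolP[M [fM WM]] rmax] := ex_maxnP P0 Pub.
exists r, M; split=> // v; split=> [Wv|/submxP[x ->]]; last first.
  rewrite mulmx_sum_row; elim/big_ind: _ => //; last first.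
    by move=> i _; rewrite -[_ *: _]addr0; apply: WD.
  by move=> y z Wy Wz; rewrite -[y]scale1r; apply: WD.
apply: contraT => nvM.
suff /rmax : P (1 + r)%N by rewrite add1n ltnn.
apply/asboolP; exists (col_mx v M); split.
  have : (r < \rank (col_mx v M))%N.
    rewrite -[X in (X < _)%N](eqP fM) -addsmxE.
    rewrite (ltn_leqif (mxrank_leqif_sup (addsmxSr v M))).
    by apply: contra nvM; apply: submx_trans; apply: addsmxSl.
  by rewrite /row_free eqn_leq rank_leq_row.
move=> i; case: (split_ordP i) => i' ->.
  by rewrite rowKu; rewrite (_ : row i' v = v) //; apply/rowP => j; rewrite mxE ord1.
by rewrite rowKd.
Qed.

Lemma poly_meval N (p : {mpoly K[N]}) (P : 'I_N -> {poly K}) :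
  exists Q : {poly K}, forall s, p.@[fun i => (P i).[s]] = Q.[s].
Proof.
exists (\sum_(m <- msupp p) (p@_m)%:P * \prod_i P i ^+ m i) => s.
rewrite mevalE horner_sum; apply: eq_bigr => m _; rewrite hornerM hornerC.
by rewrite horner_prod; congr (_ * _); apply: eq_bigr => i _; rewrite horner_exp.
Qed.

End Minors.

(** * Lattices in window coordinates *)

Section Windows.
Import Order.TTheory GRing.Theory Num.Theory.
Local Open Scope classical_set_scope.
Local Open Scope ring_scope.
Variables (K : fieldType) (n : nat).
Notation F := (laurent K).
Implicit Types (a b : 'I_n -> int) (v w : 'cV[F]_n) (g : SL n F).

Definition lattice_of a : set 'cV[F]_n := [set v | weighted a (fun=> 0) v].

Lemma lattice0E : @lattice0 K n = lattice_of (fun=> 0).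
Proof.
apply/seteqP; split=> v H i; first by move=> j; rewrite ord1; apply: H.
exact: (H i 0).
Qed.

Lemma lattice1E d : @lattice1 K n d = lattice_of (eps d).
Proof.
apply/seteqP; split=> v => [[H0 H1] i j|H].
  rewrite ord1 subr0 /eps; have := H0 i; case: leqP => [di H k k1|_] //.
  by have [->|k0] := eqVneq k 0; [apply: H1|apply: H; move: k1 k0 => /=; lia].
split=> [i|i di].
  apply: (@val_geW _ (eps d i - 0)); last exact: H.
  by rewrite /eps; lia.
by apply: (H i 0); rewrite /eps di.
Qed.

Lemma val_ge_lmonomialM k l (f : F) :
  val_ge l (lmonomial 1 k * f) <-> val_ge (l - k) f.
Proof.
split=> H i il; last by rewrite coef_lmonomialM mul1r H //; lia.
by have := H (i + k); rewrite coef_lmonomialM addrK mul1r; apply; lia.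
Qed.

Lemma weighted_lattice a b (M : 'M[F]_n) :
  weighted a b M <-> forall v, lattice_of b v -> lattice_of a (M *m v).
Proof.
split=> [wM v|H i j]; first exact: weightedM.
have wj : lattice_of b (lmonomial 1 (b j) *: delta_mx j 0).
  move=> k l; rewrite ord1 !mxE andbT subr0; case: eqP => [->|_].
    by rewrite mulr1; apply: val_ge_lmonomial.
  by rewrite mulr0; apply: val_ge0.
have := H _ wj i 0; rewrite -scalemxAr -colE !mxE subr0.
by move/val_ge_lmonomialM.
Qed.

Lemma act_latticeP g (L : set 'cV[F]_n) v :
  act_lattice g L v <-> L (g^-1%g *m v).
Proof.
have [gV Vg] : g *m g^-1%g = 1%:M /\ g^-1%g *m g = 1%:M.
  by rewrite -!slmxM mulgV mulVg.
split=> [[u Lu <-]|Lv]; first by rewrite mulmxA Vg mul1mx.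
by exists (g^-1%g *m v); rewrite // mulmxA gV mul1mx.
Qed.

Variable m : nat.
Notation N := (n * (m + m))%N.

Definition unwindow (w : 'rV[K]_N) : 'cV[F]_n :=
  \col_i \sum_(k < m + m) lmonomial (vec_mx w i k) (k%:Z - m%:Z).

Lemma coef_unwindow (w : 'rV[K]_N) i j : (unwindow w) i 0 j =
  \sum_(k < m + m) if j == k%:Z - m%:Z then vec_mx w i k else 0.
Proof. by rewrite mxE lcoef_sum. Qed.

Lemma unwindowK (w : 'rV[K]_N) : window m (unwindow w) = w.
Proof.
rewrite -[RHS]vec_mxK; congr mxvec; apply/matrixP => i k; rewrite mxE coef_unwindow.
rewrite (bigD1 k) //= eqxx big1 ?addr0 // => l lk.
by case: eqP => // /addIr [] /val_inj E; rewrite E eqxx in lk.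
Qed.

Definition low v := lattice_of (fun=> - m%:Z) v.
Definition high v := lattice_of (fun=> m%:Z) v.

Lemma low_unwindow (w : 'rV[K]_N) : low (unwindow w).
Proof.
move=> i j; rewrite ord1 subr0 => k km; rewrite coef_unwindow big1 // => l _.
by case: eqP => // kl; lia.
Qed.

Lemma window_lin c v w : window m (lconst c *: v + w) = c *: window m v + window m w.
Proof.
rewrite -linearP /=; congr mxvec; apply/matrixP => i k.
by rewrite !mxE coefD lcoef_constM.
Qed.

Lemma window_eq0 v : low v -> window m v = 0 <-> high v.
Proof.
move=> lv; split=> [v0 i j k|hv].
  rewrite ord1 subr0 => km; have [kl|kl] := ltP k (- m%:Z).
    by apply: lv; rewrite subr0.
  have kn : (absz (k + m%:Z)%R < m + m)%N by lia.
  have := congr1 (fun x : 'rV[K]_N => vec_mx x i (Ordinal kn)) v0.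
  rewrite mxvecK linear0 !mxE /= => <-; congr (v i 0 _); lia.
apply/eqP; rewrite mxvec_eq0; apply/eqP/matrixP => i k; rewrite !mxE.
by apply: (hv i 0); have := ltn_ord k; lia.
Qed.

Lemma window_delta_coef v i (k : 'I_(m + m)) :
  (window m v) 0 (mxvec_index i k) = v i 0 (k%:Z - m%:Z).
Proof. by rewrite mxvecE mxE. Qed.

(** The window map is linear over K, so lattices enter the construction of frames as K-subspaces. *)
Definition const_closed (L : set 'cV[F]_n) :=
  forall c v w, L v -> L w -> L (lconst c *: v + w).

Lemma lattice_of_closed a : const_closed (lattice_of a).
Proof.
move=> c v w Lv Lw i j; rewrite !mxE; apply: val_geD (Lw i j).
by rewrite -[X in val_ge X]add0r; apply: val_geM (Lv i j); apply: val_ge_lconst.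
Qed.

Lemma act_lattice_closed g L : const_closed L -> const_closed (act_lattice g L).
Proof.
move=> HL c _ _ [v Lv <-] [w Lw <-]; exists (lconst c *: v + w); first exact: HL.
by rewrite mulmxDr scalemxAr.
Qed.

Lemma frame_exists (L : set 'cV[F]_n) :
  const_closed L -> (forall v, high v -> L v) -> (forall v, L v -> low v) ->
  exists k (M : 'M[K]_(k, N)), frames M L.
Proof.
move=> cL hL lL.
have L0 : L 0 by apply: hL => i j; rewrite mxE; apply: val_ge0.
have [||k [M [fM ML]]] := @row_spaceP K N [set window m v | v in L].
- by exists 0 => //; apply/window_eq0 => [i j|i j]; rewrite mxE; apply: val_ge0.
- move=> c _ _ [v Lv <-] [w Lw <-]; exists (lconst c *: v + w); first exact: cL.
  exact: window_lin.
exists k, M; split=> // v; split=> [Lv|[lv /ML[u Lu uv]]].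
  split; last by apply/ML; exists v.
  by move=> i j jm; apply: (lL v Lv i 0); rewrite subr0.
(* Two vectors with the same window differ by an element of t^m A^n, which L contains. *)
have -> : v = lconst 1 *: u + (lconst (-1) *: u + v).
  by rewrite addrA -scalerDl -rmorphD subrr rmorph0 scale0r add0r.
apply: (cL) => //; apply: hL.
have lv' : low v by move=> i j l; rewrite ord1 subr0; apply: lv.
apply/window_eq0; first by apply: lattice_of_closed => //; apply: lL.
by rewrite window_lin uv scaleN1r addNr.
Qed.

Lemma frames_low k (M : 'M[K]_(k, N)) L v : frames M L ->
  L v <-> low v /\ (window m v <= M)%MS.
Proof.
move=> [_ ML]; split=> [/ML[lv vM]|[lv vM]].
  by split=> // i j l; rewrite ord1 subr0; apply: lv.
by apply/ML; split=> // i j jm; apply: (lv i 0); rewrite subr0.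
Qed.

Lemma weighted_const0 (W : 'M[K]_n) a c s :
  a = (fun=> c) -> weighted a a (1%:M + lmonomial s 1 *: map_mx (@lconst K) W).
Proof.
move=> ->; apply: weightedD; first exact: weighted1.
move=> i j; rewrite !mxE subrr; apply: (@val_geW _ 1) => //.
by rewrite -[1]addr0; apply: val_geM; [apply: val_ge_lmonomial|apply: val_ge_lconst].
Qed.

(** The endomorphism v |-> t W v of t^-m A^n / t^m A^n: W acts on the coordinates, and the right
    factor moves each coefficient up by one power, dropping the last. *)
Definition window_shift (W : 'M[K]_n) : 'M[K]_N :=
  lin_mulmx W *m lin_mulmxr (\matrix_(k, l) (k.+1 == l :> nat)%:R).

Lemma window_shiftE W v s : low v ->
  window m ((1%:M + lmonomial s 1 *: map_mx (@lconst K) W) *m v) =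
  window m v *m (1%:M + s *: window_shift W).
Proof.
move=> lv; rewrite mulmxDr mulmx1 -scalemxAr mulmxA [mxvec _ *m lin_mx _]mul_vec_lin.
rewrite [mxvec _ *m lin_mx _]mul_vec_lin /= -linearZ -linearD /=; congr mxvec.
apply/matrixP => i k; rewrite mulmxDl mul1mx -scalemxAl [LHS]mxE mxE [RHS]mxE [in RHS]mxE.
rewrite coefD; congr (_ + _).
rewrite [in LHS]mxE coef_lmonomialM [in RHS]mxE; congr (_ * _).
rewrite mxE lcoef_sum [RHS]mxE.
(* For k = 0 the contribution comes from t^(-m-1), below the window, where v vanishes. *)
have [k0|k0] := posnP k.
  rewrite big1 => [|j _]; last first.
    by rewrite mxE lcoef_constM (lv j 0) ?mulr0 // k0; lia.
  by rewrite big1 // => l _; rewrite [X in _ * X]mxE k0 mulr0.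
have kl : (k.-1 < m + m)%N by have := ltn_ord k; lia.
rewrite [RHS](bigD1 (Ordinal kl)) // [X in _ = _ * X + _]mxE.
rewrite [nat_of_ord (Ordinal kl)]/= prednK // eqxx mulr1.
rewrite [X in _ = _ + X]big1 ?addr0 => [|l lk]; last first.
  rewrite [X in _ * X]mxE; case: eqP => [E|]; rewrite ?mulr0 //.
  by case/eqP: lk; apply: val_inj; rewrite /= -E.
rewrite mxE; apply: eq_bigr => j _.
rewrite [map_mx _ _ _ _]mxE lcoef_constM [in RHS]mxE; congr (_ * v j 0 _).
by rewrite /=; lia.
Qed.

Lemma window_shift_sqr W : W *m W = 0 -> window_shift W *m window_shift W = 0.
Proof.
move=> WW; apply/row_matrixP => i; rewrite row0 rowE.
rewrite -[delta_mx 0 i]vec_mxK /window_shift !mulmxA.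
rewrite [mxvec _ *m lin_mx _]mul_vec_lin [mxvec _ *m lin_mx _]mul_vec_lin.
rewrite [mxvec _ *m lin_mx _]mul_vec_lin [mxvec _ *m lin_mx _]mul_vec_lin /=.
by rewrite !mulmxA WW !mul0mx linear0.
Qed.

(** As W^2 = 0, the parameter -s gives the inverse shear, on vectors as on windows, so a basis of
    one quotient is carried to a basis of the other. *)
Lemma frames_shear k (M : 'M[K]_(k, N)) (L : set 'cV[F]_n) W s g g' :
  W *m W = 0 -> slmx g' = (1%:M + lmonomial s 1 *: map_mx (@lconst K) W) *m g ->
  frames M (act_lattice g L) ->
  frames (M *m (1%:M + s *: window_shift W)) (act_lattice g' L).
Proof.
move=> WW gE fM; pose H x : 'M[F]_n := 1%:M + lmonomial x 1 *: map_mx (@lconst K) W.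
pose D x : 'M[K]_N := 1%:M + x *: window_shift W.
have HK x : H x *m H (- x) = 1%:M.
  rewrite /H mulmxDr mulmx1 mulmxDl mul1mx -scalemxAl -scalemxAr -map_mxM WW.
  rewrite map_mx0 !scaler0 addr0 -addrA -scalerDl.
  rewrite (_ : lmonomial x 1 + _ = 0) ?scale0r ?addr0 //.
  by apply: laurentP => i; rewrite coefD /=; case: eqP; rewrite ?addr0 ?subrr ?if_same.
have DK x : D x *m D (- x) = 1%:M.
  rewrite /D mulmxDr mulmx1 mulmxDl mul1mx -scalemxAl -scalemxAr window_shift_sqr //.
  by rewrite !scaler0 addr0 -addrA -scalerDl subrr scale0r addr0.
have lH x v : low v -> low (H x *m v) by apply: weightedM; apply: weighted_const0.
have gH : g'^-1%g = g^-1%g *m H (- s) :> 'M_n.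
  have Vg : g^-1%g *m g = 1%:M by rewrite -slmxM mulVg.
  have g'V : g' *m g'^-1%g = 1%:M by rewrite -slmxM mulgV.
  have HKs : H (- s) *m H s = 1%:M by have := HK (- s); rewrite opprK.
  rewrite -[RHS]mulmx1 -g'V gE -/(H s) !mulmxA -(mulmxA g^-1%g) HKs mulmx1 Vg.
  by rewrite mul1mx.
have actE v : act_lattice g' L v <-> act_lattice g L (H (- s) *m v).
  by rewrite !act_latticeP gH mulmxA.
split.
  rewrite -/(D s) /row_free mxrankMfree; first by case: fM.
  by apply/row_freeP; exists (D (- s)).
move=> v; rewrite actE (frames_low _ fM).
have lE : low v <-> forall i (j : int), j < - m%:Z -> v i 0 j = 0.
  split=> lv i j; first by move=> jm; apply: (lv i 0); rewrite subr0.
  by rewrite ord1 subr0 => l; apply: lv.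
rewrite -lE; split=> [[lv vM]|[lv vM]].
  have {}lv : low v.
    by have := lH s _ lv; rewrite mulmxA HK mul1mx.
  split=> //; move: vM; rewrite window_shiftE // -/(D (- s)) => /(submxMr (D s)).
  by have := DK (- s); rewrite opprK -mulmxA => ->; rewrite mulmx1.
split; first exact: lH.
rewrite window_shiftE // -/(D (- s)); have := submxMr (D (- s)) vM.
by rewrite -/(D s) -mulmxA DK mulmx1.
Qed.

End Windows.

(** * The closure of the image of phi *)

Section Closure.
Import Order.TTheory GRing.Theory Num.Theory.
Local Open Scope classical_set_scope.
Local Open Scope quotient_scope.
Local Open Scope ring_scope.

Definition grassmannian_locus (K : fieldType) n d : set (flag K n d) :=
  [set x | exists2 g, over_grassmannian d g & x = flag_pi d g].

Lemma grassmannian_locusP (K : fieldType) n d (g : SL n (laurent K)) :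
  grassmannian_locus (flag_pi d g) <-> over_grassmannian d g.
Proof.
split=> [[h Zh /esym/flag_piP[q Qq ->]]|Zg]; last by exists g.
have P1 : SL_power_series (1%g : SL n (laurent K)).
  by apply: weighted_SL_power_series; apply: weighted1.
by rewrite -[h]mul1g; apply: over_grassmannianM => //; apply: two_step_stab.
Qed.

(** The index l stands for t^(l - m). Inclusion in E0 concerns l < m, inclusion of t E0 concerns l >
    m, and l = m, the level of E0 / t E0, stays free. *)
Lemma over_grassmannian_windows (K : fieldType) n d (g : SL n (laurent K)) m k
    (M : 'M[K]_(k, n * (m + m))) :
  frames M (act_lattice g (@lattice1 K n d)) ->
  over_grassmannian d g <->
  forall (i : 'I_n) (l : 'I_(m + m)),
    ((l < m)%N -> col (mxvec_index i l) M = 0) /\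
    ((m < l)%N -> ((delta_mx 0 (mxvec_index i l) : 'rV_(n * (m + m))) <= M)%MS).
Proof.
rewrite lattice1E => fM.
have LM v : lattice_of (eps d) (g^-1%g *m v) <-> low m v /\ (window m v <= M)%MS.
  by rewrite -act_latticeP; apply: frames_low.
have gV : g^-1%g *m g = 1%:M by rewrite -slmxM mulVg.
have Vg : g *m g^-1%g = 1%:M by rewrite -slmxM mulgV.
have -> : over_grassmannian d g <->
    (forall v, low m v -> (window m v <= M)%MS -> lattice_of (fun=> 0) v) /\
    (forall v, lattice_of (fun=> 1) v -> low m v /\ (window m v <= M)%MS).
  split=> [[/weighted_lattice w0 /weighted_lattice w1]|[w0 w1]].
    split=> v; last by move/w1/LM.
    by move=> lv vM; rewrite -[v]mul1mx -Vg -mulmxA; apply: w0; apply/LM.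
  split; apply/weighted_lattice => v Lv; last exact/LM/w1.
  have /LM[lv vM] : lattice_of (eps d) (g^-1%g *m (g *m v)) by rewrite mulmxA gV mul1mx.
  exact: w0.
split=> [[w0 w1] i l|H]; split.
- move=> lm; apply/colP => r; rewrite !mxE.
  have := w0 _ (low_unwindow (row r M)); rewrite unwindowK row_sub => /(_ isT).
  move=> /(_ i 0 (l%:Z - m%:Z)); rewrite -window_delta_coef unwindowK mxE; apply.
  by rewrite subr0 subr_lt0 ltz_nat.
- move=> ml; rewrite -[X in (X <= _)%MS](@unwindowK K n m).
  apply: (w1 _ _).2 => a b c; rewrite ord1 subr0 => c1.
  rewrite coef_unwindow big1 // => r _; case: eqP => // E.
  rewrite vec_mx_delta mxE; case: (r =P l) => [rl|_]; last by rewrite andbF.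
  by move: E; rewrite rl; lia.
- move=> v lv /submxP[x vM] a b c; rewrite ord1 subr0 => c0.
  have [cm|mc] := ltP c (- m%:Z); first by apply: (lv a 0); rewrite subr0.
  have cn : (absz (c + m%:Z)%R < m + m)%N by lia.
  have [/(_ _)M0 _] := H a (Ordinal cn).
  have := window_delta_coef v a (Ordinal cn).
  rewrite vM mxE big1; last first.
    move=> r _; have := congr1 (fun u : 'cV_k => u r 0) (M0 _).
    by rewrite !mxE => ->; rewrite ?mulr0 //=; lia.
  by move=> ->; congr (v a 0 _); rewrite /=; lia.
move=> v v1; split.
  by move=> a b c c1; apply: v1; apply: lt_le_trans c1 _; lia.
rewrite [window m v]row_sum_delta; apply: summx_sub => j _.
case/mxvec_indexP: j => i l; rewrite window_delta_coef.
have [lm|ml] := leqP l m; last by apply: scalemx_sub; apply: (H i l).2.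
rewrite (v1 i 0) ?scale0r ?sub0mx //; lia.
Qed.

Lemma grassmannian_locus_closed (K : fieldType) n d :
  zariski_closed (@grassmannian_locus K n d).
Proof.
move=> m k0 k1.
(* A negative power is absent from all vectors, so the minors through its column vanish; a positive
   power belongs to the lattice, so the minors avoiding its column vanish. *)
pose bad (s : {ffun 'I_k1 -> 'I_(n * (m + m))}) := exists (i : 'I_n) (l : 'I_(m + m)),
  (l < m)%N /\ (exists r, s r = mxvec_index i l) \/
  (m < l)%N /\ (forall r, s r <> mxvec_index i l).
exists [set 'X_(rshift _ (enum_rank s)) | s in bad] => g M0 M1 _ f1.
rewrite grassmannian_locusP (over_grassmannian_windows f1).
have ev s : plucker_eval M0 M1 'X_(rshift _ (enum_rank s)) = \det (colsub s M1).
  by rewrite /plucker_eval mevalXU row_mxEr mxE enum_rankK.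
have fM : row_free M1 by case: f1.
split=> [H _ [s [i [l [[lm sr]|[ml sr]]]] <-]|H i l]; rewrite ?ev.
- by have /(col_eq0_minors _ fM) := (H i l).1 lm; apply.
- by have /(delta_mx_minors _ fM) := (H i l).2 ml; apply.
split=> lm.
  apply/(col_eq0_minors _ fM) => s sr; rewrite -ev; apply: H; exists s => //.
  by exists i, l; left.
apply/(delta_mx_minors _ fM) => s sr; rewrite -ev; apply: H; exists s => //.
by exists i, l; right.
Qed.

Lemma poly_eq0_numField (K : numFieldType) (p : {poly K}) :
  (forall x, p.[x] = 0) -> p = 0.
Proof.
move=> p0; apply/eqP; apply: contraT => np.
pose rs := [seq i%:R : K | i <- iota 0 (size p)].
have : (size rs < size p)%N.
  apply: max_poly_roots => //.
    by apply/allP => x _; rewrite /root p0.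
  by rewrite map_inj_uniq ?iota_uniq // => i j /eqP; rewrite eqr_nat => /eqP.
by rewrite size_map size_iota ltnn.
Qed.

Lemma entries_bounded (K : fieldType) n (M : 'M[laurent K]_n) :
  exists m : nat, weighted (fun=> - m%:Z) (fun=> 0) M.
Proof.
have /choice[b Hb] : forall ij : 'I_n * 'I_n, exists m : int, val_ge m (M ij.1 ij.2).
  by move=> ij; have [m Hm] := lcoefP (M ij.1 ij.2); exists m.
exists (\max_ij absz (b ij)) => i j k; rewrite subr0 => km; apply: (Hb (i, j)).
by have := leq_bigmax (F := fun ij => absz (b ij)) (i, j); lia.
Qed.

Lemma frames_bounded (K : fieldType) n (g : SL n (laurent K)) :
  exists m, forall a, (forall i, 0 <= a i <= 1) ->
  exists k (M : 'M[K]_(k, n * (m + m))), frames M (act_lattice g (lattice_of a)).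
Proof.
have [[m1 H1] [m2 H2]] := (entries_bounded g, entries_bounded g^-1%g).
(* The pole orders of g and g^-1 control the two inclusions; the extra one is for lattices which,
   like E1, only contain t A^n. *)
exists (m1 + m2).+1 => a a01; apply: frame_exists.
- by apply: act_lattice_closed; apply: lattice_of_closed.
- move=> v hv; apply/act_latticeP; apply: (@weightedM K _ _ _ _ (fun=> m2.+1%:Z)).
    by apply: weightedW H2 => i j; have := a01 i; lia.
  by apply: weightedW hv => i j; lia.
move=> v /act_latticeP Lv; rewrite -[v]mul1mx -slmx1 -(mulgV g) slmxM -mulmxA.
apply: weightedM Lv; apply: weightedW H1 => i j; have := a01 j; lia.
Qed.

Variables (K : numFieldType) (d e : nat).
Hypotheses (d0 : (0 < d)%N) (e0 : (0 < e)%N).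
Notation n := (d + e)%N.

Lemma plucker_poly k N (M D : 'M[K]_(k, N)) i : exists P : {poly K},
  forall s, plucker (M + s *: D) 0 i = P.[s].
Proof.
exists (\det (map_mx polyC (colsub (enum_val i : {ffun _}) M) +
              'X *: map_mx polyC (colsub (enum_val i : {ffun _}) D))) => s.
rewrite horner_det_affine mxE; congr determinant.
by apply/matrixP => x y; rewrite !mxE.
Qed.

Lemma range_phi_locus : range (@phi K n d) `<=` @grassmannian_locus K n d.
Proof.
move=> _ [a _ <-]; rewrite /phi /phi_rep.
case: (repr a) => h [Y HY] /=; apply/grassmannian_locusP/over_grassmannian_const.
have YE : Y = block_mx 0 (ursubmx Y) 0 0.
  apply/matrixP => i j; rewrite -{1}[Y]submxK.
  have Y0 (i' j' : 'I_n) : ~~ (i' < d <= j')%N -> Y i' j' = 0.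
    by move/forallP/(_ i')/forallP/(_ j')/implyP: HY => H /H/eqP.
  case: (split_ordP i) => i' ->; case: (split_ordP j) => j' ->;
    rewrite ?(block_mxEul, block_mxEur, block_mxEdl, block_mxEdr) // !mxE Y0 //=.
  - by rewrite ltn_ord leqNgt ltn_ord.
  - by rewrite ltnNge leq_addr.
  by rewrite ltnNge leq_addr.
have -> : geomSL (Nilradical HY) = geomSL (Nilradical (block_nilradical (ursubmx Y))).
  by congr geomSL; apply: val_inj.
exact: geomSL_weighted.
Qed.

Lemma closure_range_phi : closure (range (@phi K n d)) = @grassmannian_locus K n d.
Proof.
have closedE (Z : set (flag K n d)) : closed Z <-> zariski_closed Z.
  by rewrite -openC; split=> H; [have := H|]; rewrite /open /= ?setCK.
rewrite closureE; apply/seteqP; split=> [x|_ [g Zg ->] C [/closedE cC phiC]].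
  apply; split; last exact: range_phi_locus.
  by apply/closedE; apply: grassmannian_locus_closed.
have [W [P [gs [WW P0 gsE gsP]]]] := curve_to_open_cell d0 e0 Zg.
have [m Hm] := frames_bounded g.
have [k0 [M0 f0]] : exists k0 (M0 : 'M[K]_(k0, n * (m + m))),
    frames M0 (act_lattice g (@lattice0 K n)).
  by rewrite lattice0E; apply: Hm => i.
have [k1 [M1 f1]] : exists k1 (M1 : 'M[K]_(k1, n * (m + m))),
    frames M1 (act_lattice g (@lattice1 K n d)).
  by rewrite lattice1E; apply: Hm => i; rewrite /eps; case: leqP.
(* The shear keeps m, k0 and k1, so the same S tests all points of the curve. *)
have [S HS] := cC m k0 k1.
apply/(HS _ _ _ f0 f1) => p Sp.
pose D := window_shift m W.
pose Q0 s := M0 + s *: (M0 *m D); pose Q1 s := M1 + s *: (M1 *m D).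
have QE k (M : 'M[K]_(k, n * (m + m))) s :
    M + s *: (M *m D) = M *m (1%:M + s *: D).
  by rewrite mulmxDr mulmx1 -scalemxAr.
have /choice[PP HPP] : forall i, exists q : {poly K},
    forall s, row_mx (plucker (Q0 s)) (plucker (Q1 s)) 0 i = q.[s].
  move=> i; case: (split_ordP i) => j ->.
    have [q Hq] := plucker_poly M0 (M0 *m D) j.
    by exists q => s; rewrite row_mxEl Hq.
  have [q Hq] := plucker_poly M1 (M1 *m D) j.
  by exists q => s; rewrite row_mxEr Hq.
have [Q HQ] := poly_meval p PP.
have evQ s : plucker_eval (Q0 s) (Q1 s) p = Q.[s].
  by rewrite -HQ; congr (_.@[_]); apply/funext => i; apply: HPP.
(* Where P is nonzero, the curve is in the image of phi, hence in C, and Q vanishes. *)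
have QP : Q * P = 0.
  apply: poly_eq0_numField => s; rewrite hornerM.
  have [->|Ps] := eqVneq P.[s] 0; first by rewrite mulr0.
  have F0 : frames (Q0 s) (act_lattice (gs s) (@lattice0 K n)).
    by rewrite /Q0 QE; apply: frames_shear f0.
  have F1 : frames (Q1 s) (act_lattice (gs s) (@lattice1 K n d)).
    by rewrite /Q1 QE; apply: frames_shear f1.
  rewrite -evQ; have /(HS _ _ _ F0 F1)/(_ p Sp) -> := phiC _ (gsP s Ps).
  by rewrite mul0r.
have Q00 : Q = 0 by move/eqP: QP; rewrite mulf_eq0 (negPf P0) orbF => /eqP.
have := evQ 0; rewrite Q00 horner0 => <-.
by rewrite /Q0 /Q1 !scale0r !addr0.
Qed.

End Closure.

(** * Affine permutations, reflections and the permutation of [kappa] *)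

Section AffinePermutations.
Import Order.TTheory GRing.Theory Num.Theory.
Local Open Scope ring_scope.
Variable n : nat.
Hypothesis n1 : (1 < n)%N.
Implicit Types (p q x y z a b : int) (f g h : int -> int).

Definition congr_n x y := (n%:Z %| x - y)%Z.

Lemma congr_nP x y : reflect (exists k : int, x = y + k * n%:Z) (congr_n x y).
Proof.
apply: (iffP dvdzP) => -[k E]; exists k; first by rewrite -E addrC subrK.
by rewrite E addrAC subrr add0r.
Qed.

Lemma congr_nxx x : congr_n x x.
Proof. by rewrite /congr_n subrr dvdz0. Qed.

Lemma congr_n_sym x y : congr_n x y = congr_n y x.
Proof. by apply/congr_nP/congr_nP => -[k ->]; exists (- k); ring. Qed.

Lemma congr_n_trans x y z : congr_n x y -> congr_n y z -> congr_n x z.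
Proof.
move=> /congr_nP[k ->] /congr_nP[l ->]; apply/congr_nP.
by exists (l + k); rewrite mulrDl addrA.
Qed.

Lemma congr_n_small x y : congr_n x y -> `|x - y| < n%:Z -> x = y.
Proof.
move=> /congr_nP[k ->]; rewrite addrAC subrr add0r => H.
suff -> : k = 0 by rewrite mul0r addr0.
nia.
Qed.

(** For p and q not congruent, the reflection of the affine symmetric group exchanging p + k n and q
    + k n for all k. *)
Definition affine_transp p q x :=
  if congr_n x p then x + (q - p) else if congr_n x q then x - (q - p) else x.

(** This is the extended group; the condition that determinant 1 puts on the values is extracted in
    [permutes_shifts]. *)
Definition affine_perm f := bijective f /\ forall x, f (x + n%:Z) = f x + n%:Z.

Lemma affine_permMn f x k : affine_perm f -> f (x + k * n%:Z) = f x + k * n%:Z.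
Proof.
case=> _ fn.
have pos (m : nat) y : f (y + m%:Z * n%:Z) = f y + m%:Z * n%:Z.
  elim: m => [|m IH]; first by rewrite !mul0r !addr0.
  by rewrite intS mulrDl mul1r [n%:Z + _]addrC !addrA fn IH.
case: k => m; first exact: pos.
rewrite NegzE; apply: (addIr (m.+1%:Z * n%:Z)); rewrite -pos.
by rewrite mulNr !addrNK.
Qed.

Lemma affine_perm_id : affine_perm id.
Proof. by split=> //; exists id. Qed.

Lemma affine_perm_comp f g : affine_perm f -> affine_perm g -> affine_perm (f \o g).
Proof.
move=> [bf fn] [bg gn]; split; first exact: bij_comp.
by move=> x /=; rewrite gn fn.
Qed.

Lemma affine_perm_inv f g : affine_perm f -> cancel f g -> cancel g f -> affine_perm g.
Proof.
move=> Af fg gf; split; first by exists f.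
move=> x; apply: (can_inj fg); rewrite gf.
by case: Af => _ ->; rewrite gf.
Qed.

Lemma affine_perm_congr f x y : affine_perm f -> congr_n (f x) (f y) = congr_n x y.
Proof.
move=> Af; apply/congr_nP/congr_nP => -[k E]; exists k.
  by case: (Af) => -[g fg gf] _; apply: (can_inj fg); rewrite affine_permMn.
by rewrite E affine_permMn.
Qed.

Lemma affine_transpL p q : affine_transp p q p = q.
Proof. by rewrite /affine_transp congr_nxx addrC subrK. Qed.

Lemma affine_transpR p q : ~~ congr_n p q -> affine_transp p q q = p.
Proof.
by move=> pq; rewrite /affine_transp congr_n_sym (negPf pq) congr_nxx subKr.
Qed.

Lemma congr_n_add x y z w : x - y = z - w -> congr_n x y = congr_n z w.
Proof. by rewrite /congr_n => ->. Qed.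

Lemma affine_transpK p q : ~~ congr_n p q -> involutive (affine_transp p q).
Proof.
move=> pq x; rewrite {2}/affine_transp; case: ifP => [xp|xp].
  have xq : congr_n (x + (q - p)) q by rewrite (@congr_n_add _ _ x p) //; ring.
  rewrite /affine_transp xq; case: ifP => [xp'|_]; last by rewrite addrK.
  by case/negP: pq; rewrite congr_n_sym in xp'; apply: congr_n_trans xp' xq.
case: ifP => [xq|xq]; last by rewrite /affine_transp xp xq.
rewrite /affine_transp (_ : congr_n _ p); first by rewrite subrK.
by rewrite (@congr_n_add _ _ x q) //; ring.
Qed.

Lemma affine_transpC p q : ~~ congr_n p q -> affine_transp p q =1 affine_transp q p.
Proof.
move=> pq x; rewrite /affine_transp; case: ifP => [xp|//].
  case: ifP => [xq|_]; last by ring.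
  by case/negP: pq; rewrite congr_n_sym in xp; apply: congr_n_trans xp xq.
by move=> _; case: ifP => // _; ring.
Qed.

Lemma affine_transp_perm p q : ~~ congr_n p q -> affine_perm (affine_transp p q).
Proof.
move=> pq; split; first by apply: inv_bij; apply: affine_transpK.
move=> x; rewrite /affine_transp.
have E y : congr_n (x + n%:Z) y = congr_n x y.
  apply/congr_nP/congr_nP => -[k E]; [exists (k - 1)|exists (k + 1)]; lia.
by rewrite !E; case: ifP => _; [|case: ifP => _]; rewrite // addrAC.
Qed.

Lemma affine_transp_conj f p q x : affine_perm f ->
  f (affine_transp p q x) = affine_transp (f p) (f q) (f x).
Proof.
move=> Af; rewrite /affine_transp !affine_perm_congr //.
case: ifP => [/congr_nP[k ->]|_].
  rewrite (_ : _ + (q - p) = q + k * n%:Z); last by ring.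
  by rewrite !affine_permMn //; ring.
case: ifP => [/congr_nP[k ->]|//].
rewrite (_ : _ - (q - p) = p + k * n%:Z); last by ring.
by rewrite !affine_permMn //; ring.
Qed.

Lemma eq_affine_transp p q p' q' : congr_n p p' -> q - p = q' - p' ->
  affine_transp p q =1 affine_transp p' q'.
Proof.
move=> pp E x; rewrite /affine_transp -E.
have H y y' z : congr_n y y' -> congr_n z y = congr_n z y'.
  by move=> yy; apply/idP/idP => H; apply: congr_n_trans H _; rewrite // congr_n_sym.
have qq : congr_n q q' by rewrite (@congr_n_add _ _ p p') //; move: E; clear; lia.
by rewrite (H _ _ _ pp) (H _ _ _ qq).
Qed.

(** With positions counted from 0, s_i exchanges i - 1 and i; for i = 0 these are the indices of t
    e_n and e_1. *)
Definition adj_transp z := affine_transp (z - 1) z.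

Lemma adj_not_congr z : ~~ congr_n (z - 1) z.
Proof. by apply/negP => /congr_n_small; lia. Qed.

Lemma adj_transpK z : involutive (adj_transp z).
Proof. by apply: affine_transpK; apply: adj_not_congr. Qed.

Lemma adj_transp_perm z : affine_perm (adj_transp z).
Proof. by apply: affine_transp_perm; apply: adj_not_congr. Qed.

Lemma adj_transpE a z x : a <= z - 1 -> z < a + n%:Z -> a <= x < a + n%:Z ->
  adj_transp z x = if x == z - 1 then z else if x == z then z - 1 else x.
Proof.
move=> az za xa; have E y : a <= y < a + n%:Z -> congr_n x y = (x == y).
  move=> ya; apply/idP/eqP => [/congr_n_small|->]; last exact: congr_nxx.
  by apply; lia.
rewrite /adj_transp /affine_transp !E; try lia.
by case: eqP => [->|_]; [lia|case: eqP => [->|_]; lia].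
Qed.

Lemma adj_transp_shift z : adj_transp (z + n%:Z) =1 adj_transp z.
Proof.
by apply: eq_affine_transp; [apply/congr_nP; exists 1|]; lia.
Qed.

(** Integers move by at most one, so only exchanged neighbours can be inverted. *)
Lemma adj_transp_flip z x y : x < y -> adj_transp z y < adj_transp z x ->
  congr_n x (z - 1) /\ y = x + 1.
Proof.
move=> xy; have z1 : z - (z - 1) = 1 by ring.
rewrite /adj_transp /affine_transp z1.
case: (ifP (congr_n x _)) => [xz|xz].
  case: ifP => [yz|yz]; first by lia.
  by case: ifP => _; lia.
case: (ifP (congr_n x _)) => [xz'|xz']; case: ifP => [yz|yz]; try lia; case: ifP => [yz'|yz']; try lia.
Qed.

Fixpoint word_perm (w : seq nat) : int -> int :=
  if w is i :: w' then adj_transp i%:Z \o word_perm w' else id.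

Lemma word_perm_affine w : affine_perm (word_perm w).
Proof.
elim: w => [|i w IH]; first exact: affine_perm_id.
by apply: affine_perm_comp IH; apply: adj_transp_perm.
Qed.

Lemma word_perm_cat w w' : word_perm (w ++ w') =1 word_perm w \o word_perm w'.
Proof. by move=> x; elim: w => //= i w /= ->. Qed.


(** The strong exchange condition. Some letter, acting after those to its right, first inverts the
    images of p and q; these images are the neighbours it exchanges, so deleting it amounts to
    composing with the reflection. *)
Lemma exchange w p q : all (gtn n) w -> ~~ congr_n p q -> p < q ->
    word_perm w q < word_perm w p ->
  exists w', [/\ size w = (size w').+1, all (gtn n) w' &
    word_perm w' =1 word_perm w \o affine_transp p q].
Proof.
move=> + pq plq; elim: w => [|i w IH] /= => [_|/andP[iw ww]]; first by lia.
have Aw := word_perm_affine w.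
move=> flip; have [lt|le] := ltP (word_perm w q) (word_perm w p).
  have [w' [-> ww' w'E]] := IH ww lt; exists (i :: w'); split=> //=; first by rewrite iw.
  by move=> x /=; rewrite w'E.
have lt : word_perm w p < word_perm w q.
  rewrite lt_neqAle le andbT; apply: contraNneq pq => E.
  by rewrite -(affine_perm_congr _ _ Aw) E congr_nxx.
have [pi qi] := adj_transp_flip lt flip.
exists w; split=> // x /=; rewrite affine_transp_conj // qi.
rewrite (@eq_affine_transp _ _ (i%:Z - 1) i%:Z) //; last by ring.
by rewrite -[affine_transp _ _]/(adj_transp i) adj_transpK.
Qed.

(** Conjugation by the simple reflection exchanging p and p + 1 replaces p by p + 1 and does not
    raise q, so the distance shrinks until it is 1. *)
Lemma affine_transp_word p q : ~~ congr_n p q -> p < q ->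
  exists w i, [/\ all (gtn n) w, (i < n)%N &
    affine_transp p q =1 word_perm (w ++ i :: rev w)].
Proof.
move=> + plq; have [N] : exists N : nat, q - p < N%:Z by exists (absz (q - p)%R).+1; lia.
elim: N p q plq => [|N IH] p q plq qpN pq; first by lia.
have [i [iltn iq]] : exists i, (i < n)%N /\ congr_n (p + 1) i%:Z.
  have n0 : n%:Z != 0 by lia.
  have := modz_ge0 (p + 1) n0; have : ((p + 1) %% n%:Z)%Z < n%:Z by rewrite ltz_pmod; lia.
  have := divz_eq (p + 1) n%:Z.
  case: ((p + 1) %% n%:Z)%Z => // i E iltn _; exists i; split; first by lia.
  by apply/congr_nP; exists ((p + 1) %/ n%:Z)%Z; rewrite [RHS]addrC.
have pi : congr_n p (i%:Z - 1) by rewrite (@congr_n_add _ _ (p + 1) i%:Z) //; ring.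
have sE : adj_transp i%:Z =1 affine_transp p (p + 1).
  by move=> x; apply/esym/eq_affine_transp => //; ring.
have [qE|qp1] := eqVneq q (p + 1).
  by exists [::], i; split=> // x; rewrite qE -sE.
have As := adj_transp_perm i%:Z.
have sp : adj_transp i%:Z p = p + 1 by rewrite sE affine_transpL.
have sqE : adj_transp i%:Z q = if congr_n q (p + 1) then q - 1 else q.
  rewrite sE /affine_transp congr_n_sym (negPf pq).
  by case: ifP => // _; ring.
(* If q is congruent to p + 1, it moves down to q - 1, which still exceeds p + 1 because n > 1. *)
have sq : p + 1 < adj_transp i%:Z q /\ adj_transp i%:Z q <= q.
  rewrite sqE; case: ifP => [/congr_nP[k kE]|_]; last by lia.
  by split; last lia; have : 0 < k; nia.
have pq' : ~~ congr_n (p + 1) (adj_transp i%:Z q).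
  by rewrite -sp affine_perm_congr.
have qN : adj_transp i q - (p + 1) < N%:Z by lia.
have [w [j [ww jn wE]]] := IH _ _ sq.1 qN pq'.
exists (i :: w), j; split=> //=; first by rewrite iltn.
rewrite (_ : _ ++ _ = (w ++ j :: rev w) ++ [:: i]); last first.
  by rewrite rev_cons -cats1 /= -catA.
move=> x; rewrite /= word_perm_cat /= -wE affine_transp_conj // -{1}sp.
by rewrite !adj_transpK.
Qed.

(** Letters are integers rather than residues, so that the word v_k, whose letters pass from n - 1
    to 0, becomes a single ascending run. *)
Fixpoint ascending a (m : nat) : int -> int :=
  if m is m'.+1 then adj_transp a \o ascending (a + 1) m' else id.

Lemma ascendingD a m1 m2 : ascending a (m1 + m2) =1
  ascending a m1 \o ascending (a + m1%:Z) m2.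
Proof.
elim: m1 a => [|m1 IH] a x /=; first by rewrite addr0.
by rewrite IH /= intS addrA.
Qed.

Lemma ascending_shift a m : ascending (a + n%:Z) m =1 ascending a m.
Proof.
elim: m a => //= m IH a x /=.
by rewrite adj_transp_shift addrAC IH.
Qed.

Lemma ascending_perm a m : affine_perm (ascending a m).
Proof.
elim: m a => [|m IH] a; first exact: affine_perm_id.
by apply: affine_perm_comp (IH _); apply: adj_transp_perm.
Qed.

Lemma ascendingE a (m : nat) x : (m < n)%N -> a - 1 <= x < a - 1 + n%:Z ->
  ascending a m x = if x < a + m%:Z - 1 then x + 1 else
                    if x == a + m%:Z - 1 then a - 1 else x.
Proof.
elim: m a x => [|m IH] a x mn xa /=.
  by rewrite addr0; case: ltP; [lia|case: eqP => [->|]].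
have [E|xa1] := eqVneq x (a - 1).
  (* The integer a - 1 lies just below the period a, ..., a + n - 1 of the induction hypothesis,
     hence the translation by n. *)
  have := affine_permMn x 1 (ascending_perm (a + 1) m); rewrite mul1r.
  have -> : ascending (a + 1) m (x + n%:Z) = x + n%:Z.
    by rewrite IH; repeat (case: ifP => ?); lia.
  move=> /addIr <-; rewrite (@adj_transpE (a - 1)); [|lia..].
  by repeat (case: ifP => ?); lia.
rewrite IH; [|lia|lia].
by repeat (case: ifP => ?); rewrite (@adj_transpE (a - 1)); repeat (case: ifP => ?); lia.
Qed.

Lemma word_perm_iota k m : word_perm (iota k m) =1 ascending k m.
Proof.
elim: m k => // m IH k x /=; rewrite IH.
by rewrite -addn1 PoszD.
Qed.

Lemma word_perm_rev w : word_perm (rev w) \o word_perm w =1 id.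
Proof.
elim: w => // i w IH x; rewrite rev_cons -cats1 /= word_perm_cat /= adj_transpK.
exact: IH.
Qed.

Lemma u_word_perm d k x : (d < n)%N -> (0 < d)%N -> (k <= d)%N -> (0 < k)%N ->
  k%:Z - 1 <= x < k%:Z - 1 + n%:Z ->
  word_perm (u_word n d k) x =
    if x == k%:Z - 1 then x + (n - d)%N%:Z else
    if x < k%:Z + (n - d)%N%:Z then x - 1 else x.
Proof.
move=> dn d0 kd k0 xk; have := word_perm_rev (u_word n d k).
rewrite /u_word revK => H; set y := (RHS).
have -> : x = word_perm (iota k (n - d)) y.
  rewrite word_perm_iota /y; repeat (case: ifP => ?);
  by rewrite ascendingE; repeat (case: ifP => ?); lia.
exact: (word_perm_rev (iota k (n - d)) y).
Qed.

Lemma v_word_perm d k x : (k < d)%N -> (d <= n - d)%N ->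
  (d + k)%N%:Z - n%:Z <= x < (d + k)%N%:Z ->
  word_perm (v_word n d k) x =
    if x < k%:Z then x + 1 else
    if x == k%:Z then x - (n - d)%N%:Z else x.
Proof.
move=> kd dnd xk.
have nE : (n - d)%N = ((n - (d + k).+1) + k.+1)%N by lia.
have -> : word_perm (v_word n d k) x = ascending ((d + k).+1%:Z - n%:Z) (n - d) x.
  rewrite nE ascendingD [RHS]/comp -[RHS]ascending_shift subrK /v_word word_perm_cat.
  rewrite [LHS]/comp !word_perm_iota.
  by congr (ascending _ _ (ascending _ _ _)); lia.
by rewrite ascendingE; repeat (case: ifP => ?); lia.
Qed.

(** The induction invariant for the first j words: they exchange two adjacent intervals of lengths j
    and n - d. *)
Lemma w1_word_perm d j x : (0 < d)%N -> (d < n)%N -> (j <= d)%N -> 0 <= x < n%:Z ->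
  word_perm (flatten [seq u_word n d k | k <- iota 1 j]) x =
    if x < j%:Z then x + (n - d)%N%:Z else
    if x < (j + (n - d))%N%:Z then x - j%:Z else x.
Proof.
move=> d0 dn; elim: j x => [|j IH] x jd x0.
  by rewrite /=; repeat (case: ifP => ?); lia.
rewrite -[in X in iota 1 X]addn1 iotaD map_cat flatten_cat word_perm_cat /= cats0 add1n.
have [xj|xj] := ltP x j%:Z.
  have -> : word_perm (u_word n d j.+1) x = x.
    apply: (addIr (1 * n%:Z)); rewrite -affine_permMn; last exact: word_perm_affine.
    by rewrite u_word_perm //; repeat (case: ifP => ?); lia.
  by rewrite IH; repeat (case: ifP => ?); lia.
rewrite u_word_perm //; try lia.
by repeat (case: ifP => ?); rewrite IH; repeat (case: ifP => ?); lia.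
Qed.

Lemma w2_word_perm d j x : (0 < d)%N -> (d <= n - d)%N -> (j <= d)%N ->
  d%:Z - n%:Z <= x < d%:Z ->
  word_perm (flatten [seq v_word n d k | k <- rev (iota 0 j)]) x =
    if x < 0 then x + j%:Z else
    if x < j%:Z then x - (n - d)%N%:Z else x.
Proof.
move=> d0 dn; elim: j x => [|j IH] x jd x0.
  by rewrite /=; repeat (case: ifP => ?); lia.
rewrite -[in X in iota 0 X]addn1 iotaD rev_cat map_cat flatten_cat word_perm_cat /= cats0.
rewrite IH //; last lia.
case: ifP => ?.
  by rewrite v_word_perm //; try lia; repeat (case: ifP => ?); lia.
case: ifP => ?; last by rewrite v_word_perm //; try lia; repeat (case: ifP => ?); lia.
have -> y : word_perm (v_word n d j) y = word_perm (v_word n d j) (y + 1 * n%:Z) - n%:Z.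
  by rewrite affine_permMn ?mul1r ?addrK //; apply: word_perm_affine.
by rewrite v_word_perm //; repeat (case: ifP => ?); lia.
Qed.

(** This is diag(t, 1, t^-1) in blocks, since t lowers indices by n. Translations by n bring the
    argument into the periods where the formulas for the two factors apply. *)
Lemma kappa_word_perm d x : (0 < d)%N -> (d <= n - d)%N -> 0 <= x < n%:Z ->
  word_perm (w1_word n d ++ w2_word n d) x =
    if x < d%:Z then x - n%:Z else if x < (n - d)%N%:Z then x else x + n%:Z.
Proof.
move=> d0 dn x0; rewrite word_perm_cat /=.
have S y (k : int) : word_perm (w1_word n d) y =
    word_perm (w1_word n d) (y + k * n%:Z) - k * n%:Z.
  by rewrite affine_permMn ?addrK //; apply: word_perm_affine.
have [xd|dx] := ltP x d%:Z.
  rewrite (@w2_word_perm d d) //; [|lia].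
  rewrite ltNge (andP x0).1 /= xd (S _ 1) /w1_word w1_word_perm //; [|lia..].
  by repeat (case: ifP => ?); lia.
have -> : word_perm (w2_word n d) x = word_perm (w2_word n d) (x + (-1) * n%:Z) + n%:Z.
  by rewrite affine_permMn ?mulN1r ?subrK //; apply: word_perm_affine.
rewrite (@w2_word_perm d d) //; [|lia].
rewrite ifT; last by lia.
have [xn|nx] := ltP x (n - d)%N%:Z.
  rewrite (S _ 0) /w1_word w1_word_perm //; [|lia..].
  by repeat (case: ifP => ?); lia.
rewrite (S _ (-1)) /w1_word w1_word_perm //; [|lia..].
by repeat (case: ifP => ?); lia.
Qed.

Lemma kappa_word_letters d : (0 < d)%N -> (d <= n - d)%N ->
  all (gtn n) (w1_word n d ++ w2_word n d).
Proof.
move=> d0 dn; rewrite all_cat; apply/andP; split; apply/allP => i /flatten_mapP[k].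
  by rewrite mem_iota mem_rev mem_iota /=; lia.
by rewrite mem_rev mem_iota /v_word mem_cat !mem_iota /=; lia.
Qed.


End AffinePermutations.

(** * Monomial matrices and the length function *)

Section MonomialMatrices.
Import Order.TTheory GRing.Theory Num.Theory.
Local Open Scope classical_set_scope.
Local Open Scope ring_scope.
Variables (K : fieldType) (n : nat).
Hypothesis n1 : (1 < n)%N.
Notation F := (laurent K).
Implicit Types (x y : int) (g h : SL n F) (f : int -> int) (i j : 'I_n).

(* The vector t^a e_i has index i - a n, so that the Iwahori subgroup acts by
   triangular matrices with respect to increasing indices. *)
Definition basis_vec x : 'cV[F]_n :=
  \col_i if congr_n n i%:Z x then lmonomial 1 ((i%:Z - x) %/ n%:Z)%Z else 0.

Let n0 : n%:Z != 0. Proof. by lia. Qed.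

Lemma congr_n_ord i j k : congr_n n i%:Z (j%:Z + k * n%:Z) = (i == j).
Proof.
apply/idP/eqP => [/congr_nP[l E]|->].
  apply: val_inj => /=; have := ltn_ord i; have := ltn_ord j => jn iltn.
  have kl : (k + l) * n%:Z = i%:Z - j%:Z by rewrite mulrDl; lia.
  have kl0 : k + l = 0 by nia.
  by move: kl; rewrite kl0; lia.
by apply/congr_nP; exists (- k); lia.
Qed.

Lemma basis_vecE i k : basis_vec (i%:Z + k * n%:Z) = lmonomial 1 (- k) *: delta_mx i 0.
Proof.
apply/colP => j; rewrite !mxE congr_n_ord andbT; case: eqP => [->|_]; last by rewrite mulr0.
by rewrite mulr1 opprD addrA subrr add0r -mulNr mulzK.
Qed.

Lemma basis_vec_ord i : basis_vec i%:Z = delta_mx i 0.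
Proof. by have := basis_vecE i 0; rewrite mul0r addr0 oppr0 scale1r. Qed.

Lemma int_ordP x : exists i k, x = i%:Z + k * n%:Z.
Proof.
have x0 := modz_ge0 x n0.
have xn : (absz (x %% n%:Z)%Z < n)%N by rewrite -ltz_nat gez0_abs // ltz_pmod; lia.
exists (Ordinal xn), (x %/ n%:Z)%Z.
by rewrite [nat_of_ord _]/= gez0_abs // addrC -divz_eq.
Qed.

Lemma basis_vecD x k : basis_vec (x + k * n%:Z) = lmonomial 1 (- k) *: basis_vec x.
Proof.
have [i [l ->]] := int_ordP x; rewrite -addrA -mulrDl !basis_vecE scalerA.
by rewrite lmonomialM mulr1 opprD addrC.
Qed.

Lemma basis_vec_inj c c' x y : c != 0 ->
  lconst c *: basis_vec x = lconst c' *: basis_vec y :> 'cV[F]_n -> x = y.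
Proof.
move=> c0; have [i [k ->]] := int_ordP x; have [j [l ->]] := int_ordP y.
rewrite !basis_vecE => /colP/(_ i); rewrite !mxE !eqxx !andbT !mulr1 !lmonomialM !add0r !mulr1.
case: eqP => [<-|_]; last first.
  by rewrite !mulr0 => /eqP; rewrite lmonomial_eq0 (negPf c0).
rewrite mulr1 lmonomialM mulr1 add0r => /(congr1 (fun u : F => u (- k))) /=.
rewrite eqxx; case: eqP => [|_]; first by lia.
by move=> E; rewrite E eqxx in c0.
Qed.

(** Constants are ignored, so f depends only on g modulo the constant torus, that is on its class in
    the affine Weyl group. *)
Definition permutes g f := affine_perm n f /\
  forall x, exists2 c, c != 0 & slmx g *m basis_vec x = lconst c *: basis_vec (f x).

Lemma permutes_eq g f f' : f =1 f' -> permutes g f -> permutes g f'.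
Proof. by move=> /funext ->. Qed.

Lemma permutes_fun g f f' : permutes g f -> permutes g f' -> f = f'.
Proof.
move=> [_ H] [_ H']; apply/funext => x; have [c c0 E] := H x.
by have [c' _ E'] := H' x; apply: (@basis_vec_inj c c') => //; rewrite -E E'.
Qed.

Lemma permutes1 : permutes 1%g id.
Proof.
split; first exact: affine_perm_id.
by move=> x; exists 1; rewrite ?oner_eq0 // slmx1 mul1mx scale1r.
Qed.

Lemma permutesM g h f f' : permutes g f -> permutes h f' -> permutes (g * h)%g (f \o f').
Proof.
move=> [Af Hg] [Af' Hh]; split; first exact: affine_perm_comp.
move=> x; have [c c0 E] := Hh x; have [c' c'0 E'] := Hg (f' x).
exists (c * c'); first exact: mulf_neq0.
by rewrite slmxM -mulmxA E -scalemxAr E' scalerA -rmorphM.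
Qed.

Lemma permutesV g f f' : permutes g f -> cancel f f' -> cancel f' f -> permutes g^-1%g f'.
Proof.
move=> [Af Hg] ff' f'f; split; first exact: affine_perm_inv ff' f'f.
move=> x; have [c c0 E] := Hg (f' x); exists c^-1; first by rewrite invr_eq0.
move: E; rewrite f'f => /(congr1 (mulmx (slmx g^-1%g))).
rewrite mulmxA -slmxM mulVg slmx1 mul1mx -scalemxAr => /(congr1 ( *:%R (lconst c^-1))).
by rewrite [in X in _ = X]scalerA -rmorphM mulVf // rmorph1 scale1r.
Qed.

Lemma permutesVe g f : permutes g f ->
  exists f', [/\ cancel f f', cancel f' f & permutes g^-1%g f'].
Proof.
move=> gf; case: (gf) => -[[f' ff' f'f] _] _; exists f'; split=> //.
exact: permutesV gf ff' f'f.
Qed.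

Lemma permutes_col g f : affine_perm n f ->
  (forall j, exists2 c, c != 0 & col j g = lconst c *: basis_vec (f j%:Z)) ->
  permutes g f.
Proof.
move=> Af H; split=> // x; have [j [k ->]] := int_ordP x.
have [c c0 E] := H j; exists c => //.
rewrite basis_vecE -scalemxAr -colE E affine_permMn // basis_vecD.
by rewrite !scalerA mulrC.
Qed.

Lemma permutes_colE g f j : permutes g f ->
  exists2 c, c != 0 & forall i, g i j = lconst c * basis_vec (f j%:Z) i 0.
Proof.
move=> [_ /(_ j%:Z)[c c0]]; rewrite basis_vec_ord -colE => E; exists c => // i.
by have /colP/(_ i) := E; rewrite !mxE.
Qed.

Lemma permutes_const_torus g : const_torus g <-> permutes g id.
Proof.
split=> [[x Tx <-]|gid].
  apply: permutes_col; first exact: affine_perm_id.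
  move=> j; exists (x j j).
    have : \det x != 0 by rewrite det_SL oner_eq0.
    rewrite det_trig; first by move=> /prodf_neq0; apply.
    by apply/is_trig_mxP => i k ik; apply: Tx; rewrite -val_eqE ltn_eqF.
  rewrite basis_vec_ord; apply/colP => i; rewrite !mxE andbT.
  have [->|ij] := eqVneq i j; first by rewrite mulr1.
  by rewrite mulr0 Tx // rmorph0.
have gE i j : g i j = lconst (if i == j then g i j 0 else 0).
  have [c c0 ->] := permutes_colE j gid.
  rewrite basis_vec_ord mxE andbT; case: eqP => _; last by rewrite mulr0 rmorph0.
  by rewrite mulr1 coef_lconst0.
have w0 : weighted (fun=> 0) (fun=> 0) g.
  by move=> i j; rewrite subrr gE; apply: val_ge_lconst.
have d1 : \det (lead_mx (fun=> 0) (fun=> 0) g) == 1.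
  by rewrite det_lead_mx // det_SL subrr.
exists (MkSL d1).
  by move=> i j ij; rewrite /= mxE gE (negPf ij) subrr coef_lconst0.
apply: val_inj; apply/matrixP => i j; rewrite /= !mxE subrr gE.
by case: eqP => _; rewrite coef_lconst0.
Qed.

Lemma weyl_eqP g h f : permutes g f -> (weyl_eq g h <-> permutes h f).
Proof.
move=> gf; have [f' [ff' f'f gV]] := permutesVe gf; split=> [/permutes_const_torus H|hf].
  by have := permutesM gf H; rewrite mulVKg.
apply/permutes_const_torus; apply: permutes_eq (permutesM gV hf).
exact: ff'.
Qed.

Lemma permutes_normalizer g f : permutes g f -> affine_normalizer g.
Proof.
move=> gf; have [f' [ff' f'f gV]] := permutesVe gf; split.
  move=> i j; have [c c0 ->] := permutes_colE j gf; rewrite mxE.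
  case: ifP => _; last by exists 0 => k _; rewrite mulr0 /= if_same.
  exists ((i%:Z - f j%:Z) %/ n%:Z)%Z => k kl.
  by rewrite lcoef_constM /= gt_eqF // mulr0.
have conj u v v' : permutes u v -> cancel v v' -> cancel v' v ->
    forall z : SL n F, const_torus z -> const_torus (z ^ u)%g.
  move=> uv vv' v'v z /permutes_const_torus Ty; apply/permutes_const_torus.
  have := permutesM (permutesV uv vv' v'v) (permutesM Ty uv).
  by apply: permutes_eq => y /=; rewrite vv'.
by move=> z Tz; split; [apply: conj gf ff' f'f z Tz|apply: conj gV f'f ff' z Tz].
Qed.

Lemma swap_mx_col (p q : 'I_n) (a b : F) j : p != q ->
  col j (swap_mx n p q a b) = if j == p then b *: delta_mx q 0 else
                              if j == q then a *: delta_mx p 0 else delta_mx j 0.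
Proof.
move=> pq; apply/colP => i; rewrite !mxE !val_eqE.
have [->|jp] := eqVneq j p.
  rewrite (negPf pq) andbF andbT !mxE andbT.
  have [_|_] := eqVneq i q; first by rewrite mulr1.
  by rewrite mulr0 andbT andbN.
have [->|jq] := eqVneq j q.
  rewrite andbT andbF !mxE andbT.
  have [_|_] := eqVneq i p; first by rewrite mulr1.
  by rewrite mulr0 andbT andbN.
rewrite !andbF !mxE andbT; have [->|//] := eqVneq i j.
by rewrite jp jq.
Qed.

Lemma simple_refl_permutes k : (k < n)%N ->
  permutes (simple_refl K n k) (adj_transp n k%:Z).
Proof.
move=> kn; apply: permutes_col; first exact: adj_transp_perm.
have n0' : (0 < n)%N by lia.
move=> j; rewrite simple_reflE // /adj_transp /affine_transp.
rewrite (_ : k%:Z - (k%:Z - 1) = 1); last by ring.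
case: k kn => [|k] kn.
  have nn : (n.-1 < n)%N by lia.
  pose p := Ordinal n0'; pose q := Ordinal nn.
  have pq : p != q by rewrite -val_eqE /=; lia.
  have -> : congr_n n j%:Z (0%:Z - 1) = (j == q).
    by rewrite -(congr_n_ord j q (-1)); congr congr_n; rewrite /=; lia.
  have -> : congr_n n j%:Z 0%:Z = (j == p).
    by rewrite -(congr_n_ord j p 0); congr congr_n; rewrite /=; lia.
  rewrite [simple_mx _ _ _]/(swap_mx n p q (lvarV K) (- lvar K)) swap_mx_col //.
  have [->|jp] := eqVneq j p.
    exists (-1); first by rewrite oppr_eq0 oner_eq0.
    rewrite (negPf pq) (_ : p%:Z - 1 = q%:Z + (-1) * n%:Z); last by rewrite /=; lia.
    by rewrite basis_vecE opprK scalerA rmorphN rmorph1 mulN1r.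
  have [->|jq] := eqVneq j q; last first.
    by exists 1; rewrite ?oner_eq0 // rmorph1 scale1r basis_vec_ord.
  exists 1; rewrite ?oner_eq0 // rmorph1 scale1r.
  rewrite (_ : q%:Z + 1 = p%:Z + 1 * n%:Z); last by rewrite /=; lia.
  by rewrite basis_vecE.
have kn' : (k < n)%N by lia.
pose p := Ordinal kn'; pose q := Ordinal kn.
have pq : p != q by rewrite -val_eqE /=; lia.
have -> : congr_n n j%:Z (k.+1%:Z - 1) = (j == p).
  by rewrite -(congr_n_ord j p 0); congr congr_n; rewrite /=; lia.
have -> : congr_n n j%:Z k.+1%:Z = (j == q).
  by rewrite -(congr_n_ord j q 0); congr congr_n; rewrite /=; lia.
rewrite [simple_mx _ _ _]/(swap_mx n p q 1 (-1)) swap_mx_col //.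
have [->|jp] := eqVneq j p.
  exists (-1); first by rewrite oppr_eq0 oner_eq0.
  rewrite (_ : p%:Z + 1 = q%:Z); last by rewrite /=; lia.
  by rewrite basis_vec_ord rmorphN rmorph1.
have [->|jq] := eqVneq j q; last first.
  by exists 1; rewrite ?oner_eq0 // rmorph1 scale1r basis_vec_ord.
exists 1; rewrite ?oner_eq0 // rmorph1.
rewrite (_ : q%:Z - 1 = p%:Z); last by rewrite /=; lia.
by rewrite basis_vec_ord.
Qed.

Lemma word_prod_permutes w : all (gtn n) w -> permutes (word_prod K n w) (word_perm n w).
Proof.
elim: w => [_|k w IH] /=; first by rewrite /word_prod big_nil; apply: permutes1.
case/andP=> kn /IH H; rewrite /word_prod big_cons.
exact: permutesM (simple_refl_permutes kn) H.
Qed.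

Lemma expressibleP g f k : permutes g f -> expressible g k <->
  exists w, [/\ size w = k, all (gtn n) w & word_perm n w =1 f].
Proof.
move=> gf; split=> -[w [wk wn H]]; exists w; split=> //.
  by move: H => /(weyl_eqP _ (word_prod_permutes wn)) H; rewrite (permutes_fun H gf).
apply/(weyl_eqP _ (word_prod_permutes wn)).
by apply: permutes_eq gf => x; rewrite H.
Qed.

Lemma weyl_length_eq g h f : permutes g f -> permutes h f -> weyl_length g = weyl_length h.
Proof.
move=> gf hf; rewrite /weyl_length; congr xget; apply/funext => k; apply/propext.
have E (l : nat) : expressible g l <-> expressible h l.
  by rewrite (expressibleP _ gf) (expressibleP _ hf).
split=> -[gk H]; split=> [|l gl].
- exact/(E k).
- exact/H/(E l).
- exact/(E k).
- exact/H/(E l).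
Qed.

(** One word for g rules out the default value of [weyl_length] and makes it a minimum that is
    attained. *)
Lemma weyl_lengthP g k : expressible g k ->
  expressible g (weyl_length g) /\ (weyl_length g <= k)%N.
Proof.
move=> gk; have ex : exists l : nat, `[< expressible g l >] by exists k; apply/asboolP.
have [m /asboolP gm mmin] := ex_minnP ex.
rewrite /weyl_length; case: xgetP => [j _ [gj jmin]|/(_ m)[]]; first by split=> //; apply: jmin.
by split=> // j gj; apply: mmin; apply/asboolP.
Qed.

Lemma weyl_length_lt g r f p q k : permutes g f -> expressible g k ->
  ~~ congr_n n p q -> p < q -> f q < f p -> permutes r (affine_transp n p q) ->
  (weyl_length (g * r)%g < weyl_length g)%N.
Proof.
move=> gf gk pq plq flip rpq; have [] := weyl_lengthP gk.
move=> /(expressibleP _ gf)[w [<- wn wf]] _.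
have [||||w' [-> w'n w'E]] := @exchange n n1 w p q; rewrite ?wf //.
apply: (weyl_lengthP (k := size w') _).2.
apply/(expressibleP _ (permutesM gf rpq)); exists w'; split=> // x.
by rewrite w'E /= wf.
Qed.

Lemma reflection_permutes p q : ~~ congr_n n p q -> p < q ->
  exists2 r : SL n F, reflection r & permutes r (affine_transp n p q).
Proof.
move=> pq plq; have [w [i [wn iltn E]]] := affine_transp_word n1 pq plq.
exists (simple_refl K n i ^ (word_prod K n w)^-1)%g.
  exists i, (word_prod K n w)^-1%g; split=> //.
  have [f' [_ _ H]] := permutesVe (word_prod_permutes wn).
  exact: permutes_normalizer H.
have H := permutesM (word_prod_permutes wn) (simple_refl_permutes iltn).
have wrev : cancel (word_perm n w) (word_perm n (rev w)) by move=> x; apply: word_perm_rev.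
have wrev' : cancel (word_perm n (rev w)) (word_perm n w).
  by move=> x; have := word_perm_rev n1 (rev w) x; rewrite revK.
have := permutesM H (permutesV (word_prod_permutes wn) wrev wrev').
rewrite conjgE invgK mulgA; apply: permutes_eq => x.
by rewrite E word_perm_cat.
Qed.

(** Monomiality of the normalizer enters as an assumption over a general field; it is supplied later
    in characteristic zero. *)
Lemma reflection_permutesP (r : SL n F) :
  (forall u : SL n F, affine_normalizer u -> exists f, permutes u f) -> reflection r ->
  exists p q, [/\ ~~ congr_n n p q, p < q & permutes r (affine_transp n p q)].
Proof.
move=> norm [i [x [iltn /norm[f xf] ->]]].
have [f' [ff' f'f xV]] := permutesVe xf.
have Af' : affine_perm n f' by case: xV.
have ii := adj_not_congr n1 i%:Z.
pose p := f' (i%:Z - 1); pose q := f' i%:Z.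
have pq : ~~ congr_n n p q by rewrite affine_perm_congr.
have rpq : permutes (simple_refl K n i ^ x)%g (affine_transp n p q).
  have := permutesM xV (permutesM (simple_refl_permutes iltn) xf).
  rewrite conjgE; apply: permutes_eq => y /=.
  by rewrite /adj_transp affine_transp_conj // ff'.
have [plq|] := ltP p q; first by exists p, q.
rewrite le_eqVlt => /orP[/eqP E|qp]; first by rewrite E congr_nxx in pq.
exists q, p; split=> //; first by rewrite congr_n_sym.
by apply: permutes_eq rpq; apply: affine_transpC.
Qed.

End MonomialMatrices.

(** * Bruhat decomposition of SL_n(K((t))) *)

Section BruhatDecomposition.
Import Order.TTheory GRing.Theory Num.Theory.
Local Open Scope classical_set_scope.
Local Open Scope ring_scope.
Variables (K : fieldType) (n : nat).
Hypothesis n1 : (1 < n)%N.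
Notation F := (laurent K).
Implicit Types (g b q : SL n F) (i j : 'I_n).

Lemma monomial_permutes g :
  (forall j, exists i c k, c != 0 /\ col j g = lmonomial c k *: delta_mx i 0) ->
  exists f, permutes g f.
Proof.
move=> /choice[s /choice[c /choice[a H]]].
have /choice[r /choice[q rq]] := int_ordP n1.
have rqE i k : r (i%:Z + k * n%:Z) = i /\ q (i%:Z + k * n%:Z) = k.
  have := rq (i%:Z + k * n%:Z); move: (r _) (q _) => i' k' E.
  have ii : i = i'.
    by apply/eqP; rewrite -(congr_n_ord n1 i i' (k' - k)) mulrBl addrA -E addrK congr_nxx.
  split=> //; have n0 : n%:Z != 0 by lia.
  by apply: (mulIf n0); move: E; rewrite ii => /addrI.
(* Two columns supported on the same row would be proportional. *)
have s_inj : injective s.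
  move=> j j' E; apply/eqP; apply: contraT => jj'.
  have [cj Hj] := H j; have [cj' Hj'] := H j'.
  have : lmonomial (c j') (a j') *: col j g = lmonomial (c j) (a j) *: col j' g.
    by rewrite Hj Hj' !scalerA E mulrC.
  rewrite !colE !scalemxAr => /(congr1 (mulmx (slmx g^-1%g))).
  rewrite !mulmxA -slmxM mulVg slmx1 !mul1mx => /colP/(_ j).
  rewrite !mxE eqxx (negPf jj') /= mulr1 mulr0 => /eqP.
  by rewrite lmonomial_eq0 (negPf cj').
have [s' ss' s's] := injF_bij s_inj.
pose f x := (s (r x))%:Z + (q x - a (r x)) * n%:Z.
pose f' x := (s' (r x))%:Z + (q x + a (s' (r x))) * n%:Z.
have fE i k : f (i%:Z + k * n%:Z) = (s i)%:Z + (k - a i) * n%:Z.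
  by rewrite /f !(rqE i k).1 !(rqE i k).2.
have f'E i k : f' (i%:Z + k * n%:Z) = (s' i)%:Z + (k + a (s' i)) * n%:Z.
  by rewrite /f' !(rqE i k).1 !(rqE i k).2.
exists f; apply: permutes_col => //.
  split; last first.
    move=> x; have [i [k ->]] := int_ordP n1 x.
    rewrite (_ : _ + n%:Z = i%:Z + (k + 1) * n%:Z); last by ring.
    by rewrite !fE; ring.
  exists f' => x; have [i [k ->]] := int_ordP n1 x.
    by rewrite fE f'E ss' subrK.
  by rewrite f'E fE s's addrK.
move=> j; have [cj Hj] := H j; exists (c j) => //.
have := fE j 0; rewrite mul0r addr0 => ->.
by rewrite basis_vecE // Hj scalerA sub0r opprK lmonomialM mulr1 add0r.
Qed.

Lemma iwahori_entries g :
  (forall i j, val_ge (j < i)%N%:R (g i j)) -> iwahori g.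
Proof.
move=> H; apply/iwahoriP => d; apply/two_stepP.
by split=> i j; apply: val_geW (H i j); rewrite /eps; lia.
Qed.

Lemma det_add_col (x : 'cV[F]_n) i : x i 0 = 0 -> \det (1%:M + x *m delta_mx 0 i) = 1.
Proof.
move=> xi; have E k l : (1%:M + x *m delta_mx 0 i) k l = (k == l)%:R + x k 0 * (l == i)%:R.
  by rewrite !mxE big_ord1 mxE eqxx /=.
rewrite (expand_det_row _ i) (bigD1 i) //= big1 => [|l /negPf li]; last first.
  by rewrite E xi mul0r addr0 eq_sym li mul0r.
rewrite E xi mul0r addr0 eqxx addr0 /cofactor -signr_odd addnn odd_double !mul1r.
rewrite (_ : row' i _ = 1%:M) ?det1 //; apply/matrixP => k l.
rewrite [LHS]mxE [LHS]mxE E mxE (inj_eq lift_inj) [lift i l == i]eq_sym.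
by rewrite (negPf (neq_lift i l)) mulr0 addr0.
Qed.

Lemma elementary_col (x : 'cV[F]_n) i : x i 0 = 0 ->
  (forall k : 'I_n, val_ge (i < k)%N%:R (x k 0)) ->
  exists2 b, iwahori b & slmx b = 1%:M + x *m delta_mx 0 i.
Proof.
move=> xi xk; have d1 : \det (1%:M + x *m delta_mx 0 i) == 1 by rewrite det_add_col.
exists (MkSL d1) => //; apply: iwahori_entries => k l.
rewrite [slmx _]/= !mxE big_ord1 mxE eqxx /=; apply: val_geD.
  by case: eqP => [->|_]; [rewrite ltnn; apply: val_ge_lmonomial|apply: val_ge0].
by case: eqP => [->|_]; [rewrite mulr1; apply: xk|rewrite mulr0; apply: val_ge0].
Qed.

Lemma elementary_row (y : 'rV[F]_n) j : y 0 j = 0 ->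
  (forall k : 'I_n, val_ge (k < j)%N%:R (y 0 k)) ->
  exists2 q, iwahori q & slmx q = 1%:M + delta_mx j 0 *m y.
Proof.
move=> yj yk; have d1 : \det (1%:M + delta_mx j 0 *m y) == 1.
  rewrite -det_tr linearD /= trmx1 trmx_mul trmx_delta.
  by rewrite det_add_col // mxE.
exists (MkSL d1) => //; apply: iwahori_entries => k l.
rewrite [slmx _]/= !mxE big_ord1 mxE eqxx andbT; apply: val_geD.
  by case: eqP => [->|_]; [rewrite ltnn; apply: val_ge_lmonomial|apply: val_ge0].
by case: eqP => [->|_]; [rewrite mul1r; apply: yk|rewrite mul0r; apply: val_ge0].
Qed.

Definition pivot (g : 'M[F]_n) (ij : 'I_n * 'I_n) :=
  [&& g ij.1 ij.2 != 0, [forall i, (i != ij.1) ==> (g i ij.2 == 0)] &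
      [forall j, (j != ij.2) ==> (g ij.1 j == 0)]].

Lemma pivotP (g : 'M[F]_n) i j : reflect
  [/\ g i j != 0, forall i', i' != i -> g i' j = 0 & forall j', j' != j -> g i j' = 0]
  (pivot g (i, j)).
Proof.
apply: (iffP and3P) => /= -[gij Hi Hj]; split=> //.
- by move=> i' ii'; move/forallP/(_ i')/implyP: Hi => /(_ ii')/eqP.
- by move=> j' jj'; move/forallP/(_ j')/implyP: Hj => /(_ jj')/eqP.
- by apply/forallP => i'; apply/implyP => /Hi ->.
by apply/forallP => j'; apply/implyP => /Hj ->.
Qed.

Lemma mul_ge_signs (a x y : int) : 0 < y -> - y < x -> x <= a * y -> 0 <= a /\ (0 < x -> 0 < a).
Proof. by move=> y0 yx xay; split=> [|x0]; nia. Qed.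

(** In the column of the pivot, valuations are no smaller, and strictly larger below it, as an
    Iwahori row operation requires. *)
Lemma pivot_key_col (i j k : nat) (a b : int) : (i < n)%N -> (k < n)%N ->
  a * (n * n)%N%:Z + (j%:Z * n%:Z - i%:Z) <= b * (n * n)%N%:Z + (j%:Z * n%:Z - k%:Z) ->
  (i < k)%N%:R <= b - a.
Proof.
move=> iltn kn H.
have nn : n%:Z <= (n * n)%N%:Z by rewrite lez_nat leq_pmulr //; lia.
have ki : k%:Z - i%:Z <= (b - a) * (n * n)%N%:Z.
  by move: H; rewrite mulrBl; move: (_ * _) (_ * _) (_ * _) => x y z; lia.
move: nn ki; move: (n * n)%N%:Z => N nn ki.
have N0 : 0 < N by lia.
have Nki : - N < k%:Z - i%:Z by lia.
have [D0 D1] := mul_ge_signs N0 Nki ki.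
by case: ltnP => ik; lia.
Qed.

(** In the row of the pivot, the increase is strict to its left. *)
Lemma pivot_key_row (i j k : nat) (a b : int) : (j < n)%N -> (k < n)%N ->
  a * (n * n)%N%:Z + (j%:Z * n%:Z - i%:Z) <= b * (n * n)%N%:Z + (k%:Z * n%:Z - i%:Z) ->
  (k < j)%N%:R <= b - a.
Proof.
move=> jn kn H; have np : 0 < n%:Z by lia.
have jk : (j%:Z - k%:Z) * n%:Z <= (b - a) * (n * n)%N%:Z.
  by move: H; rewrite !mulrBl; move: (_ * _) (_ * _) (_ * _) (_ * _) => x y z w; lia.
have nn : - (n * n)%N%:Z < (j%:Z - k%:Z) * n%:Z.
  by rewrite PoszM -mulNr ltr_pM2r //; lia.
have N0 : 0 < (n * n)%N%:Z by rewrite PoszM mulr_gt0.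
have [D0 D1] := mul_ge_signs N0 nn jk.
case: ltnP => kj //.
suff : 0 < b - a by lia.
by apply: D1; rewrite mulr_gt0 //; lia.
Qed.

(* Among the entries that are not yet pivots, the pivot has minimal valuation and is
   then leftmost, and then lowest: this makes the row and column operations that
   clear its row and its column belong to the Iwahori subgroup. *)
Lemma pivot_step g ij0 : g ij0.1 ij0.2 != 0 -> ~~ pivot g ij0 ->
  exists b q, [/\ iwahori b, iwahori q &
    (#|[pred ij | ~~ pivot (b * g * q)%g ij]| < #|[pred ij | ~~ pivot g ij]|)%N].
Proof.
move=> g0 np0.
have /choice[v vP] : forall ij : 'I_n * 'I_n, exists k : int,
    g ij.1 ij.2 != 0 -> val_ge k (g ij.1 ij.2) /\ g ij.1 ij.2 k != 0.
  move=> ij; have [->|/laurent_valP[k vk gk]] := eqVneq (g ij.1 ij.2) 0.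
    by exists 0; rewrite eqxx.
  by exists k.
(* The lexicographic order as one integer: two values of j n - i differ by less than n^2. *)
pose key (ij : 'I_n * 'I_n) : int := v ij * (n * n)%N%:Z + (ij.2%:Z * n%:Z - ij.1%:Z).
pose N := [pred ij | (g ij.1 ij.2 != 0) && ~~ pivot g ij].
have N0 : N ij0 by rewrite /= g0.
have [[i j] /andP[/= gij npij] minij] := arg_minP key N0.
have [/= vij gv] := vP (i, j) gij.
have [h hv gh] := laurent_inv vij gv.
have notpiv i' j' : pivot g (i', j') -> i' != i /\ j' != j.
  move=> p; case/pivotP: (p) => _ Hi Hj; split; apply: contraNneq npij => E.
    have [jj|jj] := eqVneq j j'; first by rewrite -E jj.
    by move: gij; rewrite -E Hj ?eqxx.
  have [ii|ii] := eqVneq i i'; first by rewrite -E ii.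
  by move: gij; rewrite -E Hi ?eqxx.
pose x : 'cV[F]_n := \col_k (if k == i then 0 else - (g k j * h)).
pose y : 'rV[F]_n := \row_k (if k == j then 0 else - (h * g i k)).
have in_N i' j' : (i' = i \/ j' = j) -> g i' j' != 0 -> (i', j') \in N.
  move=> H gi'; rewrite inE /= gi' /=; apply/negP => /notpiv[ii jj].
  by case: H => E; [rewrite E eqxx in ii|rewrite E eqxx in jj].
have keyle i' j' : (i' = i \/ j' = j) -> g i' j' != 0 ->
    val_ge (v (i', j')) (g i' j') /\ key (i, j) <= key (i', j').
  by move=> H gi'; split; [case: (vP (i', j') gi')|apply: minij; apply: in_N].
have xk (k : 'I_n) : val_ge (i < k)%N%:R (x k 0).
  rewrite mxE; case: eqP => [_|/eqP ki]; first exact: val_ge0.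
  apply: val_geN; have [->|gk] := eqVneq (g k j) 0.
    by rewrite mul0r; apply: val_ge0.
  have [vk] := keyle k j (or_intror erefl) gk.
  rewrite /key /= => kk; apply: val_geW (val_geM vk hv).
  exact: pivot_key_col (ltn_ord i) (ltn_ord k) kk.
have yk (k : 'I_n) : val_ge (k < j)%N%:R (y 0 k).
  rewrite mxE; case: eqP => [_|/eqP kj]; first exact: val_ge0.
  apply: val_geN; have [->|gk] := eqVneq (g i k) 0.
    by rewrite mulr0; apply: val_ge0.
  have [vk] := keyle i k (or_introl erefl) gk.
  rewrite /key /= => kk; rewrite mulrC; apply: val_geW (val_geM vk hv).
  exact: pivot_key_row (ltn_ord j) (ltn_ord k) kk.
have xi : x i 0 = 0 by rewrite mxE eqxx.
have yj : y 0 j = 0 by rewrite mxE eqxx.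
have [b Ib bE] := elementary_col xi xk; have [q Iq qE] := elementary_row yj yk.
have hg : h * g i j = 1 by rewrite mulrC.
have bgE (k l : 'I_n) : (b *m g) k l = g k l + x k 0 * g i l.
  rewrite bE mulmxDl mul1mx -mulmxA -rowE [LHS]mxE; congr (_ + _).
  by rewrite mxE big_ord1 [row _ _ _ _]mxE.
have bgqE (k l : 'I_n) : (b *m g *m q) k l = (b *m g) k l + (b *m g) k j * y 0 l.
  rewrite qE mulmxDr mulmx1 mulmxA -colE [LHS]mxE; congr (_ + _).
  by rewrite mxE big_ord1 [col _ _ _ _]mxE.
have bgj (k : 'I_n) : (b *m g) k j = if k == i then g i j else 0.
  rewrite bgE mxE; case: eqP => [->|_]; first by rewrite mul0r addr0.
  by rewrite mulNr -mulrA hg mulr1 subrr.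
have gE (k l : 'I_n) : (b * g * q)%g k l =
    if k == i then (if l == j then g i j else 0) else
    if l == j then 0 else g k l + x k 0 * g i l.
  rewrite !slmxM bgqE bgj.
  have [->|ki] := eqVneq k i.
    rewrite bgE xi mul0r addr0; have [->|lj] := eqVneq l j; first by rewrite yj mulr0 addr0.
    by rewrite mxE (negPf lj) mulrN mulrA gh mul1r subrr.
  rewrite mul0r addr0; have [->|lj] := eqVneq l j; last by rewrite bgE.
  by rewrite bgj (negPf ki).
(* Existing pivots lie outside the row and the column of the new one, so the operations preserve
   them. *)
exists b, q; split=> //; apply: proper_card; apply/properP; split.
  apply/fintype.subsetP => -[k l]; rewrite !inE; apply: contra => p.
  have [ki lj] := notpiv _ _ p; case/pivotP: p => gkl Hk Hl.
  apply/pivotP; split=> [|i' ik|j' jl]; rewrite gE.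
  - by rewrite (negPf ki) (negPf lj) (Hk i) ?mulr0 ?addr0 // eq_sym.
  - rewrite (negPf lj); case: eqP => // _.
    by rewrite (Hk i') // (Hk i) ?mulr0 ?addr0 // eq_sym.
  rewrite (negPf ki); case: eqP => // /eqP jj'.
  by rewrite (Hl j') // mxE (negPf ki) (Hl j) ?mul0r ?oppr0 ?mul0r ?addr0 // eq_sym.
exists (i, j); rewrite !inE ?npij // negbK; apply/pivotP; split=> [|i' ii|j' jj].
- by rewrite gE !eqxx.
- by rewrite gE (negPf ii) eqxx.
by rewrite gE eqxx (negPf jj).
Qed.

Lemma SL_col_neq0 g j : exists i, g i j != 0.
Proof.
apply/existsP; apply: contraT; rewrite negb_exists => /forallP H.
have : \det g = 0.
  rewrite (expand_det_col _ j) big1 // => i _.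
  by have /negPn/eqP -> := H i; rewrite mul0r.
by rewrite det_SL => /eqP; rewrite oner_eq0.
Qed.

Lemma bruhat_decomposition g : exists b tau q f,
  [/\ iwahori b, iwahori q, permutes tau f & g = (b * tau * q)%g].
Proof.
have [m] : exists m : nat, (#|[pred ij | ~~ pivot g ij]| < m)%N.
  by exists (#|[pred ij | ~~ pivot g ij]|).+1.
elim: m g => [|m IH] g gm; first by lia.
have [ij0 /andP[g0 np]|allp] := pickP (fun ij => (g ij.1 ij.2 != 0) && ~~ pivot g ij).
  have [b [q [Ib Iq lt]]] := pivot_step g0 np.
  have [|b' [tau [q' [f [Ib' Iq' tf E]]]]] := IH (b * g * q)%g; first by lia.
  exists (b^-1 * b')%g, tau, (q' * q^-1)%g, f; split=> //.
  - by move/iwahoriP: Ib Ib' => Ib /iwahoriP Ib'; apply/iwahoriP => d;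
      apply: two_stepM => //; apply: two_stepV.
  - by move/iwahoriP: Iq Iq' => Iq /iwahoriP Iq'; apply/iwahoriP => d;
      apply: two_stepM => //; apply: two_stepV.
  apply: (mulgI b); apply: (mulIg q); rewrite E !mulgA mulgV mul1g.
  by rewrite -[RHS]mulgA mulVg mulg1.
have pivE i j : g i j != 0 -> pivot g (i, j).
  by move=> gij; have := allp (i, j); rewrite /= gij /= => /negbFE.
have /choice[s sP] := SL_col_neq0 g.
have s_inj : injective s.
  move=> j j' E; apply/eqP; apply: contraT => jj'.
  have /pivotP[_ _ H] := pivE _ _ (sP j); have := sP j'; rewrite -E H ?eqxx //.
  by rewrite eq_sym.
have gE i j : g i j = if i == s j then g (s j) j else 0.
  have [->//|ij] := eqVneq i (s j).
  by have /pivotP[_ H _] := pivE _ _ (sP j); rewrite H.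
have [s' ss' s's] := injF_bij s_inj.
have /choice[k kP] : forall j, exists k, val_ge k (g (s j) j) /\ g (s j) j k != 0.
  by move=> j; have [k] := laurent_valP (sP j); exists k.
pose c j := g (s j) j (k j).
have c0 j : c j != 0 by case: (kP j).
(* Each entry is a monomial times a power series with constant term 1; the latter goes into b. *)
pose u j := lmonomial (c j)^-1 (- k j) * g (s j) j.
have uE j : g (s j) j = lmonomial (c j) (k j) * u j.
  by rewrite /u mulrA lmonomialM mulfV // subrr mul1r.
have u0 j : val_ge 0 (u j) /\ u j 0 = 1.
  split; last by rewrite coef_lmonomialM sub0r opprK mulVf.
  rewrite -(addNr (k j)); apply: val_geM (kP j).1; exact: val_ge_lmonomial.
have mono_prod (r : seq 'I_n) : exists C l, C != 0 /\
    \prod_(j <- r) lmonomial (c j) (k j) = lmonomial C l.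
  elim: r => [|j r [C [l [C0 E]]]].
    by exists 1, 0; rewrite big_nil oner_eq0.
  by exists (c j * C), (k j + l); rewrite big_cons E lmonomialM mulf_neq0.
pose sigma := ((perm s_inj)^-1)%g.
have gD : slmx g = perm_mx sigma *m diag_mx (\row_j g (s j) j).
  apply/matrixP => i j; rewrite mul_mx_diag !mxE gE.
  have -> : (sigma i == j) = (i == s j).
    by rewrite -(inj_eq (@perm_inj _ (perm s_inj))) /sigma permKV permE.
  by case: eqP; rewrite ?mul1r ?mul0r.
(* This gives b determinant 1. Since det g = 1, a monomial times this product is 1, and the constant
   term 1 of the product forces the monomial to be 1. *)
have U1 : \prod_j u j = 1.
  have [C [l [C0 E]]] := mono_prod (index_enum 'I_n).
  have S0 : \sum_(j <- index_enum 'I_n) (0 : int) = 0 by rewrite big1.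
  have U0 : val_ge 0 (\prod_j u j).
    have := @val_ge_prod K _ (index_enum 'I_n) xpredT u (fun=> 0) (fun j _ => (u0 j).1).
    by rewrite S0.
  have U00 : (\prod_j u j) 0 = 1.
    have := @coef_prod_lead K _ (index_enum 'I_n) u (fun=> 0) (fun j => (u0 j).1).
    by rewrite S0 => ->; rewrite big1 // => j _; case: (u0 j).
  have : 1 = lmonomial ((-1) ^+ odd_perm sigma * C) l * \prod_j u j.
    rewrite -[LHS](det_SL g) gD det_mulmx det_perm det_diag signr_lconst.
    rewrite -(add0r l) -lmonomialM -mulrA; congr (_ * _).
    by rewrite -E -big_split; apply: eq_bigr => j _; rewrite mxE uE.
  move: (\prod_j u j) U0 U00 => U U0 U00 E1.
  have := congr1 (fun f : F => f l) E1.
  rewrite coef1 coef_lmonomialM subrr U00 mulr1.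
  have [l0|_] := eqVneq l 0; last first.
    by move/eqP; rewrite eq_sym mulf_eq0 signr_eq0 (negPf C0).
  by move=> sC; rewrite E1 l0 -sC lmonomial1 mul1r.
have db : \det (diag_mx (\row_i u (s' i))) == 1.
  rewrite det_diag (reindex_inj s_inj) -[X in _ == X]U1; apply/eqP.
  by apply: eq_bigr => j _; rewrite mxE ss'.
have [b bE] : exists b : SL n F, slmx b = diag_mx (\row_i u (s' i)) by exists (MkSL db).
have tE j : col j (b^-1 * g)%g = lmonomial (c j) (k j) *: delta_mx (s j) 0.
  have E : col j g = b *m (lmonomial (c j) (k j) *: delta_mx (s j) 0).
    rewrite bE; apply/colP => i; rewrite mul_diag_mx !mxE gE andbT.
    by case: eqP => [->|_]; rewrite ?mulr0 // ss' mulr1 mulrC uE.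
  rewrite slmxM colE -mulmxA -colE E mulmxA.
  by have -> : b^-1%g *m b = 1%:M; [rewrite -slmxM mulVg|rewrite mul1mx].
have [|f Hf] := @monomial_permutes (b^-1 * g)%g.
  by move=> j; exists (s j), (c j), (k j).
exists b, (b^-1 * g)%g, 1%g, f; split=> //.
- apply: iwahori_entries => i j; rewrite bE !mxE; case: eqP => [<-|_].
    by rewrite ltnn; case: (u0 (s' i)).
  exact: val_ge0.
- by apply/iwahoriP => d; apply: two_step1.
by rewrite mulg1 mulVKg.
Qed.




End BruhatDecomposition.

(** * The elements of the affine normalizer are monomial matrices *)

Section AffineNormalizer.
Import Order.TTheory GRing.Theory Num.Theory.
Local Open Scope classical_set_scope.
Local Open Scope ring_scope.

Section LaurentPolynomials.
Variable K : fieldType.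
Notation F := (laurent K).
Implicit Types (f g : F) (k l : int).

Definition deg_le k f := forall i, k < i -> f i = 0.

Lemma deg_leM k l f g : deg_le k f -> deg_le l g ->
  deg_le (k + l) (f * g) /\ (f * g) (k + l) = f k * g l.
Proof.
move=> fk gl; split=> [i kli|] /=.
  apply: fsbig1 => j _; have [/fk ->|jk] := ltP k j; first by rewrite mul0r.
  by rewrite gl ?mulr0 //; lia.
rewrite -(fsbig_widen [set k]) //; last first.
  move=> j [_ /= jk]; have [/fk ->|kj] := ltP k j; first by rewrite mul0r.
  by rewrite gl ?mulr0 //; move/eqP: jk; lia.
by rewrite fsbig_set1 addrAC subrr add0r.
Qed.

Lemma laurent_polyD f g : laurent_poly f -> laurent_poly g -> laurent_poly (f + g).
Proof.
move=> [k fk] [l gl]; exists (Num.max k l) => i; rewrite gt_max => /andP[ki li].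
by rewrite coefD fk // gl // addr0.
Qed.

Lemma laurent_polyM f g : laurent_poly f -> laurent_poly g -> laurent_poly (f * g).
Proof. by move=> [k fk] [l gl]; exists (k + l); apply: (deg_leM fk gl).1. Qed.

Lemma laurent_poly_const c : laurent_poly (@lconst K c).
Proof. by exists 0 => i i0 /=; rewrite gt_eqF. Qed.

Lemma laurent_poly_det n (M : 'M[F]_n) :
  (forall i j, laurent_poly (M i j)) -> laurent_poly (\det M).
Proof.
move=> HM; rewrite /determinant; elim/big_ind: _ => [||s _].
- by rewrite -(rmorph0 (@lconst K)); apply: laurent_poly_const.
- exact: laurent_polyD.
rewrite signr_lconst; apply: laurent_polyM; first exact: laurent_poly_const.
elim/big_ind: _ => [||i _] //; last exact: laurent_polyM.
by rewrite -(rmorph1 (@lconst K)); apply: laurent_poly_const.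
Qed.

Lemma laurent_poly_inv n (g : SL n F) :
  (forall i j, laurent_poly (g i j)) -> forall i j, laurent_poly (g^-1%g i j).
Proof.
move=> Hg i j; rewrite mxE /cofactor.
have -> : (-1) ^+ (j + i) = lconst ((-1) ^+ (j + i)) :> F.
  by rewrite rmorphXn rmorphN rmorph1.
apply: laurent_polyM; first exact: laurent_poly_const.
by apply: laurent_poly_det => k l; rewrite !mxE.
Qed.

Lemma laurent_degP f : laurent_poly f -> f != 0 -> exists2 k, deg_le k f & f k != 0.
Proof.
move=> [m fm] f0.
have [|k kP kmin] := @ex_minnP (fun j : nat => f (m - j%:Z) != 0).
  apply: contrapT => H; case/eqP: f0; apply: laurentP => i.
  rewrite [RHS]/= if_same; have [/fm //|mi] := ltP m i.
  apply/eqP; apply: contrapT => fi; apply: H.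
  exists `|m - i|%N; rewrite (_ : m - _ = i); first exact/negP.
  by lia.
exists (m - k%:Z) => // i ik; have [/fm //|mi] := ltP m i.
apply/eqP; apply: contrapT => /negP fi.
suff : (k <= `|m - i|)%N by lia.
by apply: kmin; rewrite (_ : m - _ = i) //; lia.
Qed.

(** The lowest exponents of f and g add up to 0, and so do the highest; hence lowest and highest
    agree. *)
Lemma laurent_poly_unit f g : laurent_poly f -> laurent_poly g -> f * g = 1 ->
  exists c k, c != 0 /\ f = lmonomial c k.
Proof.
move=> Pf Pg fg.
have f0 : f != 0 by apply: contra_eq_neq fg => ->; rewrite mul0r eq_sym oner_eq0.
have g0 : g != 0 by apply: contra_eq_neq fg => ->; rewrite mulr0 eq_sym oner_eq0.
have [k fk fk0] := laurent_valP f0; have [l gl gl0] := laurent_valP g0.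
have [k' fk' fk'0] := laurent_degP Pf f0; have [l' gl' gl'0] := laurent_degP Pg g0.
have kl : k + l = 0.
  apply: contraNeq (mulf_neq0 fk0 gl0) => kl.
  by rewrite -coefM_lead // fg coef1 (negPf kl).
have kl' : k' + l' = 0.
  apply: contraNeq (mulf_neq0 fk'0 gl'0) => kl'.
  by rewrite -(deg_leM fk' gl').2 fg coef1 (negPf kl').
have kk : k <= k' by rewrite leNgt; apply: contraNN fk'0 => /fk ->.
have ll : l <= l' by rewrite leNgt; apply: contraNN gl'0 => /gl ->.
have kk' : k = k' by lia.
exists (f k), k; split=> //; apply: laurentP => i /=.
have [->//|ik] := eqVneq i k.
have [ki|ik'] := ltP k i; first by apply: fk'; rewrite -kk'.
by apply: fk; rewrite lt_neqAle ik.
Qed.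

End LaurentPolynomials.

Lemma distinct_torus (K : numFieldType) n : (1 < n)%N ->
  exists x : SL n K, torus x /\ forall i j, x i i = x j j -> i = j.
Proof.
move=> n1; have nn : (n.-1 < n)%N by lia.
(* The exponent i + 1 keeps the entries other than the last at least 2; with i instead, n = 2 would
   give the identity matrix. *)
pose o := Ordinal nn; pose P := (\prod_(i < n | i != o) 2 ^ i.+1)%N.
pose t (i : 'I_n) : K := if i == o then P%:R^-1 else (2 ^ i.+1)%:R.
have P0 : (0 < P)%N by rewrite prodn_gt0 // => i; rewrite expn_gt0.
have PK : (P%:R : K) != 0 by rewrite pnatr_eq0 -lt0n.
have d1 : \det (diag_mx (\row_i t i)) == 1.
  rewrite det_diag (bigD1 o) //= mxE {1}/t eqxx.
  rewrite (eq_bigr (fun i : 'I_n => (2 ^ i.+1)%:R)); last first.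
    by move=> i /negPf io; rewrite mxE /t io.
  by rewrite -natr_prod mulVf.
have neq (i : 'I_n) : (2 ^ i.+1)%:R != P%:R^-1 :> K.
  apply/negP => /eqP/(congr1 ( *%R^~ P%:R)); rewrite mulVf // -natrM => /eqP.
  rewrite -[1]/(1%:R) eqr_nat muln_eq1 => /andP[/eqP E _].
  by have := ltn_expl i.+1 (ltnSn 1); rewrite E; lia.
exists (MkSL d1); split=> [i j ij|i j]; first by rewrite /= !mxE (negPf ij) mulr0n.
rewrite /= !mxE !eqxx !mulr1n /t.
case: eqP => [->|_]; case: eqP => [->|_] //; move=> /eqP.
- by rewrite eq_sym (negPf (neq j)).
- by rewrite (negPf (neq i)).
by rewrite eqr_nat eqn_exp2l // => /eqP[] /val_inj.
Qed.

(** Columns of g are eigenvectors of a torus element with distinct diagonal entries, so each has a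
    single nonzero entry. This entry is a unit of K[t, t^-1] because g^-1 has Laurent polynomial
    entries too. *)
Lemma affine_normalizer_permutes (K : numFieldType) n (g : SL n (laurent K)) :
  (1 < n)%N -> affine_normalizer g -> exists f, permutes g f.
Proof.
move=> n1 [Pg Ng]; have [x [Tx xinj]] := distinct_torus K n1.
have [[z Tz zE] _] : const_torus (constSL x ^ g)%g /\ const_torus (constSL x ^ g^-1)%g.
  by apply: Ng; exists x.
have gz : g *m constSL z = constSL x *m g.
  by rewrite zE -slmxM -slmxM conjgE mulVKg.
have constE (y : SL n K) : torus y -> slmx (constSL y) = diag_mx (\row_i lconst (y i i)).
  move=> Ty; apply/matrixP => i j; rewrite !mxE; case: eqP => [->|/eqP ij] //.
  by rewrite mulr0n Ty // rmorph0.
have row_uniq i j : g i j != 0 -> z j j = x i i.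
  move=> gij; have := congr1 (fun M : 'M_n => M i j) gz.
  rewrite !constE // mul_mx_diag mul_diag_mx !mxE mulrC => /eqP.
  rewrite -subr_eq0 -mulrBl => /eqP/laurent_mulf_eq0[|g0]; last by rewrite g0 eqxx in gij.
  by rewrite -rmorphB => /eqP; rewrite lconst_eq0 subr_eq0 => /eqP.
apply: monomial_permutes => // j; have [i gij] := SL_col_neq0 g j.
have gk k : k != i -> g k j = 0.
  move=> ki; apply/eqP; apply: contraT => gkj; case/eqP: ki; apply: xinj.
  by rewrite -(row_uniq _ _ gij) -(row_uniq _ _ gkj).
have gV : g i j * g^-1%g j i = 1.
  have : (g^-1%g *m g) j j = 1 by rewrite -slmxM mulVg slmx1 mxE eqxx.
  rewrite mxE (bigD1 i) //= big1 ?addr0 => [|k /gk ->]; last by rewrite mulr0.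
  by rewrite mulrC.
have [c [k [c0 E]]] := laurent_poly_unit (Pg i j) (laurent_poly_inv Pg j i) gV.
exists i, c, k; split=> //; apply/colP => l; rewrite !mxE andbT.
have [->|li] := eqVneq l i; first by rewrite mulr1.
by rewrite mulr0 gk.
Qed.

End AffineNormalizer.

(** * The Schubert variety of [kappa] *)

Section SchubertLocus.
Import Order.TTheory GRing.Theory Num.Theory.
Local Open Scope classical_set_scope.
Local Open Scope ring_scope.
Variables (K : numFieldType) (n d : nat).
Hypotheses (n1 : (1 < n)%N) (d0 : (0 < d)%N) (dn : (d <= n - d)%N).
Notation F := (laurent K).
Implicit Types (u v w g h r y : SL n F) (f : int -> int) (i j : 'I_n).

Definition in_window i (x : int) :=
  ((i < d)%N -> - n%:Z <= x < n%:Z) /\ ((d <= i)%N -> 0 <= x < n%:Z + n%:Z).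

Definition window_perm f := forall i, in_window i (f i%:Z).

(** The indices below n, d and 0 span E0, E1 and t E0, so these are the two inclusions defining Z.
    All integers are treated alike, which suits exchanges at arbitrary positions, while
    [window_perm] involves one period. *)
Definition half_line_perm f :=
  forall x, (x < d%:Z -> f x < n%:Z) /\ (f x < 0 -> x < d%:Z).

Lemma mulz_cases (k : int) :
  [\/ k <= -1 /\ k * n%:Z <= - n%:Z, k = 0 /\ k * n%:Z = 0 | 1 <= k /\ n%:Z <= k * n%:Z].
Proof.
have [k0|k0|->] := ltgtP k 0; last by constructor 2; rewrite mul0r.
- by constructor 1; split; nia.
- by constructor 3; split; nia.
Qed.

Lemma in_window_shift i j k :
  in_window i (j%:Z + k * n%:Z) <-> eps d i - 1 <= k <= eps d i.
Proof.
have jn := ltn_ord j; rewrite /in_window /eps.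
have := mulz_cases k; have := mulz_cases (k + 1); have := mulz_cases (k - 1).
rewrite !mulrDl mulN1r mul1r; move: (k * n%:Z) => m k1 k2 k3.
case: ltnP => [id|di] /=; split.
- by move=> [/(_ isT) H _]; case: k2; case: k3; lia.
- by move=> H; split=> // _; case: k2; case: k3; lia.
- by move=> [_ /(_ isT) H]; case: k1; case: k3; lia.
- by move=> H; split=> // _; case: k1; case: k3; lia.
Qed.

Lemma window_permP f : affine_perm n f -> window_perm f <-> half_line_perm f.
Proof.
move=> Af; have fD k x : f (x + k * n%:Z) = f x + k * n%:Z by exact: affine_permMn.
split=> [W x|H i].
  have [i [k ->]] := int_ordP n1 x; rewrite fD; have := ltn_ord i => iltn.
  have [Wi Wi'] := W i; have := mulz_cases k; move: (k * n%:Z) => m km.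
  by have [id|di] := ltnP i d; [have := Wi id|have := Wi' di]; case: km; lia.
have iltn := ltn_ord i.
have H0 := H i%:Z; have := H (i%:Z + 1 * n%:Z); have := H (i%:Z + (-1) * n%:Z).
rewrite !fD => H1 H2; split=> di; lia.
Qed.

Lemma permutes_weighted g f a b : permutes g f ->
  weighted a b g <-> forall i j k, f j%:Z = i%:Z + k * n%:Z -> a i - b j <= - k.
Proof.
move=> gf; split=> [wg i j k E|H i j].
  have [c c0 /(_ i)] := permutes_colE n1 j gf; rewrite E basis_vecE // !mxE !eqxx mulr1.
  move=> gij; have := wg i j; rewrite gij => H; rewrite leNgt; apply/negP => /H /eqP.
  by rewrite lcoef_constM /= eqxx mulr1 (negPf c0).
have [c c0 ->] := permutes_colE n1 j gf; have [i' [k E]] := int_ordP n1 (f j%:Z).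
rewrite E basis_vecE // !mxE andbT; case: eqP => [ii|_]; last first.
  by rewrite !mulr0; apply: val_ge0.
rewrite mulr1 -[a i - b j]add0r; apply: val_geM; first exact: val_ge_lconst.
by apply: val_geW (@val_ge_lmonomial K _ _); apply: H; rewrite E ii.
Qed.

Lemma over_grassmannian_window g f : permutes g f ->
  over_grassmannian d g <-> window_perm f.
Proof.
move=> gf; have [f' [ff' f'f gV]] := permutesVe gf.
have Af : affine_perm n f by case: gf.
rewrite /over_grassmannian (permutes_weighted _ _ gf) (permutes_weighted _ _ gV).
split=> [[H1 H2] i|W].
  have [j [k E]] := int_ordP n1 (f i%:Z).
  have E' : f' j%:Z = i%:Z + (- k) * n%:Z.
    by rewrite -[RHS]ff' affine_permMn // E mulNr addrK.
  have := H1 j i k E; have := H2 i j (- k) E'; rewrite E => A B.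
  by apply/in_window_shift; lia.
split=> i j k E.
  by have := W j; rewrite E => /in_window_shift; lia.
have E' : f i%:Z = j%:Z + (- k) * n%:Z.
  have -> : i%:Z = f' j%:Z + (- k) * n%:Z by rewrite E mulNr addrK.
  by rewrite affine_permMn // f'f.
by have := W i; rewrite E' => /in_window_shift; lia.
Qed.

(** Up to sign, the sum of the k j is the valuation of det g = 1; it appears as two inequalities,
    from g and from g^-1. *)
Lemma permutes_shifts g f : permutes g f -> exists s k,
  [/\ injective s, forall j, f j%:Z = (s j : 'I_n)%:Z + k j * n%:Z & \sum_j k j = 0].
Proof.
move=> gf; have Af : affine_perm n f by case: gf.
have [f' [ff' f'f gV]] := permutesVe gf.
have /choice[s /choice[k sk]] : forall j, exists i k, f j%:Z = i%:Z + k * n%:Z.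
  by move=> j; apply: int_ordP.
have uniq i i' (l l' : int) : i%:Z + l * n%:Z = i'%:Z + l' * n%:Z -> i = i' /\ l = l'.
  move=> E; have iltn := ltn_ord i; have i'n := ltn_ord i'.
  have ll : l = l'.
    move: E (mulz_cases (l - l')); rewrite mulrBl; move: (l * _) (l' * _) => m m' E.
    by case; lia.
  by split=> //; apply: val_inj; move: E; rewrite ll; move/addIr => [].
exists s, k; split=> //.
  move=> j j' E; apply/eqP; rewrite -(congr_n_ord n1 j j' 0) mul0r addr0.
  rewrite -(affine_perm_congr _ _ Af) !sk E; apply/congr_nP; exists (k j - k j').
  by ring.
have w1 : weighted (fun=> 0) k g.
  apply/(permutes_weighted _ _ gf) => i j l; rewrite sk => /uniq[_ ->].
  by rewrite sub0r.
have w2 : weighted k (fun=> 0) g^-1%g.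
  apply/(permutes_weighted _ _ gV) => i j l E; rewrite subr0.
  suff /uniq[_ ->] : (s i)%:Z + k i * n%:Z = j%:Z + (- l) * n%:Z by [].
  rewrite -sk; have -> : i%:Z = f' j%:Z + (- l) * n%:Z by rewrite E mulNr addrK.
  by rewrite affine_permMn // f'f.
have S0 : \sum_(j < n) (0 : int) = 0 by rewrite big1.
have := weighted_det w1; have := weighted_det w2; rewrite !det_SL S0 => H1 H2.
have := val_ge_lconst_neq0 (oner_neq0 K) H1; have := val_ge_lconst_neq0 (oner_neq0 K) H2.
rewrite subr0 sub0r oppr_le0 => ge0 le0.
by apply/eqP; rewrite eq_le le0 ge0.
Qed.

(** The exchange puts the smaller value at the smaller position, which both half-line conditions
    tolerate. *)
Lemma half_line_transp f p q : affine_perm n f -> ~~ congr_n n p q -> p < q -> f q < f p ->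
  half_line_perm f -> half_line_perm (f \o affine_transp n p q).
Proof.
move=> Af pq plq flip H x /=; rewrite /affine_transp.
case: ifP => [/congr_nP[k ->]|_].
  have -> : p + k * n%:Z + (q - p) = q + k * n%:Z by ring.
  have := H (p + k * n%:Z); have := H (q + k * n%:Z); rewrite !affine_permMn //; lia.
case: ifP => [/congr_nP[k ->]|_]; last exact: H.
have -> : q + k * n%:Z - (q - p) = p + k * n%:Z by ring.
have := H (p + k * n%:Z); have := H (q + k * n%:Z); rewrite !affine_permMn //; lia.
Qed.

Lemma weyl_eq_permutes g h f : weyl_eq g h -> permutes h f -> permutes g f.
Proof.
move=> /(permutes_const_torus n1) T hf.
have := permutesM hf (permutesV T (fun=> erefl) (fun=> erefl)).
by rewrite invgM invgK mulVKg; apply: permutes_eq.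
Qed.

Lemma weyl_eq_refl g : weyl_eq g g.
Proof. by rewrite /weyl_eq mulVg; apply/(permutes_const_torus n1); apply: permutes1. Qed.

Lemma expressible_transp g h f p q k : permutes g f -> expressible g k ->
  ~~ congr_n n p q -> p < q -> permutes h (f \o affine_transp n p q) ->
  exists l, expressible h l.
Proof.
move=> gf /(expressibleP n1 _ gf)[w [_ wn wf]] pq plq hf.
have [w' [i [w'n iltn w'E]]] := affine_transp_word n1 pq plq.
exists (size (w ++ (w' ++ i :: rev w'))); apply/(expressibleP n1 _ hf).
exists (w ++ (w' ++ i :: rev w')); split=> //.
  by rewrite !all_cat /= all_rev wn w'n iltn.
by move=> x; rewrite word_perm_cat /= wf w'E.
Qed.

Lemma bruhat_down u w : bruhat u w -> forall f k,
  permutes w f -> half_line_perm f -> expressible w k ->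
  exists2 f', permutes u f' & half_line_perm f'.
Proof.
elim=> {w} [w uw|v w _ IH [r [rr vrw lt]]] f k wf Hf wk.
  by exists f => //; apply: weyl_eq_permutes wf.
have [|p [q [pq plq rpq]]] := reflection_permutesP n1 _ rr.
  by move=> x; apply: affine_normalizer_permutes.
have tK := affine_transpK pq.
have vrf : permutes (v * r)%g f by apply: weyl_eq_permutes wf.
have vf : permutes v (f \o affine_transp n p q).
  by have := permutesM vrf (permutesV rpq tK tK); rewrite mulgK.
have [l vl] := expressible_transp wf wk pq plq vf.
have Af : affine_perm n f by case: wf.
(* Otherwise v would invert p and q, and the exchange condition would make v longer than w. *)
have fqp : f q < f p.
  rewrite ltNge; apply/negP => le.
  have fpq : f p < f q.
    rewrite lt_neqAle le andbT; apply: contraNneq pq => E.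
    by rewrite -(affine_perm_congr _ _ Af) E congr_nxx.
  have := weyl_length_lt n1 vf vl pq plq _ rpq.
  rewrite /= affine_transpL affine_transpR // => /(_ fpq).
  by rewrite (weyl_length_eq n1 vrf wf); lia.
apply: (IH _ _ vf _ vl).
exact: half_line_transp.
Qed.

Lemma kappa_permutes :
  permutes (kappa K n d) (word_perm n (w1_word n d ++ w2_word n d)).
Proof.
rewrite /kappa; have := kappa_word_letters n1 d0 dn; rewrite all_cat => /andP[l1 l2].
have H := permutesM (word_prod_permutes K n1 l1) (word_prod_permutes K n1 l2).
by apply: permutes_eq H => x; rewrite word_perm_cat.
Qed.

Lemma kappa_expressible : exists k, expressible (kappa K n d) k.
Proof.
exists (size (w1_word n d ++ w2_word n d)); apply/(expressibleP n1 _ kappa_permutes).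
by exists (w1_word n d ++ w2_word n d); split=> //; apply: kappa_word_letters.
Qed.

Lemma kappa_window : window_perm (word_perm n (w1_word n d ++ w2_word n d)).
Proof.
move=> i; have iltn := ltn_ord i; rewrite kappa_word_perm //.
by rewrite /in_window; case: ifP => ?; [|case: ifP => ?]; split=> di; lia.
Qed.

(** [bruhat] grows at its upper end; this adds a step at the lower end. *)
Lemma step_bruhat u v w f : permutes v f -> bruhat_step u v -> bruhat v w -> bruhat u w.
Proof.
move=> vf uv; elim=> {w} [w vw|x w _ IH xw]; last exact: bruhat_trans IH xw.
have wf : permutes w f by apply/(weyl_eqP n1 _ vf).
apply: bruhat_trans (bruhat_refl (weyl_eq_refl u)) _.
case: uv => r [rr urv lt]; exists r; split=> //.
  have [f' urf] : exists f', permutes (u * r)%g f'.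
    by exists f; apply: weyl_eq_permutes urv vf.
  by apply/(weyl_eqP n1 _ (weyl_eq_permutes urv vf)).
by rewrite -(weyl_length_eq n1 vf wf).
Qed.

(** The Weyl group of P_d, a product of two symmetric groups. *)
Definition block_perm (pi : int -> int) := forall x,
  (0 <= x < d%:Z -> 0 <= pi x < d%:Z) /\ (d%:Z <= x < n%:Z -> d%:Z <= pi x < n%:Z).

Lemma block_perm_two_step y pi : permutes y pi -> block_perm pi -> two_step d y.
Proof.
move=> yp Bp; apply/two_stepP; split; apply/(permutes_weighted _ _ yp) => i j k E.
  have jn := ltn_ord j; have iltn := ltn_ord i.
  have [B1 B2] := Bp j%:Z; rewrite E in B1 B2.
  have : i%:Z + k * n%:Z < n%:Z by lia.
  by case: (mulz_cases k); lia.
have jn := ltn_ord j; have iltn := ltn_ord i.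
have [B1 B2] := Bp j%:Z; rewrite E in B1 B2.
have k0 : k = 0.
  have : 0 <= i%:Z + k * n%:Z < n%:Z by lia.
  by case: (mulz_cases k); lia.
by move: B1 B2; rewrite k0 mul0r addr0 /eps; lia.
Qed.

(** Replacing f(i), f(j) by f(j) + m, f(i) - m adds 2 m (f(j) - f(i) + m), which is positive
    precisely when m > 0 and f(i) - m < f(j), or both inequalities are reversed. *)
Definition energy f : int := \sum_(i < n) f i%:Z * f i%:Z.

Lemma energy_bound f : window_perm f -> energy f <= n%:Z * (n%:Z + n%:Z) * (n%:Z + n%:Z).
Proof.
move=> W; rewrite -mulrA -[n%:Z in X in _ <= X * _](_ : \sum_(i < n) 1 = _); last first.
  by rewrite sumr_const card_ord pmulrn intz.
rewrite mulr_suml; apply: ler_sum => i _; rewrite mul1r.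
have [W1 W2] := W i; have : - (n%:Z + n%:Z) <= f i%:Z <= n%:Z + n%:Z.
  by have [id|di] := ltnP i d; [have := W1 id|have := W2 di]; lia.
by nia.
Qed.

(** The reflection at p = i - k n and q = j. As k > 0, p lies in an earlier period than q, so f p <
    f q means that the exchange goes up. *)
Definition admissible f i j (k : int) :=
  [/\ i != j, 0 < k, f i%:Z - k * n%:Z < f j%:Z, in_window i (f j%:Z + k * n%:Z) &
      in_window j (f i%:Z - k * n%:Z)].

Lemma admissible_transp f i j k : affine_perm n f -> window_perm f ->
  admissible f i j k -> let t := affine_transp n (i%:Z - k * n%:Z) j%:Z in
  [/\ ~~ congr_n n (i%:Z - k * n%:Z) j%:Z, window_perm (f \o t) &
      energy f < energy (f \o t)].
Proof.
move=> Af W [ij k0 lt Wi Wj] t.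
have nc : ~~ congr_n n (i%:Z - k * n%:Z) j%:Z.
  by rewrite congr_n_sym -mulNr congr_n_ord // eq_sym.
have cE (l : 'I_n) : congr_n n l%:Z (i%:Z - k * n%:Z) = (l == i).
  by rewrite -mulNr congr_n_ord.
have cE' (l : 'I_n) : congr_n n l%:Z j%:Z = (l == j).
  by rewrite -(congr_n_ord n1 l j 0) mul0r addr0.
have ti : f (t i%:Z) = f j%:Z + k * n%:Z.
  by rewrite /t /affine_transp cE eqxx -affine_permMn //; congr f; ring.
have tj : f (t j%:Z) = f i%:Z - k * n%:Z.
  rewrite /t /affine_transp cE cE' eqxx eq_sym (negPf ij) -mulNr -affine_permMn //.
  by congr f; ring.
have tl l : l != i -> l != j -> f (t l%:Z) = f l%:Z.
  by move=> li lj; rewrite /t /affine_transp cE cE' (negPf li) (negPf lj).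
split=> //.
  move=> l /=; have [->|li] := eqVneq l i; first by rewrite ti.
  by have [->|lj] := eqVneq l j; [rewrite tj|rewrite tl].
rewrite /energy (bigD1 i) //= (bigD1 j) 1?eq_sym //= addrA.
rewrite [X in _ < X](bigD1 i) //= [X in _ < _ + X](bigD1 j) 1?eq_sym //= addrA.
rewrite [X in _ < _ + X](eq_bigr (fun l : 'I_n => f l%:Z * f l%:Z)); last first.
  by move=> l /andP[li lj]; rewrite tl.
rewrite ltrD2r ti tj; have kn : 0 < k * n%:Z by rewrite mulr_gt0 //; lia.
by move: (k * n%:Z) kn lt => m m0 lt; nia.
Qed.

Lemma card_le_interval (s : 'I_n -> 'I_n) (A : pred 'I_n) (a m : nat) : injective s ->
  (forall i, A i -> (a <= s i < a + m)%N) -> (#|A| <= m)%N.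
Proof.
move=> s_inj H; rewrite cardE -(size_map (fun i => nat_of_ord (s i))) -(size_iota a m).
apply: uniq_leq_size.
  by rewrite map_inj_uniq ?enum_uniq // => i j /val_inj/s_inj.
by move=> _ /mapP[i + ->]; rewrite mem_enum mem_iota => /H.
Qed.

Lemma card_sum (A : pred 'I_n) : #|A|%:Z = \sum_i (A i)%:R.
Proof.
rewrite -natz -sum1_card natr_sum big_mkcond; apply: eq_bigr => i _.
by rewrite unfold_in; case: (A i).
Qed.

Lemma card_ge_d : #|[pred i : 'I_n | (d <= i)%N]| = (n - d)%N.
Proof.
have : #|[pred i : 'I_n | (d <= i)%N]|%:Z = (n - d)%N%:Z.
  by rewrite card_sum -sum_eps //; lia.
by case.
Qed.

Lemma card_lt_d : #|[pred i : 'I_n | (i < d)%N]| = d.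
Proof.
have E : #|predC [pred i : 'I_n | (d <= i)%N]| = #|[pred i : 'I_n | (i < d)%N]|.
  by apply: eq_card => i; rewrite !inE ltnNge.
have := cardC [pred i : 'I_n | (d <= i)%N]; rewrite card_ge_d card_ord E.
by move: #|_| => c; lia.
Qed.

(* When no admissible exchange is left, the residues of the values at positions
   i < d, those of the small values, and those of the large values at positions
   j >= d are three consecutive blocks of 0, ..., n - 1, as they are for kappa. *)
Lemma terminal_residues u f : permutes u f -> window_perm f ->
  (forall i j k, ~ admissible f i j k) -> exists s k,
  [/\ forall j, f j%:Z = (s j : 'I_n)%:Z + k j * n%:Z,
      forall i, (i < d)%N -> k i = -1 /\ (s i < d)%N &
      forall i, (d <= i)%N -> (k i = 0 /\ (d <= s i < n - d)%N) \/
                              (k i = 1 /\ (n - d <= s i)%N)].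
Proof.
move=> uf W nadm; have [s [k [s_inj fE k_sum]]] := permutes_shifts uf.
have kW i : eps d i - 1 <= k i <= eps d i.
  by have := W i; rewrite fE => /in_window_shift.
have dn' : (d <= n)%N by lia.
have fD j m : f j%:Z + m * n%:Z = (s j)%:Z + (k j + m) * n%:Z by rewrite fE; ring.
have fB j m : f j%:Z - m * n%:Z = (s j)%:Z + (k j - m) * n%:Z by rewrite fE; ring.
have kd i : (i < d)%N -> k i = -1.
  move=> id; have := kW i; rewrite /eps leqNgt id /= => ki.
  have [//|ki1] := eqVneq (k i) (-1); have ki0 : k i = 0 by lia.
  have kbig j : (d <= j)%N -> k j = 1.
    move=> dj; have := kW j; rewrite /eps dj /= => kj.
    have [//|kj1] := eqVneq (k j) 1; have kj0 : k j = 0 by lia.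
    case: (nadm j i 1); split=> //.
    - by apply: contraTneq dj => ->; rewrite -ltnNge.
    - by rewrite !fE ki0 kj0; have := ltn_ord (s j); lia.
    - rewrite fD ki0; apply/in_window_shift; rewrite /eps dj; lia.
    - rewrite fB kj0; apply/in_window_shift; rewrite /eps leqNgt id; lia.
  (* Here d <= n - d is decisive: the k j would be at least -1 on the first d positions, with k i =
     0, and 1 elsewhere, so their sum would be at least n - 2 d + 1 > 0. *)
  have : \sum_j (k j - (eps d j *+ 2 - 1)) = 2 * d%:Z - n%:Z.
    rewrite sumrB sumrB k_sum sumrMnl sum_eps // sumr_const card_ord.
    by rewrite natz mulr2n; lia.
  rewrite (bigD1 i) //= ki0 /eps leqNgt id /= => E.
  have : 0 <= \sum_(j < n | j != i) (k j - ((d <= j)%N%:R *+ 2 - 1)).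
    apply: sumr_ge0 => j _; have := kW j; rewrite /eps.
    by case: leqP => dj; [rewrite kbig //; lia|lia].
  by move: E; move: (\sum_(_ < _ | _) _) => S; lia.
have kge j : (d <= j)%N -> k j = 0 \/ k j = 1.
  by move=> dj; have := kW j; rewrite /eps dj; lia.
pose big := [pred j : 'I_n | k j == 1].
have big_ge j : big j -> (d <= j)%N.
  by rewrite /= leqNgt => /eqP kj; apply/negP => /kd; rewrite kj.
(* The shifts sum to 0 and are -1 on the first d positions, so d of the others equal 1. *)
have cbig : #|big| = d.
  suff : #|big|%:Z = d%:Z by case.
  have : \sum_j (k j + 1 - eps d j) = \sum_j (big j)%:R.
    apply: eq_bigr => j _ /=; rewrite /eps; case: leqP => [/kge[]->|/kd ->] //.
  by rewrite -card_sum sumrB big_split /= k_sum sum_eps // sumr_const card_ord natz => <-; lia.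
have ineq i j (m : int) : i != j -> 0 < m -> in_window i (f j%:Z + m * n%:Z) ->
    in_window j (f i%:Z - m * n%:Z) -> f j%:Z <= f i%:Z - m * n%:Z.
  by move=> ij m0 Wi Wj; rewrite leNgt; apply/negP => lt; apply: (nadm i j m).
have s_neq i j : i != j -> s i != s j :> nat.
  by move=> ij; rewrite val_eqE (inj_eq s_inj).
have neq i j : (i < d)%N -> (d <= j)%N -> j != i.
  by move=> id; apply: contraTneq => ->; rewrite -ltnNge.
have lt_res i j (a b : int) : j != i -> a = b ->
    (s i)%:Z + a * n%:Z <= (s j)%:Z + b * n%:Z -> (s i < s j)%N.
  move=> ji ->; rewrite lerD2r lez_nat ltn_neqAle => ->; rewrite andbT.
  by rewrite s_neq // eq_sym.
have ord1 i j : (i < d)%N -> (d <= j)%N -> (s i < s j)%N.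
  move=> id dj; have ki := kd i id; have ji := neq i j id dj.
  have [kj|kj] := kge j dj.
    have := ineq j i 1 ji isT; rewrite !fB !fD !fE ki kj => H.
    apply: (lt_res _ _ _ _ ji _ (H _ _)) => //; apply/in_window_shift; rewrite /eps ?dj //.
    by rewrite leqNgt id.
  (* The shifts -1 and 1 differ by two periods, hence the exchange with k = 2. *)
  have := ineq j i 2 ji isT; rewrite !fB !fD !fE ki kj => H.
  apply: (lt_res _ _ _ _ ji _ (H _ _)) => //; apply/in_window_shift; rewrite /eps ?dj //.
  by rewrite leqNgt id.
have ord2 i j : (d <= i)%N -> k i = 0 -> big j -> (s i < s j)%N.
  move=> di ki bj; have dj := big_ge j bj; have /eqP kj := bj.
  have ji : j != i by apply: contraTneq bj => ->; rewrite /= ki.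
  have := ineq j i 1 ji isT; rewrite !fB !fD !fE ki kj => H.
  by apply: (lt_res _ _ _ _ ji _ (H _ _)) => //; apply/in_window_shift; rewrite /eps ?dj ?di.
(* Comparisons of residues become positions by counting how many residues lie above or below s i. *)
exists s, k; split=> // i di.
  split; first exact: kd.
  have := ltn_ord (s i).
  have := @card_le_interval s [pred j : 'I_n | (d <= j)%N] (s i).+1 (n - (s i).+1) s_inj.
  rewrite card_ge_d => /(_ _); rewrite -/(is_true _) => H.
  have : (n - d <= n - (s i).+1)%N.
    by apply: H => j /= dj; have := ord1 i j di dj; have := ltn_ord (s j); lia.
  by lia.
have dsi : (d <= s i)%N.
  rewrite -[X in (X <= _)%N]card_lt_d.
  by apply: (@card_le_interval s _ 0) => // j /= jd; apply: ord1.
have [ki|ki] := kge i di; [left|right]; split=> //.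
  have : (d <= n - (s i).+1)%N.
    rewrite -[X in (X <= _)%N]cbig; apply: (@card_le_interval s _ (s i).+1) => // j bj.
    by have := ord2 i j di ki bj; have := ltn_ord (s j); lia.
  by have := ltn_ord (s i); lia.
have cn : #|[predC big]| = (n - d)%N by have := cardC big; rewrite cbig card_ord; move: #|_| => c; lia.
rewrite -[X in (X <= _)%N]cn; apply: (@card_le_interval s _ 0) => // j /= nbj.
have [jd|dj] := ltnP j d; first exact: ord1.
by apply: ord2 => //=; [case: (kge j dj) => // kj; rewrite inE kj in nbj|rewrite ki].
Qed.

Lemma terminal_kappa u f : permutes u f -> window_perm f ->
  (forall i j k, ~ admissible f i j k) ->
  exists2 pi, permutes (u^-1 * kappa K n d)%g pi & block_perm pi.
Proof.
move=> uf W nadm; have [s [k [fE lt_d ge_d]]] := terminal_residues uf W nadm.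
have [f' [ff' f'f uV]] := permutesVe uf.
have Af : affine_perm n f by case: uf.
exists (f' \o word_perm n (w1_word n d ++ w2_word n d)).
  exact: permutesM uV kappa_permutes.
have H (i : 'I_n) m : word_perm n (w1_word n d ++ w2_word n d) i%:Z = i%:Z + m * n%:Z ->
    exists j, [/\ f' (i%:Z + m * n%:Z) = j%:Z + (m - k j) * n%:Z & i = s j].
  move=> _; have [j [l E]] := int_ordP n1 (f' (i%:Z + m * n%:Z)).
  have : i%:Z + m * n%:Z = (s j)%:Z + (k j + l) * n%:Z.
    by rewrite -[LHS]f'f E affine_permMn // fE mulrDl addrA.
  move=> E2; have is_ : i = s j.
    apply/eqP; rewrite -(congr_n_ord n1 i (s j) (k j + l - m)); apply/congr_nP; exists 0.
    by rewrite mulrBl addrA -E2; ring.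
  exists j; split=> //; rewrite E; congr (_ + _ * _).
  have np : n%:Z != 0 by lia.
  by move: E2; rewrite -is_ => /addrI/(mulIf np) ->; ring.
move=> x /=; split=> xd.
  have xn : (absz x < n)%N by lia.
  have xE : x = (Ordinal xn)%:Z by rewrite /=; lia.
  have kx : word_perm n (w1_word n d ++ w2_word n d) x = x + (-1) * n%:Z.
    by rewrite kappa_word_perm //; [rewrite ifT; lia|lia].
  rewrite kx; rewrite xE in kx *; have [j [-> sj]] := H _ _ kx.
  have sjd : (s j < d)%N by rewrite -sj /=; lia.
  have [jd|dj] := ltnP j d; last by case: (ge_d j dj) => -[_]; lia.
  by have [-> _] := lt_d j jd; rewrite subrr mul0r addr0; lia.
have xn : (absz x < n)%N by lia.
have xE : x = (Ordinal xn)%:Z by rewrite /=; lia.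
have xo : (Ordinal xn : nat) = absz x by [].
have [kx|kx] : word_perm n (w1_word n d ++ w2_word n d) x = x + 0 * n%:Z /\ x < (n - d)%N%:Z \/
    word_perm n (w1_word n d ++ w2_word n d) x = x + 1 * n%:Z /\ (n - d)%N%:Z <= x.
  rewrite kappa_word_perm //; last by lia.
  by rewrite ifF; [case: ifP => ?; [left|right]; split; lia|lia].
  case: kx => kx xnd; rewrite kx; rewrite xE in kx *; have [j [-> sj]] := H _ _ kx.
  have dj : (d <= j)%N.
    by rewrite leqNgt; apply/negP => /lt_d[_]; rewrite -sj xo; lia.
  have jn := ltn_ord j.
  case: (ge_d j dj) => -[-> sj']; first by rewrite subrr mul0r addr0; lia.
  by move: sj'; rewrite -sj xo; lia.
case: kx => kx xnd; rewrite kx; rewrite xE in kx *; have [j [-> sj]] := H _ _ kx.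
have dj : (d <= j)%N.
  by rewrite leqNgt; apply/negP => /lt_d[_]; rewrite -sj xo; lia.
have jn := ltn_ord j.
case: (ge_d j dj) => -[-> sj']; last by rewrite subrr mul0r addr0; lia.
by move: sj'; rewrite -sj xo; lia.
Qed.

Lemma block_perm_window pi pi' : affine_perm n pi -> cancel pi pi' -> cancel pi' pi ->
  block_perm pi -> forall i, 0 <= pi' i%:Z < n%:Z.
Proof.
move=> Ap pp' p'p Bp i; have [j [k E]] := int_ordP n1 (pi' i%:Z).
have Ei : i%:Z = pi j%:Z + k * n%:Z by rewrite -affine_permMn // -E p'p.
have [B1 B2] := Bp j%:Z; have jn := ltn_ord j; have iltn := ltn_ord i.
have pj : 0 <= pi j%:Z < n%:Z by lia.
rewrite E; case: (mulz_cases k) => -[k1 k2]; try lia.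
Qed.

Lemma reflectionJ r y : reflection r -> affine_normalizer y -> reflection (r ^ y)%g.
Proof.
move=> [i [x [iltn Nx ->]]] Ny; exists i, (x * y)%g; split; rewrite ?conjgM //.
have [f xf] := affine_normalizer_permutes n1 Nx.
have [f' yf] := affine_normalizer_permutes n1 Ny.
exact: (permutes_normalizer n1 (permutesM xf yf)).
Qed.

(* The exchanges compare positions in different blocks of n consecutive integers, so
   the order of these positions is not affected by y. *)
Lemma bruhat_up u f : permutes u f -> window_perm f -> exists y pi,
  [/\ permutes y pi, block_perm pi, exists k, expressible (u * y)%g k &
      bruhat (u * y)%g (kappa K n d)].
Proof.
pose E := n%:Z * (n%:Z + n%:Z) * (n%:Z + n%:Z).
have [m] : exists m : nat, E - energy f < m%:Z by exists (absz (E - energy f)).+1; lia.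
elim: m u f => [|m IH] u f Em uf W.
  by have := energy_bound W; rewrite -/E => ?; lia.
have [[i [j [k adm]]]|nadm] := pselect (exists i j k, admissible f i j k); last first.
  have [|pi yp Bp] := terminal_kappa uf W.
    by move=> i j k adm; apply: nadm; exists i, j, k.
  exists (u^-1 * kappa K n d)%g, pi; rewrite mulVKg; split=> //.
    exact: kappa_expressible.
  exact/bruhat_refl/weyl_eq_refl.
have Af : affine_perm n f by case: uf.
have [nc W' lt] := admissible_transp Af W adm; case: adm => ij k0 flt _ _.
set p := i%:Z - k * n%:Z in nc W' lt flt; set q := j%:Z in nc W' lt flt.
have pn : n%:Z <= k * n%:Z by case: (mulz_cases k) => -[]; lia.
have plq : p < q by have := ltn_ord i; rewrite /p /q; move: (k * _) pn => *; lia.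
have [r rr rpq] := reflection_permutes K n1 nc plq.
have [|y [pi [yp Bp [l El] Br]]] := IH _ _ _ (permutesM uf rpq) W'; first by lia.
have [pi' [pp' p'p yV]] := permutesVe yp.
have Ap' : affine_perm n pi' by case: yV.
have Ap : affine_perm n pi by case: yp.
have fpq : f p < f q by rewrite /p -mulNr affine_permMn // mulNr.
pose P := pi' p; pose Q := pi' q.
have ncPQ : ~~ congr_n n P Q by rewrite affine_perm_congr.
have PQ : P < Q.
  have wi := block_perm_window Ap pp' p'p Bp i; have wj := block_perm_window Ap pp' p'p Bp j.
  rewrite /P /p -mulNr affine_permMn // mulNr -/Q.
  by move: (k * _) pn wi wj => M; rewrite -/Q; lia.
have tK := affine_transpK nc.
have tpi x : pi (affine_transp n P Q x) = affine_transp n p q (pi x).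
  by rewrite affine_transp_conj // /P /Q !p'p.
have rJ : permutes (r ^ y)%g (affine_transp n P Q).
  have := permutesM yV (permutesM rpq yp); rewrite conjgE; apply: permutes_eq => x /=.
  by rewrite affine_transp_conj // pp'.
have uy := permutesM uf yp; have ury := permutesM (permutesM uf rpq) yp.
have [l' El'] : exists l', expressible (u * y)%g l'.
  apply: (expressible_transp ury El ncPQ PQ).
  by apply: permutes_eq uy => x /=; rewrite tpi tK.
exists y, pi; split=> //; first by exists l'.
(* Conjugation carries the exchange past y: u y r^y = u r y. *)
apply: (step_bruhat ury _ Br); exists (r ^ y)%g; split.
- by apply: (reflectionJ rr (permutes_normalizer n1 yp)).
- rewrite (_ : (u * y * r ^ y)%g = (u * r * y)%g); first exact: weyl_eq_refl.
  by rewrite conjgE !mulgA mulgK.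
have flip : (f \o affine_transp n p q \o pi) Q < (f \o affine_transp n p q \o pi) P.
  by rewrite /= /P /Q !p'p affine_transpL affine_transpR.
have uryr : permutes (u * r * y * r ^ y)%g (f \o pi).
  have := permutesM ury rJ; apply: permutes_eq => x /=.
  by rewrite tpi tK.
by have := weyl_length_lt n1 ury El ncPQ PQ flip rJ; rewrite (weyl_length_eq n1 uryr uy).
Qed.

Lemma schubert_kappa : @schubert K n d (kappa K n d) = @grassmannian_locus K n d.
Proof.
apply/seteqP; split=> [_ [tau [_ Bt] [b Ib [q Qq <-]]]|_ [g Zg ->]].
  apply/grassmannian_locusP; apply: over_grassmannianM; first by case: Ib.
    exact: two_step_stab.
  have [k Ek] := kappa_expressible.
  have Ak : affine_perm n (word_perm n (w1_word n d ++ w2_word n d)).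
    exact: word_perm_affine.
  have [f tf Hf] := bruhat_down Bt kappa_permutes (iffLR (window_permP Ak) kappa_window) Ek.
  have Af : affine_perm n f by case: tf.
  by apply/(over_grassmannian_window tf)/(window_permP Af).
have [b [tau [q [f [/iwahoriP Ib /iwahoriP Iq tf gE]]]]] := bruhat_decomposition n1 g.
have Zt : over_grassmannian d tau.
  have -> : tau = (b^-1 * g * q^-1)%g by rewrite gE mulgA mulKg mulgK.
  apply: over_grassmannianM => //.
    by have := two_stepV (Ib d); case.
  by apply: two_step_stab; apply: two_stepV.
have [y [pi [yp Bp _ By]]] := bruhat_up tf (iffLR (over_grassmannian_window tf) Zt).
(* The factor y lies in Q, so tau y has the same image as tau in the flag variety, and it lies below
   [kappa]. *)
exists (tau * y)%g.
  by split=> //; apply: (permutes_normalizer n1 (permutesM tf yp)).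
exists b; first exact/iwahoriP.
exists (y^-1 * q)%g; last by rewrite gE !mulgA mulgK.
by apply: two_stepM => //; apply: two_stepV; apply: (block_perm_two_step yp Bp).
Qed.

End SchubertLocus.

Local Open Scope classical_set_scope.

Theorem theorem5p2 (R : realType) (n d : nat) (hn : 2 <= n)
    (hd : 1 <= d <= n - 1) (hdn : d <= n - d) :
  closure (range (@phi R[i] n d)) = @schubert R[i] n d (@kappa R[i] n d).
Proof.
have [d0 _] := andP hd; rewrite schubert_kappa //.
have [e [e0 ne]] : exists e, 0 < e /\ n = (d + e)%N by exists (n - d); lia.
by subst n; apply: closure_range_phi.
Qed.
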